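(* Let $u_0\in H_3$, let $T>0$ be a finite time, and let $u\in C([0,T];H_3)$ be the solution of the Euler equations $$\partial_t u+(u\cdot\nabla)u+\nabla p=0,\qquad \nabla\cdot u=0,$$ on $[0,T]\times\mathbb{T}$ with $u(0)=u_0$. Let $(u_0^\beta)_{\beta>0}$ be a family of initial data such that (i) $u_0^\beta\in H_4$ for every $\beta>0$; (ii) $\|u_0^\beta-u_0\|_{H_3}\to 0$ as $\beta\to 0$. For $\alpha,\beta,\nu>0$ let $u^{\alpha,\beta,\nu}$ be the solution of the Navier-Stokes-Voigt equations $$\partial_t u^{\alpha,\beta,\nu}-\alpha^2\partial_t\Delta u^{\alpha,\beta,\nu}+(u^{\alpha,\beta,\nu}\cdot\nabla)u^{\alpha,\beta,\nu}-\nu\Delta u^{\alpha,\beta,\nu}+\nabla p^{\alpha,\beta,\nu}=0,\qquad \nabla\cdot u^{\alpha,\beta,\nu}=0,$$ on $[0,T]\times\mathbb{T}$ with $u^{\alpha,\beta,\nu}(0)=u_0^\beta$. Then for every choice of positive sequences $\{\beta_n\}$ and $\{\nu_n\}$, both converging to zero as $n\to\infty$, there exists a positive sequence $\{\alpha_n\}$ converging to zero as $n\to\infty$ such that $$\sup_{0<t<T}\|u^{\alpha_n,\beta_n,\nu_n}(t)-u(t)\|_{H_3}\to 0\qquad\text{as } n\to\infty.$$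
   Context: Space-periodic setting: $\mathbb{T}=\mathbb{R}^3/(2\pi\mathbb{Z})^3$ is the three-dimensional torus, velocities and pressures are periodic with zero mean, and there is no external force. For $s\ge 0$, $$H_s=\Big\{w=\sum_{k\in\mathbb{Z}^3\setminus\{0\}}\widehat w_k e^{ik\cdot x}\ :\ \sum_{k\ne0}|k|^{2s}|\widehat w_k|^2<\infty,\ k\cdot\widehat w_k=0,\ \widehat w_{-k}=\overline{\widehat w_k}\Big\}$$ (with $\widehat w_k\in\mathbb{C}^3$) is the space of real, zero-mean, divergence-free periodic vector fields of Sobolev class $H^s$, with norm $\|w\|_{H_s}^2=\sum_{k\neq 0}|k|^{2s}|\widehat w_k|^2$. For $\alpha,\nu>0$ and an initial datum in $H_4$, the solution of the Navier-Stokes-Voigt equations is understood as the regular solution in $C^1([0,T];H_4)$. *)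

(* Defs.v *)
From HB Require Import structures.
From mathcomp Require Import all_boot all_order all_algebra.
From mathcomp Require Export all_classical all_reals all_analysis.
From mathcomp Require Export complex.

Set Implicit Arguments.
Unset Strict Implicit.
Unset Printing Implicit Defensive.

Import Order.TTheory GRing.Theory Num.Theory.
Import numFieldNormedType.Exports.

Local Open Scope classical_set_scope.
Local Open Scope complex_scope.
Local Open Scope ring_scope.

(* A C^n-valued periodic function (or distribution) on the torus
   R^3/(2 pi Z)^3 is represented by its family of Fourier coefficients
   k |-> w_k; n = 3 for velocities and n = 1 for pressures. *)
Notation coeffs R n := ('rV[int]_3 -> 'rV[R[i]]_n).

Section FourierSeries.
Variable R : realType.
Implicit Types (k : 'rV[int]_3) (x : 'rV[R]_3) (s T t : R).

Definition sqlen k : R := \sum_j (k 0 j)%:~R ^+ 2.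

Definition dotk k x : R := \sum_j (k 0 j)%:~R * x 0 j.

Definition sqnorm n (z : 'rV[R[i]]_n) : R :=
  \sum_j ComplexField.Normc.normc (z 0 j) ^+ 2.

(* (sum_{k != 0} |k|^(2s) |w_k|^2)^(1/2), equal to +oo when the sum diverges *)
Definition hnorm n s (w : coeffs R n) : \bar R :=
  sqrte (\esum_(k in [set k : 'rV[int]_3 | k != 0])
           (sqlen k `^ s * sqnorm (w k))%:E).

(* Real, zero-mean periodic functions of class H^s. *)
Definition sobolev0 n s (w : coeffs R n) : Prop :=
  [/\ w 0 = 0, forall k j, w (- k) 0 j = (w k 0 j)^*
    & (hnorm s w < +oo)%E].

(* The space H_s. *)
Definition Hs s (w : coeffs R 3) : Prop :=
  sobolev0 s w /\ forall k, \sum_j (k 0 j)%:~R * w k 0 j = 0.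

(* Sum of an absolutely summable family of real numbers. *)
Definition usum (I : choiceType) (f : I -> R) : R :=
  fine (\esum_(i in [set: I]) ((EFin \o f)^\+ i)
        - \esum_(i in [set: I]) ((EFin \o f)^\- i))%E.

(* The j-th component of sum_k w_k e^(i k.x).  Only real parts are summed, as
   the imaginary parts cancel by w_(-k) = conj w_k.  The series is absolutely
   convergent for every w of class H^s with s > 3/2. *)
Definition realize n (w : coeffs R n) (j : 'I_n) (x : 'rV[R]_3) : R :=
  usum (fun k => complex.Re (w k 0 j * (cos (dotk k x) +i* sin (dotk k x)))).

(* The partial derivative d/dx_i, in the classical pointwise sense. *)
Definition pder (i : 'I_3) (f : 'rV[R]_3 -> R) (x : 'rV[R]_3) : R :=
  'D_('e_i) (f : 'rV[R]_3 -> R^o) x.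

Definition laplacian (f : 'rV[R]_3 -> R) (x : 'rV[R]_3) : R :=
  \sum_i pder i (pder i f) x.

(* The j-th component of (w . grad) w. *)
Definition convection (w : coeffs R 3) (j : 'I_3) (x : 'rV[R]_3) : R :=
  \sum_i realize w i x * pder i (realize w j) x.

(* u \in C([0,T]; H_s) *)
Definition C0Hs T s (u : R -> coeffs R 3) : Prop :=
  (forall t, t \in `[0, T] -> Hs s (u t)) /\
  (forall t, t \in `[0, T] ->
     (fun r => hnorm s (u r - u t)) @ within `[0, T] (nbhs t) --> 0%E).

(* u \in C^1([0,T]; H_s), with time derivative du (one-sided at 0 and T) *)
Definition C1Hs T s (u du : R -> coeffs R 3) : Prop :=
  [/\ C0Hs T s u, C0Hs T s du
    & forall t, t \in `[0, T] ->
      (fun r => hnorm s (((r - t)^-1)%:C *: (u r - u t) - du t))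
        @ within `[0, T] t^' --> 0%E].

(* For u in C([0,T]; H_3) the equation forces d_t u in C([0,T]; H_2) and
   p(t) in H^3, all three terms of the momentum equation being of class H^2;
   they are therefore continuous functions of x and the equation can be
   stated pointwise.  The constraint div u = 0 is part of Hs. *)
Definition euler_solution T (u0 : coeffs R 3) (u : R -> coeffs R 3) : Prop :=
  [/\ u 0 = u0, C0Hs T 3 u
    & exists (du : R -> coeffs R 3) (p : R -> coeffs R 1),
      [/\ C1Hs T 2 u du,
          forall t, t \in `[0, T] -> sobolev0 3 (p t)
        & forall t, t \in `[0, T] -> forall (x : 'rV[R]_3) (j : 'I_3),
            realize (du t) j x + convection (u t) j x
              + pder j (realize (p t) 0) x = 0]].

(* In C^1([0,T]; H_4) the time derivative commutes with the Laplacian, so that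
   d_t (Laplacian u) is the Laplacian of du. *)
Definition nsv_solution (alpha nu : R) T (u0 : coeffs R 3)
    (u : R -> coeffs R 3) : Prop :=
  u 0 = u0 /\
  exists (du : R -> coeffs R 3) (p : R -> coeffs R 1),
    [/\ C1Hs T 4 u du,
        forall t, t \in `[0, T] -> sobolev0 3 (p t)
      & forall t, t \in `[0, T] -> forall (x : 'rV[R]_3) (j : 'I_3),
          realize (du t) j x - alpha ^+ 2 * laplacian (realize (du t) j) x
            + convection (u t) j x - nu * laplacian (realize (u t) j) x
            + pder j (realize (p t) 0) x = 0].

End FourierSeries.

(* Main.v *)
Require Import Defs.
From mathcomp Require Import all_boot all_order all_algebra.
From mathcomp Require Import finmap.
From mathcomp Require Import all_classical all_reals all_analysis.
From mathcomp Require Import complex.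
From mathcomp Require Import ring lra.

Set Implicit Arguments.
Unset Strict Implicit.
Unset Printing Implicit Defensive.

Import Order.TTheory GRing.Theory Num.Theory.
Import numFieldNormedType.Exports.

Local Open Scope classical_set_scope.
Local Open Scope ring_scope.

(** The Voigt solution v and the Euler solution u cannot be compared directly
    in H^3: the energy estimate for v - u contains (v - u).grad u, which
    requires one derivative of u more than H^3 provides.  So v is compared with
    a = cut_N u, where the Fourier multiplier cut_N is 1 on frequencies up to
    N, 0 beyond 2N and 1/N-Lipschitz in between.  The price is a factor N, since
    |a|_(H^4) <= 2N |u|_(H^3); it is absorbed by measuring w = v - a with the
    weight omega(r) = r^2 (r + N), that is by the energy
      E = sum_k omega(|k|)^2 (1 + alpha^2 |k|^2) |w_k|^2,
    which controls |w|_(H^3)^2 + N^2 |w|_(H^2)^2.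

    The time derivative of E has five kinds of terms.
    - v.grad w : the bilinear form is antisymmetric in the two frequencies
      because div v = 0, so only the commutator of the weight omega^2 remains
      and no derivative is lost ([transport_antisym]).
    - w.grad a : here the factor N meets |w|_(H^2), which omega controls with
      the matching factor 1/N ([transport_trunc]).
    - cut_N (u.grad u) - a.grad a : a Friedrichs commutator.  It only involves
      frequencies of u above N/2 and is of size tau, the H^3 norm of that part
      of u ([truncation_error]).
    - viscosity and Voigt regularization acting on a : they cost powers of N,
      but carry the coefficients nu and alpha^2 ([viscous_error]).
    - the dissipation of w has the favourable sign, and the pressures vanish
      against the divergence-free w ([hdot_wave]).
    Altogether E' <= C (1 + E) (E + eta), where C depends only on the supremum
    of |u|_(H^3), and eta collects tau, nu and alpha^2 with their
    coefficients.  The quotient (E + eta) / (1 + E) then satisfies a linear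
    Gronwall inequality, hence E <= 2 (E(0) + eta) exp(CT) as soon as the
    right-hand side is at most 1 ([gronwall_rational]). Since u is continuous in
    time with values in H^3, tau tends to 0 as N tends to infinity, uniformly in
    time ([high_frequencies]). One chooses N first, and with N fixed lets beta
    and nu tend to 0 ([uniform_stability]). The initial energy contains alpha^2
    |u0^beta|_(H^4)^2, which may be large for small beta, and this alone
    dictates how small alpha_n must be.

    The estimates are carried out on Fourier coefficients and finite sums: a
    norm bound is a bound on all finite partial sums ([l1le], [l2le]), and the
    energy is restricted to a finite set A of modes, so that it can be
    differentiated term by term.  The antisymmetry then fails for pairs with
    one frequency outside A; the defect is controlled by the H^4 tail of w,
    which is finite for each fixed N and can be made small uniformly in time by
    the choice of A ([transport_tail], [difference_tail]).  The ordinary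
    differential equations satisfied by the coefficients are obtained from the
    pointwise equations by averaging over finer and finer grids
    ([product_modes]). *)

(** * Finite sums and discrete Young inequalities *)

Lemma fset_sum_split (V : nmodType) (I : choiceType) (A B : {fset I}) (f : I -> V) :
  \sum_(k <- B) f k = \sum_(k <- (B `&` A)%fset) f k
                    + \sum_(k <- (B `\` A)%fset) f k.
Proof.
rewrite (big_fsetID _ (mem A))/=; congr (_ + _); apply: eq_fbigl => x;
by rewrite !inE/= // andbC.
Qed.

Section FiniteSums.
Variables (R : realType) (I : choiceType).
Implicit Types (f g : I -> R) (A B : {fset I}) (X Y Z : R).

(** Bounds on sums over the whole index type, expressed without infinite sums
    by bounding every finite partial sum. *)
Definition l1le f X : Prop := forall A, \sum_(k <- A) f k <= X.
Definition l2le f X : Prop := 0 <= X /\ l1le (fun k => f k ^+ 2) (X ^+ 2).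

Lemma l1le_ge0 f X : l1le f X -> 0 <= X.
Proof. by move=> /(_ fset0); rewrite big_seq_fset0. Qed.

Lemma le_l1le f g X Y : (forall k, g k <= f k) -> X <= Y -> l1le f X -> l1le g Y.
Proof.
move=> gf XY fX A; apply: le_trans XY; apply: le_trans (fX A).
by apply: ler_sum => i _; exact: gf.
Qed.

Lemma ler_sum_fset f A B : (A `<=` B)%fset -> (forall k, 0 <= f k) ->
  \sum_(k <- A) f k <= \sum_(k <- B) f k.
Proof.
move=> AB f0; rewrite [leRHS](big_fsetID _ (mem A))/=.
have -> : [fset x in B | x \in A]%fset = A.
  apply/fsetP => x; rewrite !inE/=; apply/andP/idP => [[]//|xA].
  by split=> //; exact: (fsubsetP AB).
by rewrite lerDl sumr_ge0.
Qed.

Lemma le_l2le f g X Y : (forall k, 0 <= g k <= f k) -> X <= Y ->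
  l2le f X -> l2le g Y.
Proof.
move=> gf XY [X0 fX]; split; first exact: le_trans XY.
apply: le_l1le fX; last by rewrite lerXn2r// nnegrE// (le_trans X0).
by move=> k; have /andP[g0 gf'] := gf k; rewrite lerXn2r// nnegrE (le_trans g0).
Qed.

(** By induction on the sequence: the cross term [2 S (f k * g k)] is absorbed
    because [4 F G x^2 y^2 <= (F y^2 + G x^2)^2]. *)
Lemma cauchy_schwarz_sum (s : seq I) f g :
  (\sum_(k <- s) f k * g k) ^+ 2 <=
  (\sum_(k <- s) f k ^+ 2) * (\sum_(k <- s) g k ^+ 2).
Proof.
elim: s => [|k s IH]; first by rewrite !big_nil expr0n/= mulr0.
rewrite !big_cons.
set S := \sum_(_ <- _) _ in IH *; set F := \sum_(_ <- _) _ in IH *.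
set G := \sum_(_ <- _) _ in IH *.
have F0 : 0 <= F by apply: sumr_ge0 => i _; exact: sqr_ge0.
have G0 : 0 <= G by apply: sumr_ge0 => i _; exact: sqr_ge0.
have cross : 2 * S * (f k * g k) <= F * g k ^+ 2 + G * f k ^+ 2.
  apply: le_trans (ler_norm _) _.
  have FG0 : 0 <= F * g k ^+ 2 + G * f k ^+ 2.
    by rewrite addr_ge0//; apply: mulr_ge0 => //; exact: sqr_ge0.
  rewrite -ler_sqr ?nnegrE ?normr_ge0//.
  rewrite real_normK ?num_real//.
  have h1 : (2 * S * (f k * g k)) ^+ 2 <= 4 * (F * G) * (f k * g k) ^+ 2.
    rewrite exprMn ler_wpM2r ?sqr_ge0// exprMn.
    have -> : (2 : R) ^+ 2 = 4 by rewrite -natrX.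
    by rewrite ler_pM2l.
  apply: le_trans h1 _; rewrite -subr_ge0.
  rewrite (_ : _ - _ = (F * g k ^+ 2 - G * f k ^+ 2) ^+ 2) ?sqr_ge0//; ring.
rewrite -subr_ge0.
have -> : (f k ^+ 2 + F) * (g k ^+ 2 + G) - (f k * g k + S) ^+ 2 =
  (F * G - S ^+ 2) + (F * g k ^+ 2 + G * f k ^+ 2 - 2 * S * (f k * g k)) by ring.
by rewrite addr_ge0// subr_ge0.
Qed.

End FiniteSums.

Section FiniteSums2.
Variables (R : realType) (I J : choiceType).

Lemma l1le_inj (f : I -> R) X (h : J -> I) (s : {fset J}) : injective h ->
  l1le f X -> \sum_(k <- s) f (h k) <= X.
Proof.
move=> hinj fX; have := fX [fset h x | x in s]%fset.
by rewrite big_imfset//= => x y _ _; exact: hinj.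
Qed.

Lemma l2le_mul_inj (f : I -> R) (g : I -> R) X Y (h h' : J -> I) :
  injective h -> injective h' -> l2le f X -> l2le g Y ->
  l1le (fun k => f (h k) * g (h' k)) (X * Y).
Proof.
move=> hi hi' [X0 fX] [Y0 gY] s.
apply: le_trans (ler_norm _) _.
rewrite -ler_sqr ?nnegrE ?mulr_ge0// real_normK ?num_real//.
have /le_trans -> // := cauchy_schwarz_sum s (fun k => f (h k)) (fun k => g (h' k)).
rewrite exprMn ler_pM//; try by apply: sumr_ge0 => i _; exact: sqr_ge0.
- exact: (l1le_inj (f := fun k => f k ^+ 2)).
- exact: (l1le_inj (f := fun k => g k ^+ 2)).
Qed.

End FiniteSums2.

Lemma l2le_mul (R : realType) (I : choiceType) (f g : I -> R) X Y :
  l2le f X -> l2le g Y -> l1le (fun k => f k * g k) (X * Y).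
Proof. by move=> fX gY; apply: (@l2le_mul_inj R I I f g X Y id id). Qed.

Section Young.
Variables (R : realType) (K : zmodType).
Implicit Types (x y z : K -> R) (A B : {fset K}) (X Y Z : R).

(** The three digits of [young212] and [young122] are the summability exponents
    of the three sequences.  Here [y] is summable, and for each fixed [l] the
    sum over [m] is an inner product of [z] with a translate of [x]. *)
Lemma young212 x y z X Y Z A B :
  (forall k, 0 <= x k) -> (forall k, 0 <= y k) -> (forall k, 0 <= z k) ->
  l2le x X -> l1le y Y -> l2le z Z ->
  \sum_(m <- A) \sum_(l <- B) x (m - l) * y l * z m <= X * Y * Z.
Proof.
move=> x0 y0 z0 xX yY zZ; rewrite exchange_big/=.
have -> : X * Y * Z = (X * Z) * Y by ring.
apply: (@le_trans _ _ (\sum_(l <- B) (X * Z) * y l)); last first.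
  by rewrite -mulr_sumr ler_wpM2l// mulr_ge0; [|case: xX|case: zZ].
apply: ler_sum => l _.
under eq_bigr do rewrite mulrAC.
rewrite -mulr_suml ler_wpM2r//.
have := @l2le_mul_inj R K K x z X Z (fun m => m - l) id.
by move=> /(_ _ _ xX zZ); apply => // a b /addIr.
Qed.

(** Reduced to the previous situation by summing over [k = m - l] instead of
    [l]; the differences range over the finite set [D]. *)
Lemma young122 x y z X Y Z A B :
  (forall k, 0 <= x k) -> (forall k, 0 <= y k) -> (forall k, 0 <= z k) ->
  l1le x X -> l2le y Y -> l2le z Z ->
  \sum_(m <- A) \sum_(l <- B) x (m - l) * y l * z m <= X * Y * Z.
Proof.
move=> x0 y0 z0 xX yY zZ.
pose D := [fset m - l | m in A, l in B]%fset.
apply: (@le_trans _ _ (\sum_(m <- A) \sum_(k <- D) x k * y (m - k) * z m)).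
  rewrite big_seq [leRHS]big_seq; apply: ler_sum => m mA.
  have -> : \sum_(l <- B) x (m - l) * y l * z m =
      \sum_(k <- [fset m - l | l in B]%fset) x k * y (m - k) * z m.
    rewrite big_imfset//=; first by apply: eq_bigr => l _; rewrite subKr.
    by move=> a b _ _ /addrI/oppr_inj.
  apply: ler_sum_fset; last by move=> k; rewrite !mulr_ge0.
  apply/fsubsetP => k /imfsetP[l/= lB ->]; apply/imfset2P.
  by exists m => //; exists l.
rewrite exchange_big/=.
have -> : X * Y * Z = (Y * Z) * X by ring.
apply: (@le_trans _ _ (\sum_(k <- D) (Y * Z) * x k)); last first.
  by rewrite -mulr_sumr ler_wpM2l// mulr_ge0; [|case: yY|case: zZ].
apply: ler_sum => l _.
under eq_bigr do rewrite -mulrA.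
rewrite -mulr_sumr [leRHS]mulrC ler_wpM2l//.
have := @l2le_mul_inj R K K y z Y Z (fun m => m - l) id.
by move=> /(_ _ _ yY zZ); apply => // a b /addIr.
Qed.

End Young.

(** * Sums over the lattice of wavenumbers *)

Section Subsums.
Variable R : realType.

Lemma ler_sum_subseq (I : eqType) (s t : seq I) (F : I -> R) :
  uniq s -> {subset s <= t} -> (forall k, 0 <= F k) ->
  \sum_(k <- s) F k <= \sum_(k <- t) F k.
Proof.
move=> + + F0; elim: s t => [|x s IH] t /=.
  by move=> _ _; rewrite big_nil sumr_ge0.
move=> /andP[xs us] st; have xt : x \in t by apply: st; rewrite mem_head.
rewrite big_cons (big_rem x xt)/= lerD2l; apply: IH => // y ys.
have := st y; rewrite inE ys orbT => /(_ isT) yt.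
rewrite (perm_mem (perm_to_rem xt)) inE in yt; case/orP: yt => // /eqP yx.
by rewrite -yx ys in xs.
Qed.

Lemma l1le_prod (I J : choiceType) (f : I -> R) (g : J -> R) (X Y : R) :
  (forall k, 0 <= f k) -> (forall k, 0 <= g k) -> l1le f X -> l1le g Y ->
  l1le (fun p : I * J => f p.1 * g p.2) (X * Y).
Proof.
move=> f0 g0 fX gY A.
pose P1 := [fset p.1 | p in A]%fset; pose P2 := [fset p.2 | p in A]%fset.
apply: (@le_trans _ _ (\sum_(p <- [seq (a, b) | a <- P1, b <- P2]) f p.1 * g p.2)).
  apply: ler_sum_subseq; rewrite ?fset_uniq//.
    move=> p pA; apply/allpairsP; exists p; split => //; last by case: (p).
      by apply/imfsetP; exists p.
    by apply/imfsetP; exists p.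
  by move=> k; exact: mulr_ge0.
rewrite big_allpairs/=.
under eq_bigr do rewrite -mulr_sumr.
rewrite -mulr_suml; apply: ler_pM => //; exact: sumr_ge0.
Qed.

End Subsums.

Section LatticeSum.
Variable R : realType.

(** The one-dimensional weight (n + 1)^(-4/3) is the fourth power of this one:
    three such weights multiply to a bound of |k|^(-4). *)
Definition icbrt (n : nat) : R := n.+1%:R `^ (- 3^-1).

Lemma icbrt_gt0 n : 0 < icbrt n.
Proof. by rewrite powR_gt0. Qed.

Lemma icbrt3 n : icbrt n ^+ 3 = n.+1%:R^-1.
Proof.
rewrite -powR_mulrn ?powR_ge0// /icbrt -powRrM mulNr mulVf// powR_inv1//.
Qed.

Lemma icbrt_le n : icbrt n.+1 <= icbrt n.
Proof.
rewrite -(@ler_pXn2r _ 3)//; last 2 first.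
- by rewrite nnegrE ltW// icbrt_gt0.
- by rewrite nnegrE ltW// icbrt_gt0.
by rewrite !icbrt3 lef_pV2 ?posrE// ler_nat.
Qed.

(** With [x = icbrt n] and [y = icbrt n.+1], the numbers [x^-3] and [y^-3]
    differ by 1, so [x^3 - y^3 = x^3 y^3]; factorizing the left-hand side and
    dividing by [x^2] gives [x y^3 <= 3 (x - y)].  This makes the sum of the
    fourth powers telescope. *)
Lemma icbrt_telescope n : icbrt n.+1 ^+ 4 <= 3 * (icbrt n - icbrt n.+1).
Proof.
set x := icbrt n; set y := icbrt n.+1.
have x0 : 0 < x := icbrt_gt0 n.
have y0 : 0 < y := icbrt_gt0 n.+1.
have yx : y <= x := icbrt_le n.
have diff : x ^+ 3 - y ^+ 3 = x ^+ 3 * y ^+ 3.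
  rewrite !icbrt3; set a : R := n.+1%:R.
  have -> : n.+2%:R = a + 1 by rewrite /a -natr1.
  have a0 : 0 < a by rewrite ltr0n.
  by field; lra.
have h1 : x ^+ 3 * y ^+ 3 <= (x - y) * (3 * x ^+ 2).
  rewrite -diff; have -> : x ^+ 3 - y ^+ 3 = (x - y) * (x ^+ 2 + x * y + y ^+ 2) by ring.
  apply: ler_wpM2l; first lra.
  by nra.
have h2 : x * y ^+ 3 <= 3 * (x - y).
  have x2 : 0 < x ^+ 2 by apply: exprn_gt0.
  rewrite -(ler_pM2r x2); lra.
apply: le_trans h2; rewrite exprS ler_wpM2r// exprn_ge0//; lra.
Qed.

Lemma l1le_icbrt4 : l1le (fun n => icbrt n ^+ 4) 4.
Proof.
have part n : \sum_(k < n.+1) icbrt k ^+ 4 <= 4 - 3 * icbrt n.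
  elim: n => [|n IH].
    by rewrite big_ord1 /icbrt powR1 expr1n; lra.
  rewrite big_ord_recr/=; have := icbrt_telescope n; lra.
move=> A; pose M := \max_(i <- A) i.
apply: (@le_trans _ _ (\sum_(k <- iota 0 M.+1) icbrt k ^+ 4)).
  apply: ler_sum_subseq; rewrite ?fset_uniq//.
    move=> k kA; rewrite mem_iota/= add0n ltnS /M.
    by apply: (@leq_bigmax_seq _ _ _ (fun i => i)).
  by move=> k; rewrite exprn_ge0// ltW// icbrt_gt0.
rewrite -[iota _ _]/(index_iota 0 M.+1) big_mkord.
apply: le_trans (part M) _; have := icbrt_gt0 M; lra.
Qed.

Definition zweight (a : int) : R := icbrt `|a|%N ^+ 4.

Lemma zweight_gt0 a : 0 < zweight a.
Proof. by rewrite exprn_gt0// icbrt_gt0. Qed.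

Lemma l1le_zweight : l1le zweight 8.
Proof.
move=> A; pose P := [fset `|a|%N | a in A]%fset.
apply: (@le_trans _ _ (\sum_(k <- [seq (n%:Z : int) | n <- P]
  ++ [seq (- (n%:Z) : int) | n <- P])
    zweight k)).
  apply: ler_sum_subseq; rewrite ?fset_uniq//; last by move=> k; exact/ltW/zweight_gt0.
  move=> a aA; have aP : `|a|%N \in P by apply/imfsetP; exists a.
  rewrite mem_cat; apply/orP; case: (leP 0 a) => a0.
    by left; apply/mapP; exists `|a|%N => //; rewrite gez0_abs.
  by right; apply/mapP; exists `|a|%N => //; rewrite ltz0_abs// opprK.
rewrite big_cat !big_map/=; under [X in _ + X]eq_bigr do rewrite /zweight abszN.
have := l1le_icbrt4 P; rewrite /zweight /=; lra.
Qed.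
End LatticeSum.

Section Wavenumber.
Variable R : realType.
Implicit Types k l m : 'rV[int]_3.

Definition len k : R := Num.sqrt (sqlen R k).

Lemma sqlen_ge0 k : 0 <= sqlen R k.
Proof. by apply: sumr_ge0 => j _; exact: sqr_ge0. Qed.

Lemma len_ge0 k : 0 <= len k. Proof. exact: sqrtr_ge0. Qed.

Lemma len_sqr k : len k ^+ 2 = sqlen R k.
Proof. by rewrite sqr_sqrtr// sqlen_ge0. Qed.

Lemma len0 : len 0 = 0.
Proof.
by rewrite /len /sqlen big1 ?sqrtr0// => j _; rewrite mxE expr0n.
Qed.

Lemma lenN k : len (- k) = len k.
Proof.
by congr Num.sqrt; apply: eq_bigr => j _; rewrite mxE rmorphN/= sqrrN.
Qed.

Lemma coord_len k j : `|(k 0 j)%:~R| <= len k.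
Proof.
rewrite -ler_sqr ?nnegrE ?len_ge0// len_sqr real_normK ?num_real//.
by rewrite /sqlen (bigD1 j)//= lerDl sumr_ge0// => i _; exact: sqr_ge0.
Qed.

Lemma len_ge1 k : k != 0 -> 1 <= len k.
Proof.
move=> /rV0Pn[j kj]; apply: le_trans (coord_len k j).
by rewrite -intr_norm ler1z -gtz0_ge1 normr_gt0.
Qed.

Lemma lenD k l : len (k + l) <= len k + len l.
Proof.
rewrite -ler_sqr ?nnegrE ?addr_ge0 ?len_ge0// sqrrD !len_sqr.
have -> : sqlen R (k + l) = sqlen R k + 2 * (\sum_j (k 0 j)%:~R * (l 0 j)%:~R) + sqlen R l.
  rewrite /sqlen mulr_sumr -!big_split/=; apply: eq_bigr => j _.
  by rewrite mxE rmorphD/=; ring.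
rewrite lerD2r lerD2l -[leRHS]mulr_natl ler_wpM2l//.
apply: le_trans (ler_norm _) _.
rewrite -ler_sqr ?nnegrE ?mulr_ge0 ?len_ge0// real_normK ?num_real// exprMn !len_sqr.
exact: cauchy_schwarz_sum.
Qed.

Lemma lenB_dist m l : `|len m - len l| <= len (m - l).
Proof.
rewrite ler_norml; apply/andP; split.
  have := lenD m (l - m); rewrite addrC subrK -(lenN (l - m)) opprB; lra.
by have := lenD l (m - l); rewrite addrC subrK; lra.
Qed.

Lemma lenB_le m l : len m <= len (m - l) + len l.
Proof. by have := lenD (m - l) l; rewrite subrK. Qed.

(** Each [1 + |k_j|] is at most [2 |k|], so the product of the three weights is
    at least [(2 |k|)^-4]; cubes are compared to get rid of the roots. *)
Lemma len4_le_zweight k : (len k ^+ 4)^-1 <=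
  16 * (zweight R (k 0 0) * (zweight R (k 0 1) * zweight R (k 0 (inord 2)))).
Proof.
set P := zweight _ _ * _.
have zw j := ltW (zweight_gt0 R (k 0 j)).
have P0 : 0 <= P := mulr_ge0 (zw _) (mulr_ge0 (zw _) (zw _)).
have [->|k0] := eqVneq k 0.
  by rewrite len0 expr0n/= invr0 (le_trans P0)// ler_peMl// ler1n.
have k1 := len_ge1 k0.
have lo (j : 'I_3) : (2 * len k)^-1 <= icbrt R `|k 0%R j|%N ^+ 3.
  rewrite icbrt3 lef_pV2 ?posrE; [|lra|by rewrite ltr0n].
  have := coord_len k j; rewrite -natr1 natr_absz -intr_norm; lra.
have c0 (j : 'I_3) : 0 <= icbrt R `|k 0%R j|%N by rewrite ltW// icbrt_gt0.

rewrite -(@ler_pXn2r _ 3)//; last 2 first.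
- by rewrite nnegrE invr_ge0 exprn_ge0 ?len_ge0.
- by rewrite nnegrE mulr_ge0.
rewrite /P /zweight.
move: (icbrt R `|k 0%R 0%R|%N) (icbrt R `|k 0%R 1%R|%N) (icbrt R `|k 0%R (inord 2)|%N) (c0 0)
  (c0 1) (c0 (inord 2))
  (lo 0) (lo 1) (lo (inord 2)) => a b c a0 b0 c0' la lb lc {zw P0 lo c0 P}.
have -> : (16 * (a ^+ 4 * (b ^+ 4 * c ^+ 4))) ^+ 3 =
  16 ^+ 3 * (a ^+ 3 * b ^+ 3 * c ^+ 3) ^+ 4 by ring.
set L := (2 * len k)^-1 in la lb lc.
have L0 : 0 <= L by rewrite invr_ge0; lra.
apply: (@le_trans _ _ (16 ^+ 3 * (L * L * L) ^+ 4)); last first.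
  rewrite ler_wpM2l//; apply: lerXn2r; rewrite ?nnegrE.
  - by apply: mulr_ge0 => //; exact: mulr_ge0.
  - by apply: mulr_ge0; [apply: mulr_ge0|]; exact: exprn_ge0.
  - by apply: ler_pM => //; [exact: mulr_ge0|exact: ler_pM].
rewrite le_eqVlt; apply/orP; left; apply/eqP.
rewrite /L; field; lra.
Qed.

Lemma l1le_len4 : l1le (fun k => (len k ^+ 4)^-1) (100 ^+ 2).
Proof.
pose F := fun p : int * (int * int) => zweight R p.1 * (zweight R p.2.1 * zweight R p.2.2).
have F8 : l1le F (8 * (8 * 8)).
  apply: (@l1le_prod R int (int * int)%type (zweight R)
     (fun p => zweight R p.1 * zweight R p.2)).
  - by move=> k; exact/ltW/zweight_gt0.
  - by move=> k; rewrite mulr_ge0// ltW// zweight_gt0.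
  - exact: l1le_zweight.
  - apply: l1le_prod; try exact: l1le_zweight;
    by move=> k; exact/ltW/zweight_gt0.
pose h k := (k 0 0, (k 0 1, k 0 (inord 2))) : int * (int * int).
have hinj : injective h.
  move=> k l [e0 e1 e2]; apply/rowP => -[[|[|[|//]]] i3].
  - by rewrite (_ : Ordinal i3 = 0)//; exact/val_inj.
  - by rewrite (_ : Ordinal i3 = 1)//; exact/val_inj.
  - by rewrite (_ : Ordinal i3 = inord 2)//; apply/val_inj; rewrite /= inordK.
move=> A.
apply: (@le_trans _ _ (\sum_(k <- A) 16 * F (h k))).
  by apply: ler_sum => k _; exact: len4_le_zweight.
rewrite -mulr_sumr; have := l1le_inj A hinj F8; lra.
Qed.

(** 16 * 8^3 = 8192 bounds the sum of |k|^(-4), and 100 is a round number whose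
    square exceeds it.  At [k = 0] the convention [0^-1 = 0] makes the term
    vanish. *)
Lemma l2le_len2 : l2le (fun k => (len k ^+ 2)^-1) 100.
Proof.
split=> // A; have := l1le_len4 A; apply: le_trans.
by apply: ler_sum => k _; rewrite exprVn -exprM.
Qed.

(** The Cauchy-Schwarz inequality against |k|^(-2): in dimension three, two
    derivatives in L^2 make the Fourier series absolutely convergent. *)
Lemma l1_of_l2 (f : 'rV[int]_3 -> R) X : f 0 = 0 ->
  l2le (fun k => len k ^+ 2 * f k) X -> l1le f (100 * X).
Proof.
move=> f0 fX; have := l2le_mul l2le_len2 fX.
apply: le_l1le => // k; have [->|k0] := eqVneq k 0.
  by rewrite f0 !mulr0.
have := len_ge1 k0 => k1.
by rewrite mulKf// expf_neq0//; apply: lt0r_neq0; lra.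
Qed.
End Wavenumber.

(** * Complex exponentials and complex vectors *)

Notation cnorm := ComplexField.Normc.normc.

Section ComplexNorm.
Variable R : realType.
Implicit Types (z : R[i]) (t : R).
Local Notation Re := complex.Re.
Local Notation Im := complex.Im.

Lemma cnorm_ge0 z : 0 <= cnorm z. Proof. by case: z => a b; exact: sqrtr_ge0. Qed.
Lemma cnorm_sqr z : cnorm z ^+ 2 = Re z ^+ 2 + Im z ^+ 2.
Proof. by case: z => a b /=; rewrite sqr_sqrtr// addr_ge0// sqr_ge0. Qed.
Lemma cnorm_real (x : R) : cnorm x%:C%C = `|x|.
Proof. by rewrite /= expr0n/= addr0 sqrtr_sqr. Qed.
Lemma cnorm_conj z : cnorm z^*%C = cnorm z.
Proof. by case: z => a b /=; rewrite sqrrN. Qed.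
Lemma cnorm_Re z : `|Re z| <= cnorm z.
Proof.
rewrite -ler_sqr ?nnegrE ?cnorm_ge0// cnorm_sqr real_normK ?num_real//.
by rewrite lerDl sqr_ge0.
Qed.
Lemma cnorm_le z : cnorm z <= `|Re z| + `|Im z|.
Proof.
rewrite -ler_sqr ?nnegrE ?addr_ge0 ?cnorm_ge0// cnorm_sqr sqrrD.
rewrite !real_normK ?num_real//; have := mulr_ge0 (normr_ge0 (Re z)) (normr_ge0 (Im z)).
lra.
Qed.
Lemma cnorm0 : cnorm (0 : R[i]) = 0. Proof. exact: ComplexField.Normc.normc0. Qed.
Lemma cnormM z1 z2 : cnorm (z1 * z2) = cnorm z1 * cnorm z2.
Proof. exact: ComplexField.Normc.normcM. Qed.
Lemma cnormD z1 z2 : cnorm (z1 + z2) <= cnorm z1 + cnorm z2.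
Proof. exact: le_normcD. Qed.
Lemma cnormN z : cnorm (- z) = cnorm z. Proof. exact: normcN. Qed.
Lemma cnormB z1 z2 : cnorm (z1 - z2) <= cnorm z1 + cnorm z2.
Proof. by rewrite -(cnormN z2) cnormD. Qed.
Lemma cnorm_sum (I : Type) (s : seq I) (P : pred I) (F : I -> R[i]) :
  cnorm (\sum_(i <- s | P i) F i) <= \sum_(i <- s | P i) cnorm (F i).
Proof.
elim/big_ind2 : _ => [|x1 x2 y1 y2 h1 h2|//]; first by rewrite cnorm0.
by apply: le_trans (cnormD _ _) _; exact: lerD.
Qed.
Lemma ReD z1 z2 : Re (z1 + z2) = Re z1 + Re z2. Proof. by case: z1; case: z2. Qed.
Lemma ReN z : Re (- z) = - Re z. Proof. by case: z. Qed.
Lemma Re_sum (I : Type) (s : seq I) (P : pred I) (F : I -> R[i]) :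
  Re (\sum_(i <- s | P i) F i) = \sum_(i <- s | P i) Re (F i).
Proof. by elim/big_rec2 : _ => [//|i x y _ <-]; rewrite ReD. Qed.
Lemma RemulC (x : R) z : Re (x%:C%C * z) = x * Re z.
Proof. by case: z => a b /=; rewrite mul0r subr0. Qed.
Lemma Reconj z : Re z^*%C = Re z. Proof. by case: z. Qed.

Definition cis (t : R) : R[i] := (cos t +i* sin t)%C.
Lemma cisD s t : cis (s + t) = cis s * cis t.
Proof.
rewrite /cis cosD sinD; apply/eqP; rewrite eq_complex /= eqxx/=.
by apply/eqP; ring.
Qed.
Lemma cis0 : cis 0 = 1 :> R[i]. Proof. by rewrite /cis cos0 sin0. Qed.
Lemma cnorm_cis t : cnorm (cis t) = 1.
Proof. by rewrite /= cos2Dsin2 sqrtr1. Qed.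
Lemma cis_conj t : (cis t)^*%C = cis (- t).
Proof. by rewrite /cis cosN sinN. Qed.
Lemma cis_sum (I : finType) (F : I -> R) : cis (\sum_i F i) = \prod_i cis (F i).
Proof. by elim/big_rec2 : _ => [|i x y _ <-]; rewrite ?cis0// cisD. Qed.
Lemma cisX t n : cis (n%:R * t) = cis t ^+ n.
Proof.
elim: n => [|n IH]; first by rewrite mul0r cis0.
by rewrite -natr1 mulrDl mul1r cisD IH exprSr.
Qed.

Lemma cos_sub1_le t : `|cos t - 1| <= `|t|.
Proof.
wlog t0 : t / 0 <= t.
  by move=> H; case: (leP 0 t) => [/H//|/ltW t0]; rewrite -cosN -[leRHS]normrN; apply: H;
    rewrite oppr_ge0.
have D x : x \in `]0, t[ -> is_derive x 1 (@cos R) ((fun x => - sin x) x).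
  by move=> _; exact: is_derive_cos.
have C : {within `[0, t], continuous (@cos R)}.
  by apply: continuous_subspaceT => x; exact: continuous_cos.
have [c _] := MVT_segment t0 D C.
rewrite cos0 subr0 => ->; rewrite normrM normrN ler_piMl//; exact: sin_max.
Qed.

Lemma sin_sub_le t : `|sin t - t| <= t ^+ 2.
Proof.
wlog t0 : t / 0 <= t.
  move=> H; case: (leP 0 t) => [/H//|/ltW t0].
  have := H (- t); rewrite sinN opprK sqrrN oppr_ge0 => /(_ t0).
  by rewrite -normrN opprD !opprK.
have D x : x \in `]0, t[ -> is_derive x 1 (fun x => sin x - x) ((fun x => cos x - 1) x).
  by move=> _; apply: is_deriveB.
have C : {within `[0, t], continuous (fun x => sin x - x)}.
  by apply: continuous_subspaceT => x; apply: cvgB; [exact: continuous_sin|exact: cvg_id].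
have [c] := MVT_segment t0 D C.
rewrite in_itv/= => /andP[c0 ct]; rewrite sin0 !subr0 => ->.
rewrite normrM expr2 (ger0_norm t0) ler_wpM2r//.
by apply: le_trans (cos_sub1_le c) _; rewrite ger0_norm.
Qed.

Lemma sin_le_abs t : `|sin t| <= `|t|.
Proof.
wlog t0 : t / 0 <= t.
  move=> H; case: (leP 0 t) => [/H//|/ltW t0].
  by have := H (- t); rewrite sinN !normrN oppr_ge0 => /(_ t0).
have D x : x \in `]0, t[ -> is_derive x 1 (@sin R) ((@cos R) x).
  by move=> _; exact: is_derive_sin.
have C : {within `[0, t], continuous (@sin R)}.
  by apply: continuous_subspaceT => x; exact: continuous_sin.
have [c] := MVT_segment t0 D C.
move=> _; rewrite sin0 !subr0 => ->; rewrite normrM ler_piMl//; exact: cos_max.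
Qed.

Lemma cos_sub1_sqr t : `|cos t - 1| <= t ^+ 2.
Proof.
wlog t0 : t / 0 <= t.
  by move=> H; case: (leP 0 t) => [/H//|/ltW t0]; rewrite -cosN -sqrrN; apply: H;
    rewrite oppr_ge0.
have D x : x \in `]0, t[ -> is_derive x 1 (@cos R) ((fun x => - sin x) x).
  by move=> _; exact: is_derive_cos.
have C : {within `[0, t], continuous (@cos R)}.
  by apply: continuous_subspaceT => x; exact: continuous_cos.
have [c] := MVT_segment t0 D C.
rewrite in_itv/= => /andP[c0 ct].
rewrite cos0 subr0 => ->; rewrite normrM normrN expr2 (ger0_norm t0) ler_wpM2r//.
by apply: le_trans (sin_le_abs c) _; rewrite ger0_norm.
Qed.

(** The quadratic bound serves for finitely many frequencies, the linear one
    below for the high frequencies, whose squares need not be summable against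
    the coefficients. *)
Lemma cis_taylor2 t : cnorm (cis t - 1 - (0 +i* t)%C) <= 2 * t ^+ 2.
Proof.
apply: le_trans (cnorm_le _) _; rewrite /= oppr0 !addr0.
have := cos_sub1_sqr t; have := sin_sub_le t; lra.
Qed.

Lemma cis_taylor1 t : cnorm (cis t - 1 - (0 +i* t)%C) <= 3 * `|t|.
Proof.
apply: le_trans (cnorm_le _) _; rewrite /= oppr0 !addr0.
have := cos_sub1_le t; have := sin_le_abs t; have := ler_normB (sin t) t; lra.
Qed.

(** From [cos t = 1] the half-angle formula gives [sin (t / 2) = 0], impossible
    on this interval. *)
Lemma cis_neq1 t : 0 < t < 2 * pi -> cis t != 1.
Proof.
move=> /andP[t0 t2]; apply/eqP => -[ct _].
have : 0 < sin (t / 2) by apply: sin_gt0_pi; lra.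
have := cos_mulr2n (t / 2); rewrite (_ : t / 2 *+ 2 = t); last by rewrite -mulr_natr; lra.
rewrite ct cos2sin2 => h s0.
have : sin (t / 2) ^+ 2 = 0 by lra.
by move/eqP; rewrite expf_eq0/= gt_eqF.
Qed.

Lemma cis_int2pi (q : int) : cis (q%:~R * (2 * pi)) = 1.
Proof.
wlog : q / 0 <= q.
  move=> H; case: (leP 0 q) => [/H//|/ltW q0].
  have := H (- q); rewrite oppr_ge0 => /(_ q0).
  rewrite rmorphN mulNr -cis_conj => /(congr1 conjc); rewrite conjcK => ->.
  exact: conjc1.
case: q => // n _; rewrite -pmulrn cisX.
suff -> : cis (2 * pi) = 1 by rewrite expr1n.
by rewrite mulr_natl /cis cos2pi sin2pi.
Qed.
End ComplexNorm.

Section Vectors.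
Variables (R : realType) (n : nat).
Implicit Types (z y : 'rV[R[i]]_n).

Definition vnorm z : R := Num.sqrt (sqnorm z).

Lemma sqnorm_ge0 z : 0 <= sqnorm z.
Proof. by apply: sumr_ge0 => j _; exact: sqr_ge0. Qed.
Lemma vnorm_ge0 z : 0 <= vnorm z. Proof. exact: sqrtr_ge0. Qed.
Lemma vnorm_sqr z : vnorm z ^+ 2 = sqnorm z.
Proof. by rewrite sqr_sqrtr// sqnorm_ge0. Qed.
Lemma vnorm0 : vnorm 0 = 0.
Proof. by rewrite /vnorm /sqnorm big1 ?sqrtr0// => j _; rewrite mxE cnorm0 expr0n. Qed.
Lemma coord_vnorm z j : cnorm (z 0 j) <= vnorm z.
Proof.
rewrite -ler_sqr ?nnegrE ?vnorm_ge0 ?cnorm_ge0// vnorm_sqr.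
by rewrite /sqnorm (bigD1 j)//= lerDl sumr_ge0// => i _; exact: sqr_ge0.
Qed.
Lemma vnorm_dot z y : cnorm (\sum_j z 0 j * y 0 j) <= vnorm z * vnorm y.
Proof.
apply: le_trans (cnorm_sum _ _ _) _.
rewrite -ler_sqr ?nnegrE ?mulr_ge0 ?vnorm_ge0//; last first.
  by apply: sumr_ge0 => i _; exact: cnorm_ge0.
rewrite exprMn !vnorm_sqr; under eq_bigr do rewrite cnormM.
exact: cauchy_schwarz_sum.
Qed.
Lemma vnormZ (c : R[i]) z : vnorm (c *: z) = cnorm c * vnorm z.
Proof.
apply/eqP; rewrite -(eqrXn2 (_ : 0 < 2)%N) ?mulr_ge0 ?vnorm_ge0 ?cnorm_ge0//.
rewrite exprMn !vnorm_sqr /sqnorm mulr_sumr; apply/eqP; apply: eq_bigr => j _.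
by rewrite mxE cnormM exprMn.
Qed.
Lemma vnormD z y : vnorm (z + y) <= vnorm z + vnorm y.
Proof.
rewrite -ler_sqr ?nnegrE ?addr_ge0 ?vnorm_ge0//.
apply: (@le_trans _ _ (\sum_j (cnorm (z 0 j) + cnorm (y 0 j)) ^+ 2)).
  rewrite vnorm_sqr; apply: ler_sum => j _; rewrite mxE lerXn2r ?nnegrE ?cnorm_ge0 ?cnormD//.
  by rewrite addr_ge0 ?cnorm_ge0.
rewrite sqrrD !vnorm_sqr.
have -> : \sum_j (cnorm (z 0 j) + cnorm (y 0 j)) ^+ 2 =
  sqnorm z + (\sum_j cnorm (z 0 j) * cnorm (y 0 j)) *+ 2 + sqnorm y.
  rewrite -sumrMnl /sqnorm -big_split -big_split/=.
  by apply: eq_bigr => j _; rewrite sqrrD.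
rewrite lerD2r lerD2l lerMn2r/=.
have -> : \sum_j cnorm (z 0 j) * cnorm (y 0 j) = `|\sum_j cnorm (z 0 j) * cnorm (y 0 j)|.
  by rewrite ger0_norm// sumr_ge0// => j _; rewrite mulr_ge0 ?cnorm_ge0.
rewrite -ler_sqr ?nnegrE ?mulr_ge0 ?vnorm_ge0// real_normK ?num_real// exprMn !vnorm_sqr.
exact: cauchy_schwarz_sum.
Qed.
Lemma vnormN z : vnorm (- z) = vnorm z.
Proof.
by rewrite /vnorm /sqnorm; congr Num.sqrt; apply: eq_bigr => j _; rewrite mxE cnormN.
Qed.
End Vectors.

Lemma vnorm_wave (R : realType) (k : 'rV[int]_3) (z : 'rV[R[i]]_3) :
  cnorm (\sum_j (k 0 j)%:~R * z 0 j) <= len R k * vnorm z.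
Proof.
apply: le_trans (cnorm_sum _ _ _) _.
rewrite -ler_sqr ?nnegrE ?mulr_ge0 ?len_ge0 ?vnorm_ge0//; last first.
  by apply: sumr_ge0 => i _; exact: cnorm_ge0.
rewrite exprMn vnorm_sqr len_sqr.
have e j : cnorm ((k 0 j)%:~R * z 0 j) = `|(k 0 j)%:~R : R| * cnorm (z 0 j).
  by rewrite cnormM -(rmorph_int (real_complex R)) cnorm_real.
under eq_bigr do rewrite e.
apply: le_trans (cauchy_schwarz_sum _ _ _) _.
rewrite ler_wpM2r ?sqnorm_ge0//; apply: ler_sum => j _.
by rewrite real_normK ?num_real.
Qed.

(** * Absolutely convergent sums and averages over a grid *)

Section Tails.
Variables (R : realType) (I : choiceType).
Implicit Types (f : I -> R).

(** The finite partial sums have a supremum; a set whose partial sum is within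
    [e] of it leaves at most [e] to any disjoint set. *)
Lemma l1le_tail f X (e : R) : (forall k, 0 <= f k) -> l1le f X -> 0 < e ->
  exists B0 : {fset I}, forall D : {fset I}, [disjoint B0 & D]%fset ->
    \sum_(k <- D) f k <= e.
Proof.
move=> f0 fX e0.
pose S := [set y : R | exists A : {fset I}, y = \sum_(k <- A) f k].
have supS : has_sup S.
  by split; [exists 0, fset0; rewrite big_seq_fset0|exists X => _ [A ->]; exact: fX].
have [_ [B0 ->] hB] := sup_adherent e0 supS.
exists B0 => D dis.
have : \sum_(k <- (B0 `|` D)%fset) f k <= sup S by apply: ub_le_sup;
  [exact: supS.2|exists (B0 `|` D)%fset].
rewrite (fset_sum_split B0).
have -> : ((B0 `|` D) `&` B0)%fset = B0 by rewrite fsetIC fsetKU.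
have -> : ((B0 `|` D) `\` B0)%fset = D.
  apply/fsetP => x; rewrite !inE; case: (boolP (x \in B0)) => //= xB.
  by apply/esym/negbTE; move/fdisjointP: dis => /(_ _ xB).
lra.
Qed.

(** Translates the extended-real sums of the definitions of the norms into
    bounds on finite sums. *)
Lemma esum_nneg_le (S : set I) f (X : R) : (forall k, 0 <= f k) ->
  (\esum_(i in S) (f i)%:E <= X%:E)%E <->
  (forall A : {fset I}, (forall k, k \in A -> S k) -> \sum_(k <- A) f k <= X).
Proof.
move=> f0; split.
  move=> h A AS; rewrite -lee_fin; apply: le_trans h.
  apply: esum_ge; exists [set` A]; first by split; [exact: finite_fset|move=> k /AS].
  by rewrite fsbig_finite ?finite_fset//= set_fsetK sumEFin.
move=> h; apply: ge_ereal_sup => _ [A [finA AS] <-].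
rewrite fsbig_finite//= sumEFin lee_fin; apply: h => k.
by rewrite in_fset_set// inE => /AS.
Qed.

(** The positive and the negative part of [f] are each approximated from below
    by their sum over [B0], with an error at most the tail [e]; the factor 2
    comes from adding the two errors. *)
Lemma usum_approx f g X (e : R) (B0 : {fset I}) :
  (forall k, `|f k| <= g k) -> l1le g X ->
  (forall D : {fset I}, [disjoint B0 & D]%fset -> \sum_(k <- D) g k <= e) ->
  `|usum f - \sum_(k <- B0) f k| <= 2 * e.
Proof.
move=> fg gX tail.
pose p k := Num.max (f k) 0; pose q k := Num.max (- f k) 0.
have p0 k : 0 <= p k by rewrite le_max lexx orbT.
have q0 k : 0 <= q k by rewrite le_max lexx orbT.
have pg k : p k <= g k.
  by have := fg k; rewrite ler_norml /p => /andP[_ h];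
    rewrite ge_max h (le_trans (normr_ge0 _) (fg k)).
have qg k : q k <= g k.
  have := fg k; rewrite ler_norml /q => /andP[h _]; rewrite ge_max lerNl h.
  by rewrite (le_trans (normr_ge0 _) (fg k)).
have fpq k : f k = p k - q k.
  by rewrite /p /q; case: (leP (f k) 0) => h; case: (leP (- f k) 0) => h'; lra.
have est (h : I -> R) : (forall k, 0 <= h k) -> (forall k, h k <= g k) ->
    exists s, \esum_(i in [set: I]) (h i)%:E = s%:E /\
     \sum_(k <- B0) h k <= s <= \sum_(k <- B0) h k + e.
  move=> h0 hg; set E := \esum_(i in _) _.
  have up : (E <= (\sum_(k <- B0) h k + e)%:E)%E.
    apply/esum_nneg_le => // A _; rewrite (fset_sum_split B0); apply: lerD.
      by apply: ler_sum_fset => //; exact: fsubsetIr.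
    apply: (@le_trans _ _ (\sum_(k <- (A `\` B0)%fset) g k)).
      by apply: ler_sum => k _.
    by apply: tail; apply/fdisjointP => x xB; rewrite inE xB.
  have lo : ((\sum_(k <- B0) h k)%:E <= E)%E.
    apply: esum_ge; exists [set` B0]; first by split; [exact: finite_fset|].
    by rewrite fsbig_finite ?finite_fset//= set_fsetK sumEFin.
  have fE : E \is a fin_num.
    by rewrite fin_numE; apply/andP; split; apply/eqP => EE; rewrite EE ?leye_eq in up lo.
  exists (fine E); rewrite fineK//; split => //.
  by rewrite -!lee_fin fineK// lo up.
have [sp [Ep /andP[p1 p2]]] := est p p0 pg.
have [sq [Eq /andP[q1 q2]]] := est q q0 qg.
have -> : usum f = sp - sq.
  rewrite /usum.
  have -> : \esum_(i in [set: I]) ((EFin \o f)^\+ i)%E = sp%:E.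
    by rewrite -Ep; apply: eq_esum => k _; rewrite funeposE /p /= EFin_max.
  have -> : \esum_(i in [set: I]) ((EFin \o f)^\- i)%E = sq%:E.
    by rewrite -Eq; apply: eq_esum => k _; rewrite funenegE /q /= EFin_max.
  by [].
have -> : \sum_(k <- B0) f k = \sum_(k <- B0) p k - \sum_(k <- B0) q k.
  by rewrite -sumrB; apply: eq_bigr => k _.
rewrite ler_norml; apply/andP; split; lra.
Qed.
End Tails.

Section Exponentials.
Variable R : realType.
Implicit Types (k l m : 'rV[int]_3) (x y : 'rV[R]_3).

Definition ek k x : R[i] := cis (dotk k x).

Lemma dotkDl k l x : dotk (k + l) x = dotk k x + dotk l x.
Proof.
rewrite /dotk -big_split/=; apply: eq_bigr => j _.
by rewrite mxE rmorphD/= mulrDl.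
Qed.
Lemma dotkDr k x y : dotk k (x + y) = dotk k x + dotk k y.
Proof.
by rewrite /dotk -big_split/=; apply: eq_bigr => j _; rewrite mxE mulrDr.
Qed.
Lemma dotkNl k x : dotk (- k) x = - dotk k x.
Proof.
rewrite /dotk -sumrN; apply: eq_bigr => j _.
by rewrite mxE rmorphN/= mulNr.
Qed.
Lemma dotk_delta k (h : R) i : dotk k (h *: 'e_i) = h * (k 0 i)%:~R.
Proof.
rewrite /dotk (bigD1 i)//= big1 => [|j ji]; rewrite !mxE.
  by rewrite !eqxx/= mulr1 addr0 mulrC.
by rewrite (negbTE ji)/= !mulr0.
Qed.
Lemma ekD k l x : ek (k + l) x = ek k x * ek l x.
Proof. by rewrite /ek dotkDl cisD. Qed.
Lemma ekDr k x y : ek k (x + y) = ek k x * ek k y.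
Proof. by rewrite /ek dotkDr cisD. Qed.
Lemma ek_conj k x : (ek k x)^*%C = ek (- k) x.
Proof. by rewrite /ek cis_conj dotkNl. Qed.
Lemma cnorm_ek k x : cnorm (ek k x) = 1. Proof. exact: cnorm_cis. Qed.

(** The point of index [g] in the grid of spacing 2 pi / (M + 1).  Averages over
    this finite grid replace integrals over the torus: on trigonometric
    polynomials of degree at most [M] they give exactly the mean value. *)
Definition gridpt M (g : {ffun 'I_3 -> 'I_M.+1}) : 'rV[R]_3 :=
  \row_j ((g j)%:R * (2 * pi / M.+1%:R)).

Definition gridavg M (F : 'rV[R]_3 -> R[i]) : R[i] :=
  (((M.+1%:R ^+ 3)^-1 : R)%:C)%C * \sum_g F (gridpt (M := M) g).

Lemma gridavg_le M F (e : R) : (forall x, cnorm (F x) <= e) ->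
  cnorm (gridavg M F) <= e.
Proof.
move=> Fe; rewrite /gridavg cnormM cnorm_real ger0_norm ?invr_ge0 ?exprn_ge0//.
have h : cnorm (\sum_g F (gridpt (M := M) g)) <= M.+1%:R ^+ 3 * e.
  apply: le_trans (cnorm_sum _ _ _) _.
  apply: (@le_trans _ _ (\sum_(g : {ffun 'I_3 -> 'I_M.+1}) e)).
    by apply: ler_sum => g _.
  by rewrite sumr_const card_ffun !card_ord -[leLHS]mulr_natl natrX.
by rewrite mulrC ler_pdivrMr ?exprn_gt0// mulrC.
Qed.

Lemma gridavg_sum M (I : Type) (s : seq I) (F : I -> 'rV[R]_3 -> R[i]) :
  gridavg M (fun x => \sum_(i <- s) F i x) = \sum_(i <- s) gridavg M (F i).
Proof. by rewrite /gridavg exchange_big/= mulr_sumr. Qed.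

Lemma gridavgD M F G :
  gridavg M (fun x => F x + G x) = gridavg M F + gridavg M G.
Proof. by rewrite /gridavg big_split/= mulrDr. Qed.

Lemma gridavgZ M (c : R[i]) F : gridavg M (fun x => c * F x) = c * gridavg M F.
Proof. by rewrite /gridavg -mulr_sumr mulrCA. Qed.

(** The average is a product of three geometric sums of (M + 1)-th roots of
    unity; each vanishes unless its ratio is 1, which for [|k_j| <= M] means
    [k_j = 0]. *)
Lemma gridavg_ek M k : (forall j, `|k 0 j| < M.+1%:Z)%R ->
  gridavg M (ek k) = (k == 0)%:R.
Proof.
move=> kM; rewrite /gridavg.
pose z j := cis ((k 0 j)%:~R * (2 * pi / M.+1%:R)) : R[i].
have -> : \sum_g ek k (gridpt (M := M) g) = \prod_j \sum_(a < M.+1) z j ^+ a.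
  rewrite bigA_distr_bigA; apply: eq_bigr => g _.
  rewrite /ek /dotk cis_sum; apply: eq_bigr => j _.
  by rewrite mxE mulrCA cisX.
have [k0|k0] := eqVneq k 0.
  under eq_bigr => j _.
    rewrite (_ : z j = 1); last by rewrite /z k0 mxE mul0r cis0.
    under eq_bigr do rewrite expr1n.
    rewrite sumr_const card_ord.
    over.
  rewrite prodr_const card_ord.
  have -> : (M.+1%:R : R[i]) ^+ 3 = ((M.+1%:R ^+ 3 : R)%:C)%C.
    by rewrite rmorphXn/= rmorph_nat.
  rewrite -[LHS](rmorphM (real_complex R)) mulVf ?rmorph1//.
have [j kj] := rV0Pn _ k0.
rewrite (bigD1 j)//= (_ : \sum_(_ < _) _ = 0) ?mul0r ?mulr0//.
have zM : z j ^+ M.+1 = 1.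
  rewrite -cisX mulrCA -[RHS](cis_int2pi R (k 0 j)); congr (cis (_ * _)).
  by rewrite mulrC divfK// pnatr_eq0.
have z1 : z j != 1.
  have MR : 0 < M.+1%:R :> R by rewrite ltr0n.
  have pi0 := pi_gt0 R.
  have aux (a : int) : 0 < a -> a < M.+1%:Z -> cis (a%:~R * (2 * pi / M.+1%:R)) != 1 :> R[i].
    move=> a0 aM; have aR : 0 < a%:~R :> R by rewrite ltr0z.
    have aMR : a%:~R < M.+1%:R :> R by rewrite -[M.+1%:R]/(M.+1%:Z%:~R) ltr_int.
    apply: cis_neq1; apply/andP; split.
      by apply: mulr_gt0 => //; apply: divr_gt0 => //; lra.
    by rewrite mulrCA -[ltRHS]mulr1 ltr_pM2l ?ltr_pdivrMr ?mul1r//; lra.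
  have [kp|kn] := ltP 0 (k 0 j).
    by apply: aux => //; apply: le_lt_trans (kM j); exact: ler_norm.
  have kn' : 0 < - k 0 j by rewrite oppr_gt0 lt_neqAle kj.
  have := aux _ kn'.
  have kMj := kM j; rewrite -(normrN (k 0 j)) gtr0_norm// in kMj.
  move=> /(_ kMj); apply: contra => /eqP zj.
  by rewrite rmorphN mulNr -cis_conj [X in X^*%C]zj conjc1.
by have := subrX1 (z j) M.+1; rewrite zM subrr => /esym/eqP;
  rewrite mulf_eq0 subr_eq0 (negbTE z1)/= => /eqP.
Qed.

Lemma freq_bound (s : seq 'rV[int]_3) :
  exists M : nat, forall k, k \in s -> forall j, (`|k 0 j| < M.+1%:Z)%R.
Proof.
exists (\max_(k <- s) \max_(j < 3) `|k 0%R j|)%N => k ks j.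
rewrite -abszE ltz_nat ltnS.
apply: leq_trans (leq_bigmax_seq _ ks isT).
exact: (leq_bigmax (F := fun j => `|k 0%R j|%N)).
Qed.
End Exponentials.

(** * Fourier coefficients of pointwise identities *)

Section Approximation.
Variable R : realType.
Local Notation K := ('rV[int]_3).
Implicit Types (k l m : K) (x y : 'rV[R]_3) (a b c : K -> R[i]) (f g : 'rV[R]_3 -> R).

Definition trig (B : {fset K}) a x : R[i] := \sum_(k <- B) a k * ek k x.

(** The Fourier series converges uniformly to [f], along the directed set of
    finite sets of frequencies.  Only approximation by trigonometric polynomials
    is used below, so that products of functions involve finite sums only. *)
Definition has_fourier f a : Prop := forall e : R, 0 < e ->
  exists B0 : {fset K}, forall B, (B0 `<=` B)%fset ->
    forall x, cnorm ((f x)%:C%C - trig B a x) <= e.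

Lemma has_fourierD f g a b : has_fourier f a -> has_fourier g b ->
  has_fourier (fun x => f x + g x) (fun k => a k + b k).
Proof.
move=> fa gb e e0; have e2 : 0 < e / 2 by lra.
have [B1 h1] := fa _ e2; have [B2 h2] := gb _ e2.
exists (B1 `|` B2)%fset => B; rewrite fsubUset => /andP[B1B B2B] x.
have -> : (f x + g x)%:C%C - trig B (fun k => a k + b k) x =
  ((f x)%:C%C - trig B a x) + ((g x)%:C%C - trig B b x).
  rewrite rmorphD/= /trig; under eq_bigr do rewrite mulrDl.
  by rewrite big_split/=; ring.
apply: le_trans (cnormD _ _) _; have := h1 _ B1B x; have := h2 _ B2B x; lra.
Qed.

Lemma has_fourierZ (r : R) f a : has_fourier f a ->
  has_fourier (fun x => r * f x) (fun k => r%:C%C * a k).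
Proof.
move=> fa e e0; have r1 : 0 < `|r| + 1 by rewrite ltr_wpDl.
have e1 : 0 < e / (`|r| + 1) by exact: divr_gt0.
have [B0 h] := fa _ e1; exists B0 => B /h hB x.
have -> : (r * f x)%:C%C - trig B (fun k => r%:C%C * a k) x =
  r%:C%C * ((f x)%:C%C - trig B a x).
  rewrite rmorphM/= /trig; under eq_bigr do rewrite -mulrA.
  by rewrite -mulr_sumr; ring.
rewrite cnormM cnorm_real.
have := hB x; rewrite ler_pdivlMr// => h2; apply: le_trans h2.
by rewrite mulrC ler_wpM2l ?cnorm_ge0// lerDl.
Qed.

Lemma has_fourier0 : has_fourier (fun=> 0) (fun=> 0).
Proof.
move=> e e0; exists fset0 => B _ x.
by rewrite /trig big1 ?subrr ?cnorm0 ?ltW// => k _; rewrite mul0r.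
Qed.

Lemma has_fourier_sum (I : Type) (s : seq I) (f : I -> 'rV[R]_3 -> R) (a : I -> K -> R[i]) :
  (forall i, has_fourier (f i) (a i)) ->
  has_fourier (fun x => \sum_(i <- s) f i x) (fun k => \sum_(i <- s) a i k).
Proof.
move=> fa; elim: s => [|i s IH].
  have := has_fourier0; congr has_fourier; apply/boolp.funext => x; by rewrite big_nil.
have := has_fourierD (fa i) IH.
by congr has_fourier; apply/boolp.funext => x; rewrite big_cons.
Qed.

Lemma has_fourier_ext f g a b : f =1 g -> a =1 b -> has_fourier f a -> has_fourier g b.
Proof. by move=> /boolp.funext -> /boolp.funext ->. Qed.

Lemma trig_bound B a x X : l1le (fun k => cnorm (a k)) X -> cnorm (trig B a x) <= X.
Proof.
move=> aX; apply: le_trans (cnorm_sum _ _ _) _; apply: le_trans (aX B).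
by apply: ler_sum => k _; rewrite cnormM cnorm_ek mulr1.
Qed.

Lemma has_fourier_bound f a X x : has_fourier f a ->
  l1le (fun k => cnorm (a k)) X -> `|f x| <= X + 1.
Proof.
move=> fa aX; have [B0 /(_ B0 (fsubset_refl _) x) h] := fa 1 ltr01.
rewrite -cnorm_real -[X in cnorm X](subrK (trig B0 a x)).
apply: le_trans (cnormD _ _) _; have := trig_bound B0 x aX; lra.
Qed.

Lemma gridavg_trig M B a m : m \in B ->
  (forall k, k \in B -> forall j, (`|(k - m)%R 0 j| < M.+1%:Z)%R) ->
  gridavg M (fun x => trig B a x * ek (- m) x) = a m.
Proof.
move=> mB hM.
have -> : (fun x => trig B a x * ek (- m) x) =
    (fun x => \sum_(k <- B) a k * ek (k - m) x).
  apply/boolp.funext => x; rewrite /trig mulr_suml; apply: eq_bigr => k _.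
  by rewrite ekD mulrA.
rewrite gridavg_sum (big_fsetD1 m)//= big1_seq ?addr0.
  by rewrite gridavgZ gridavg_ek; [rewrite subrr eqxx mulr1|exact: hM].
move=> k /=; rewrite !inE => /andP[km kB].
by rewrite gridavgZ gridavg_ek ?subr_eq0 ?(negbTE km) ?mulr0//; exact: hM.
Qed.

(** The coefficient of a product is a convolution.  Because [B1] contains all
    the [m - l], the sum keeps no restriction on [m - l]; because [M] exceeds the
    occurring frequencies, no aliasing takes place. *)
Lemma gridavg_trigM M (B1 B2 : {fset K}) b c m :
  (forall l, l \in B2 -> m - l \in B1) ->
  (forall k l, k \in B1 -> l \in B2 ->
    forall j, (`|(k - (m - l))%R 0 j| < M.+1%:Z)%R) ->
  gridavg M (fun x => trig B1 b x * trig B2 c x * ek (- m) x) =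
  \sum_(l <- B2) b (m - l) * c l.
Proof.
move=> hB hM.
have -> : (fun x => trig B1 b x * trig B2 c x * ek (- m) x) =
    (fun x => \sum_(l <- B2) c l * (trig B1 b x * ek (- (m - l)) x)).
  apply/boolp.funext => x; rewrite /trig mulr_sumr mulr_suml; apply: eq_bigr => l _.
  by rewrite opprB ekD; ring.
rewrite gridavg_sum big_seq [RHS]big_seq; apply: eq_bigr => l lB.
rewrite gridavgZ gridavg_trig ?hB//; first by rewrite mulrC.
by move=> k kB; exact: hM.
Qed.

(** Both factors are replaced by trigonometric polynomials: those of [G i] over
    the prescribed set [B], those of [F i] over a set [B1] enlarged by all the
    [m - l] with [l] in [B].  The equation then holds up to [e] at every point,
    and the average against [ek (- m)] over a fine enough grid yields the
    convolution restricted to [B], with the same error. *)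
Lemma product_modes f a (F G : 'I_3 -> 'rV[R]_3 -> R) (b c : 'I_3 -> K -> R[i])
    (X Y : R) :
  has_fourier f a ->
  (forall i, has_fourier (F i) (b i)) -> (forall i, has_fourier (G i) (c i)) ->
  (forall i, l1le (fun k => cnorm (b i k)) X) ->
  (forall i, l1le (fun k => cnorm (c i k)) Y) ->
  (forall x, f x + \sum_i F i x * G i x = 0) ->
  forall m (e : R), 0 < e -> exists B0 : {fset K}, forall B, (B0 `<=` B)%fset ->
    cnorm (a m + \sum_(l <- B) \sum_i b i (m - l) * c i l) <= e.
Proof.
move=> fa Fb Gc bX cY eq0 m e e0.
have X0 : 0 <= X by exact: l1le_ge0 (bX 0).
have Y0 : 0 <= Y by exact: l1le_ge0 (cY 0).
pose d := e / (1 + 3 * (X + 1 + Y)).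
have den0 : 0 < 1 + 3 * (X + 1 + Y) by lra.
have d0 : 0 < d by exact: divr_gt0.
have [Ba hBa] := fa _ d0.
have /choice [Bb hBb] := fun i => Fb i _ d0.
have /choice [Bc hBc] := fun i => Gc i _ d0.
pose Bb' := (\bigcup_(i <- enum 'I_3) Bb i)%fset.
pose Bc' := (\bigcup_(i <- enum 'I_3) Bc i)%fset.
have subb i : (Bb i `<=` Bb')%fset by apply: bigfcup_sup; rewrite ?mem_enum.
have subc i : (Bc i `<=` Bc')%fset by apply: bigfcup_sup; rewrite ?mem_enum.
exists Bc' => B BcB.
pose B1 := (m |` (Ba `|` Bb' `|` [fset m - l | l in B]))%fset.
have mB1 : m \in B1 by rewrite !inE eqxx.
have mlB1 l : l \in B -> m - l \in B1.
  by move=> lB; rewrite !inE; apply/orP; right; apply/orP; right; apply/imfsetP; exists l.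
have BaB1 : (Ba `<=` B1)%fset by apply/fsubsetP => k kB; rewrite !inE kB orbT.
have BbB1 i : (Bb i `<=` B1)%fset.
  by apply/fsubsetP => k kB; rewrite !inE (fsubsetP (subb i) _ kB) !orbT.
have BcB2 i : (Bc i `<=` B)%fset by exact: fsubset_trans (subc i) BcB.
pose P x := trig B1 a x + \sum_i trig B1 (b i) x * trig B (c i) x.
(* F G - F_B1 G_B = F (G - G_B) + (F - F_B1) G_B, with |F| <= X + 1 and
   |G_B| <= Y *)
have Pe x : cnorm (P x) <= e.
  have -> : P x = - (((f x)%:C%C - trig B1 a x) +
      \sum_i ((F i x)%:C%C * ((G i x)%:C%C - trig B (c i) x) +
              ((F i x)%:C%C - trig B1 (b i) x) * trig B (c i) x)).
    have /(congr1 (real_complex R)) := eq0 x.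
    rewrite rmorphD rmorph_sum rmorph0/= => /eqP; rewrite addr_eq0 => /eqP fx.
    rewrite /P fx.
    have -> : \sum_i ((F i x)%:C%C * ((G i x)%:C%C - trig B (c i) x) +
              ((F i x)%:C%C - trig B1 (b i) x) * trig B (c i) x) =
       \sum_i (F i x * G i x)%:C%C - \sum_i trig B1 (b i) x * trig B (c i) x.
      by rewrite -sumrB; apply: eq_bigr => i _; rewrite rmorphM/=; ring.
    ring.
  rewrite cnormN; apply: le_trans (cnormD _ _) _.
  have h1 := hBa _ BaB1 x.
  have h2 : cnorm (\sum_i ((F i x)%:C%C * ((G i x)%:C%C - trig B (c i) x) +
              ((F i x)%:C%C - trig B1 (b i) x) * trig B (c i) x)) <= 3 * (X + 1 + Y) * d.
    apply: le_trans (cnorm_sum _ _ _) _.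
    apply: (@le_trans _ _ (\sum_(i < 3) (X + 1 + Y) * d)); last first.
      by rewrite sumr_const card_ord -[leLHS]mulr_natl mulrA.
    apply: ler_sum => i _; apply: le_trans (cnormD _ _) _.
    rewrite !cnormM cnorm_real [leRHS]mulrDl; apply: lerD.
      apply: ler_pM; [exact: normr_ge0|exact: cnorm_ge0| |exact: hBc].
      exact: has_fourier_bound (Fb i) (bX i).
    rewrite mulrC; apply: ler_pM; [exact: cnorm_ge0|exact: cnorm_ge0| |exact: hBb].
    exact: trig_bound.
  apply: le_trans (lerD h1 h2) _.
  by rewrite -[X in X + _]mul1r -mulrDl /d mulrC divfK// gt_eqF.
have [M hM] := freq_bound ([seq k - m | k <- B1] ++ [seq k - (m - l) | k <- B1, l <- B]).
have := gridavg_le M (F := fun x => P x * ek (- m) x) (e := e).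
have -> : gridavg M (fun x => P x * ek (- m) x) =
    a m + \sum_(l <- B) \sum_i b i (m - l) * c i l.
  have -> : (fun x => P x * ek (- m) x) = (fun x => trig B1 a x * ek (- m) x +
     \sum_(i <- index_enum 'I_3) trig B1 (b i) x * trig B (c i) x * ek (- m) x).
    by apply/boolp.funext => x; rewrite /P mulrDl mulr_suml.
  rewrite gridavgD gridavg_trig//; last first.
    by move=> k kB; apply: hM; rewrite mem_cat; apply/orP; left; apply/mapP; exists k.
  congr (_ + _); rewrite gridavg_sum exchange_big/=; apply: eq_bigr => i _.
  rewrite gridavg_trigM// => k l kB lB.
  apply: hM; rewrite mem_cat; apply/orP; right; apply/allpairsP.
  by exists (k, l).
by apply => x; rewrite cnormM cnorm_ek mulr1.
Qed.
End Approximation.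

Section Realize.
Variables (R : realType) (n : nat).
Local Notation K := ('rV[int]_3).
Implicit Types (w : coeffs R n) (j : 'I_n) (x : 'rV[R]_3).

Definition real_coeffs w := forall k j, w (- k) 0 j = (w k 0 j)^*%C.

(** [usum] sums real parts.  Over a set [B0] stable under [k |-> - k] the
    trigonometric polynomial of a real function is real, hence equal to that sum
    of real parts; the remaining frequencies contribute at most the tail. *)
Lemma has_fourier_realize w j X : real_coeffs w ->
  l1le (fun k => cnorm (w k 0 j)) X ->
  has_fourier (realize w j) (fun k => w k 0 j).
Proof.
move=> wr wX e e0; have e4 : 0 < e / 4 by lra.
have [C hC] := l1le_tail (fun k => cnorm_ge0 (w k 0 j)) wX e4.
pose B0 := (C `|` [fset - k | k in C])%fset.
have CB0 : (C `<=` B0)%fset by exact: fsubsetUl.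
exists B0 => B B0B x.
have tail (D : {fset K}) : [disjoint B0 & D]%fset -> \sum_(k <- D) cnorm (w k 0 j) <= e / 4.
  by move=> dis; apply: hC; exact: fdisjointWl CB0 dis.
pose f k := complex.Re (w k 0 j * ek k x).
have fg k : `|f k| <= cnorm (w k 0 j).
  by apply: le_trans (cnorm_Re _) _; rewrite cnormM cnorm_ek mulr1.
have h1 := usum_approx fg wX tail.
have B0N k : (k \in B0) = (- k \in B0).
  have imp l : l \in B0 -> - l \in B0.
    rewrite !inE => /orP[lC|/imfsetP[l' /= l'C ->]].
      by apply/orP; right; apply/imfsetP; exists l.
    by rewrite opprK l'C.
  by apply/idP/idP => [/imp//|/imp]; rewrite opprK.
have real : trig B0 (fun k => w k 0 j) x = (\sum_(k <- B0) f k)%:C%C.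
  have cj : (trig B0 (fun k => w k 0 j) x)^*%C = trig B0 (fun k => w k 0 j) x.
    rewrite /trig rmorph_sum/=.
    transitivity (\sum_(k <- [fset - k | k in B0]%fset) w k 0 j * ek k x).
      rewrite [RHS]big_imfset/=; last by move=> a b _ _ /oppr_inj.
      by apply: eq_bigr => k _; rewrite rmorphM wr -ek_conj.
    apply: eq_fbigl => k; apply/imfsetP/idP => [[l /= lB ->]|kB]; first by rewrite -B0N.
    by exists (- k); rewrite ?opprK//= -B0N.
  have -> : \sum_(k <- B0) f k = complex.Re (trig B0 (fun k => w k 0 j) x).
    by rewrite /trig Re_sum.
  move: cj; case: (trig _ _ _) => p q [qq] /=.
  by congr (_ +i* _)%C; lra.
have -> : trig B (fun k => w k 0 j) x = trig B0 (fun k => w k 0 j) x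
    + \sum_(k <- (B `\` B0)%fset) w k 0 j * ek k x.
  rewrite /trig (fset_sum_split B0).
  by rewrite (fsetIidPr B0B).
rewrite real opprD addrA -rmorphB.
apply: le_trans (cnormB _ _) _.
have h2 : cnorm (\sum_(k <- (B `\` B0)%fset) w k 0 j * ek k x) <= e / 4.
  apply: le_trans (cnorm_sum _ _ _) _.
  apply: (@le_trans _ _ (\sum_(k <- (B `\` B0)%fset) cnorm (w k 0 j))).
    by apply: ler_sum => k _; rewrite cnormM cnorm_ek mulr1.
  by apply: tail; apply/fdisjointP => k kB; rewrite inE kB.
have := h1; rewrite cnorm_real -[usum f]/(realize w j x); lra.
Qed.

(** The derivative d/dx_i multiplies the k-th coefficient by the imaginary
    number i k_i. *)
Definition dcoef (i : 'I_3) w : coeffs R n :=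
  fun k => (0 +i* (k 0 i)%:~R)%C *: w k.

Lemma dcoef_real i w : real_coeffs w -> real_coeffs (dcoef i w).
Proof.
move=> wr k j; rewrite /dcoef !mxE wr rmorphM/=.
by congr (_ * _); rewrite /= rmorphN.
Qed.

Lemma dcoef_cnorm i w k j : cnorm (dcoef i w k 0 j) <= len R k * cnorm (w k 0 j).
Proof.
rewrite /dcoef mxE cnormM ler_wpM2r ?cnorm_ge0//.
by rewrite /= expr0n/= add0r sqrtr_sqr coord_len.
Qed.

(** Differentiation under a sum with summable [|k| |w_k|].  The finitely many
    frequencies in [B0] have a second-order remainder [2 Q h^2]; all the others
    together contribute a Lipschitz remainder with a small constant. *)
Lemma pder_realize i w j X x : real_coeffs w ->
  l1le (fun k => cnorm (w k 0 j)) X ->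
  l1le (fun k => len R k * cnorm (w k 0 j)) X ->
  pder i (realize w j) x = realize (dcoef i w) j x.
Proof.
move=> wr wX dX.
have fa := has_fourier_realize wr wX.
have da : has_fourier (realize (dcoef i w) j) (fun k => dcoef i w k 0 j).
  apply: has_fourier_realize (dcoef_real i wr) _.
  by apply: le_l1le dX => // k; exact: dcoef_cnorm.
have c0 k := cnorm_ge0 (w k 0 j).
apply: cvg_lim => //; apply/cvgrPdist_le => /= e e0.
have e6 : 0 < e / 12 by lra.
have [B0 tail] := l1le_tail (fun k => mulr_ge0 (len_ge0 R k) (c0 k)) dX e6.
pose Q := \sum_(k <- B0) cnorm (w k 0 j) * len R k ^+ 2.
have Q0 : 0 <= Q by apply: sumr_ge0 => k _; rewrite mulr_ge0// sqr_ge0.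
(* The identity is proved for trigonometric polynomials close to the functions,
   with an error [r] that is afterwards sent to 0. *)
have main (h : R) : `|realize w j (h *: 'e_i + x) - realize w j x
   - h * realize (dcoef i w) j x| <= 2 * Q * h ^+ 2 + `|h| * (e / 4).
  apply/ler_addgt0Pl => r r0.
  pose r' := r / (2 + `|h|).
  have r'0 : 0 < r' by apply: divr_gt0 => //; rewrite ltr_wpDr.
  have [B1 h1] := fa _ r'0; have [B2 h2] := da _ r'0.
  pose B := (B0 `|` B1 `|` B2)%fset.
  have B1B : (B1 `<=` B)%fset by apply/fsubsetP => k kB; rewrite !inE kB orbT.
  have B2B : (B2 `<=` B)%fset by apply/fsubsetP => k kB; rewrite !inE kB orbT.
  have {}h1 := h1 _ B1B; have {}h2 := h2 _ B2B.
  set T := trig B in h1 h2.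
  pose a k := w k 0 j; pose d k := dcoef i w k 0 j.
  rewrite -/a -/d in h1 h2.
  rewrite -cnorm_real.
  have -> : (realize w j (h *: 'e_i + x) - realize w j x
   - h * realize (dcoef i w) j x)%:C%C =
    ((realize w j (h *: 'e_i + x))%:C%C - T a (h *: 'e_i + x))
    - ((realize w j x)%:C%C - T a x) - h%:C%C * ((realize (dcoef i w) j x)%:C%C - T d x)
    + (T a (h *: 'e_i + x) - T a x - h%:C%C * T d x).
    by rewrite !rmorphB rmorphM/=; ring.
  apply: le_trans (cnormD _ _) _; apply: lerD.
    apply: le_trans (cnormB _ _) _.
    rewrite cnormM cnorm_real.
    have hh := ler_wpM2l (normr_ge0 h) (h2 x).
    have := cnormB ((realize w j (h *: 'e_i + x))%:C%C - T a (h *: 'e_i + x))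
       ((realize w j x)%:C%C - T a x).
    have := h1 x; have := h1 (h *: 'e_i + x).
    have -> : r = 2 * r' + `|h| * r'.
      by rewrite -mulrDl /r' mulrC divfK// gt_eqF// ltr_wpDr.
    lra.
  have -> : T a (h *: 'e_i + x) - T a x - h%:C%C * T d x =
    \sum_(k <- B) a k * ek k x * (cis (h * (k 0 i)%:~R) - 1 - (0 +i* (h * (k 0 i)%:~R))%C).
    rewrite /T /trig mulr_sumr -!sumrB; apply: eq_bigr => k _.
    rewrite ekDr {1}/ek dotk_delta /d /dcoef mxE -/(a k).
    have -> : (0 +i* (h * (k 0 i)%:~R))%C = h%:C%C * (0 +i* (k 0 i)%:~R)%C.
      by apply/eqP; rewrite eq_complex/= !mul0r subr0 addr0 mulr0 !eqxx.
    ring.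
  apply: le_trans (cnorm_sum _ _ _) _.
  rewrite (fset_sum_split B0); apply: lerD.
    have -> : (B `&` B0 = B0)%fset.
      by apply/fsetP => k; rewrite !inE; case: (k \in B0); rewrite ?andbF.
    rewrite /Q mulr_sumr mulr_suml; apply: ler_sum => k _.
    rewrite !cnormM cnorm_ek mulr1.
    have -> : 2 * (cnorm (w k 0 j) * len R k ^+ 2) * h ^+ 2 =
      cnorm (w k 0 j) * (2 * (h * len R k) ^+ 2) by ring.
    rewrite ler_wpM2l ?cnorm_ge0// (le_trans (cis_taylor2 _))// ler_wpM2l// !exprMn ler_wpM2l
      ?sqr_ge0//.
    rewrite -[leLHS]real_normK ?num_real// lerXn2r ?nnegrE ?len_ge0//; exact: coord_len.
  apply: (@le_trans _ _ (\sum_(k <- (B `\` B0)%fset) 3 * `|h| * (len R k * cnorm (w k 0 j)))).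
    apply: ler_sum => k _; rewrite !cnormM cnorm_ek mulr1.
    apply: (@le_trans _ _ (cnorm (w k 0 j) * (3 * (`|h| * len R k))));
      last by rewrite le_eqVlt; apply/orP; left; apply/eqP; ring.
    rewrite ler_wpM2l ?cnorm_ge0// (le_trans (cis_taylor1 _))// ler_wpM2l// normrM
      ler_wpM2l//; exact: coord_len.
  rewrite -mulr_sumr.
  have := tail (B `\` B0)%fset; rewrite (_ : [disjoint _ & _]%fset); last first.
    by apply/fdisjointP => k kB; rewrite inE kB.
  move=> /(_ isT) tl.
  have h0 := normr_ge0 h.
  have := ler_wpM2l h0 tl; lra.
have Q1 : 0 < 8 * (Q + 1) by lra.
near=> h.
have h0 : h != 0 by near: h; exact: nbhs_dnbhs_neq.
have hs : `|h| < e / (8 * (Q + 1)).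
  near: h; apply: dnbhs0_lt; exact: divr_gt0.
have hp : 0 < `|h| by rewrite normr_gt0.
have -> : realize (dcoef i w) j x - h^-1 *: (realize w j (h *: 'e_i + x) - realize w j x) =
  - h^-1 * (realize w j (h *: 'e_i + x) - realize w j x - h * realize (dcoef i w) j x).
  by rewrite -[_ *: _]/(_ * _); field.
rewrite normrM normrN normfV mulrC ler_pdivrMr//.
apply: le_trans (main h) _.
rewrite -[h ^+ 2]real_normK ?num_real//.
move: hs; rewrite ltr_pdivlMr// => hs.
have := ler_wpM2l (ltW hp) (ltW hs).
have := sqr_ge0 `|h|; nra.
Unshelve. all: by end_near.
Qed.
End Realize.

(** * Sobolev norms and the momentum equation mode by mode *)

Section SobolevNorm.
Variable R : realType.
Local Notation K := ('rV[int]_3).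

(** The term of index 0 is missing in [hnorm] and vanishes on the right, [s]
    being positive. *)
Lemma hnorm_l2le n (s : nat) (w : coeffs R n) (c : R) : (0 < s)%N -> 0 <= c ->
  (hnorm s%:R w <= c%:E)%E <-> l2le (fun k => len R k ^+ s * vnorm (w k)) c.
Proof.
move=> s0 c0; rewrite /hnorm.
have E0 (k : K) : 0 <= sqlen R k `^ s%:R * sqnorm (w k).
  by rewrite mulr_ge0 ?powR_ge0 ?sqnorm_ge0.
have Ek (k : K) : (len R k ^+ s * vnorm (w k)) ^+ 2 = sqlen R k `^ s%:R * sqnorm (w k).
  by rewrite powR_mulrn ?sqlen_ge0// exprMn vnorm_sqr -len_sqr -!exprM mulnC.
have -> : (sqrte (\esum_(k in [set k : K | k != 0%R]) (sqlen R k `^ s%:R * sqnorm (w k))%:E)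
  <= c%:E)%E
  = (\esum_(k in [set k : K | k != 0%R]) (sqlen R k `^ s%:R * sqnorm (w k))%:E <=
    (c ^+ 2)%:E)%E.
  have -> : c%:E = sqrte (c ^+ 2)%:E by rewrite /= sqrtr_sqr ger0_norm.
  by rewrite lee_sqrt// lee_fin sqr_ge0.
rewrite esum_nneg_le//; split.
  move=> h; split=> // A.
  rewrite (fset_sum_split [fset (0 : K)]%fset) [X in X + _]big1_fset ?add0r.
    under eq_bigr do rewrite Ek.
    by apply: h => k; rewrite !inE => /andP[].
  move=> k; rewrite !inE => /andP[_ /eqP ->] _.
  by rewrite len0 expr0n gtn_eqF// mul0r expr0n.
move=> [_ h] A _; under eq_bigr do rewrite -Ek.
exact: h.
Qed.

Lemma hnorm_lty n (s : nat) (w : coeffs R n) : (0 < s)%N -> (hnorm s%:R w < +oo)%E ->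
  exists c : R, [/\ 0 <= c, hnorm s%:R w = c%:E &
    l2le (fun k => len R k ^+ s * vnorm (w k)) c].
Proof.
move=> s0 h.
have h0 : (0 <= hnorm s%:R w)%E by exact: sqrte_ge0.
have fin : hnorm s%:R w \is a fin_num by rewrite ge0_fin_numE.
exists (fine (hnorm s%:R w)); rewrite fineK//; split => //; first exact: fine_ge0.
by apply/hnorm_l2le => //; rewrite ?fine_ge0// fineK.
Qed.

(** Nonzero wavenumbers have length at least 1, so the Sobolev norms of
    zero-mean fields increase with the exponent. *)
Lemma l2le_weight n (w : coeffs R n) (a b : nat) c : (a <= b)%N -> w 0 = 0 ->
  l2le (fun k => len R k ^+ b * vnorm (w k)) c ->
  l2le (fun k => len R k ^+ a * vnorm (w k)) c.
Proof.
move=> ab w0; apply: le_l2le => // k.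
rewrite mulr_ge0 ?exprn_ge0 ?len_ge0 ?vnorm_ge0//=.
have [->|k0] := eqVneq k 0; first by rewrite w0 vnorm0 !mulr0.
rewrite ler_wpM2r ?vnorm_ge0// ler_weXn2l//; exact: len_ge1.
Qed.

Lemma l1le_vnorm n (w : coeffs R n) (r : nat) c : w 0 = 0 ->
  l2le (fun k => len R k ^+ r.+2 * vnorm (w k)) c ->
  l1le (fun k => len R k ^+ r * vnorm (w k)) (100 * c).
Proof.
move=> w0 h; apply: l1_of_l2; first by rewrite w0 vnorm0 mulr0.
by apply: le_l2le h => // k; rewrite mulrA -exprD lexx mulr_ge0 ?exprn_ge0 ?len_ge0 ?vnorm_ge0.
Qed.

Lemma l1le_coord n (w : coeffs R n) j (r s : nat) c : (r.+2 <= s)%N -> w 0 = 0 ->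
  l2le (fun k => len R k ^+ s * vnorm (w k)) c ->
  l1le (fun k => len R k ^+ r * cnorm (w k 0 j)) (100 * c).
Proof.
move=> rs w0 /(l2le_weight rs w0)/(l1le_vnorm w0); apply: le_l1le => // k.
by rewrite ler_wpM2l ?exprn_ge0 ?len_ge0 ?coord_vnorm.
Qed.

Lemma pder_realizeE n i (w : coeffs R n) j (s : nat) c : (3 <= s)%N ->
  real_coeffs w -> w 0 = 0 -> l2le (fun k => len R k ^+ s * vnorm (w k)) c ->
  pder i (realize w j) = realize (dcoef i w) j.
Proof.
move=> s3 wr w0 wc; apply/boolp.funext => x.
apply: (pder_realize _ (X := 100 * c)) => //.
- by have := l1le_coord j (r := 0) (ltnW s3) w0 wc; apply: le_l1le => // k; rewrite mul1r.
- by have := l1le_coord j (r := 1) s3 w0 wc; apply: le_l1le => // k.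
Qed.

Lemma dcoef_vnorm n i (w : coeffs R n) (k : K) : vnorm (dcoef i w k) <= len R k * vnorm (w k).
Proof.
rewrite /dcoef vnormZ ler_wpM2r ?vnorm_ge0//=.
by rewrite expr0n/= add0r sqrtr_sqr coord_len.
Qed.

Lemma dcoef0 n i (w : coeffs R n) : dcoef i w 0 = 0.
Proof.
by rewrite /dcoef mxE; apply/rowP => j; rewrite !mxE; apply/eqP;
  rewrite mulf_eq0 eq_complex/= !eqxx.
Qed.

Lemma dcoef_l2le n i (w : coeffs R n) (s : nat) c :
  l2le (fun k => len R k ^+ s.+1 * vnorm (w k)) c ->
  l2le (fun k => len R k ^+ s * vnorm (dcoef i w k)) c.
Proof.
apply: le_l2le => // k; rewrite mulr_ge0 ?exprn_ge0 ?len_ge0 ?vnorm_ge0//= exprSr -mulrA.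
by rewrite ler_wpM2l ?exprn_ge0 ?len_ge0 ?dcoef_vnorm.
Qed.

Lemma has_fourier_Hs n (w : coeffs R n) j (s : nat) c : (2 <= s)%N ->
  real_coeffs w -> w 0 = 0 -> l2le (fun k => len R k ^+ s * vnorm (w k)) c ->
  has_fourier (realize w j) (fun k => w k 0 j).
Proof.
move=> s2 wr w0 wc; apply: (has_fourier_realize (X := 100 * c)) => //.
by have := l1le_coord j (r := 0) s2 w0 wc; apply: le_l1le => // k; rewrite mul1r.
Qed.

Lemma has_fourier_laplacian n (w : coeffs R n) j c : real_coeffs w -> w 0 = 0 ->
  l2le (fun k => len R k ^+ 4 * vnorm (w k)) c ->
  has_fourier (laplacian (realize w j)) (fun k => - (len R k ^+ 2)%:C%C * w k 0 j).
Proof.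
move=> wr w0 wc.
have dd i : has_fourier (pder i (pder i (realize w j))) (fun k => dcoef i (dcoef i w) k 0 j).
  rewrite (pder_realizeE _ _ _ wr w0 wc)//.
  have wc1 := dcoef_l2le i wc.
  rewrite (pder_realizeE _ _ _ (dcoef_real i wr) (dcoef0 i w) wc1)//.
  apply: (has_fourier_Hs _ _ (dcoef_real i (dcoef_real i wr)) (dcoef0 i _) (dcoef_l2le i
    wc1)) => //.
have := has_fourier_sum (index_enum 'I_3) dd.
apply: has_fourier_ext => // k.
rewrite len_sqr /sqlen rmorph_sum -sumrN mulr_suml; apply: eq_bigr => i _.
rewrite /dcoef !mxE mulrA; congr (_ * _).
by apply/eqP; rewrite eq_complex/= !mul0r mulr0 sub0r addr0 oppr0 expr2 !eqxx.
Qed.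

(** The contribution of the frequency [l] to the [m]-th coefficient of
    u.grad f is [adv u m l * f l]. *)
Definition adv (u : coeffs R 3) (m l : K) : R[i] :=
  \sum_i u (m - l) 0 i * (0 +i* (l 0 i)%:~R)%C.

(** Two derivatives make a series absolutely convergent and the convection term
    takes one more, which H^3 affords. *)
Lemma convection_modes (u : coeffs R 3) (p : coeffs R 1) f a j c cp :
  real_coeffs u -> u 0 = 0 -> l2le (fun k => len R k ^+ 3 * vnorm (u k)) c ->
  real_coeffs p -> p 0 = 0 -> l2le (fun k => len R k ^+ 3 * vnorm (p k)) cp ->
  has_fourier f a ->
  (forall x, f x + convection u j x + pder j (realize p 0) x = 0) ->
  forall m (e : R), 0 < e -> exists B0 : {fset K}, forall B, (B0 `<=` B)%fset ->
    cnorm (a m + (0 +i* (m 0 j)%:~R)%C * p m 0 0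
           + \sum_(l <- B) adv u m l * u l 0 j) <= e.
Proof.
move=> ur u0 uc pr p0 pc fa eqn m e e0.
have l1u i : l1le (fun k => cnorm (u k 0 i)) (100 * c).
  by have := l1le_coord i (r := 0) (s := 3) isT u0 uc; apply: le_l1le => // k; rewrite mul1r.
have l1du i : l1le (fun k => cnorm (dcoef i u k 0 j)) (100 * c).
  have := l1le_coord j (r := 1) (s := 3) isT u0 uc; apply: le_l1le => // k.
  exact: dcoef_cnorm.
have hp : has_fourier (pder j (realize p 0)) (fun k => (0 +i* (k 0 j)%:~R)%C * p k 0 0).
  rewrite (pder_realizeE _ _ _ pr p0 pc)//.
  apply: (has_fourier_ext (frefl _) _ (has_fourier_Hs _ _ (dcoef_real j pr) (dcoef0 j p)
    (dcoef_l2le j pc))) => // k.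
  by rewrite /dcoef mxE.
have := product_modes (has_fourierD fa hp)
  (fun i => has_fourier_Hs i _ ur u0 uc)
  (fun i => has_fourier_Hs j _ (dcoef_real i ur) (dcoef0 i u) (dcoef_l2le i uc))
  l1u l1du _ m e0.
move=> /(_ isT isT) [|B0 hB].
  move=> x; rewrite -[RHS](eqn x) addrAC; congr (_ + _ + _).
  rewrite /convection; apply: eq_bigr => i _; congr (_ * _).
  by rewrite (pder_realizeE _ _ _ ur u0 uc).
exists B0 => B /hB; congr (cnorm (_ + _) <= _).
apply: eq_bigr => l _; rewrite /adv mulr_suml; apply: eq_bigr => i _.
by rewrite /dcoef mxE mulrA.
Qed.

End SobolevNorm.

(** * Uniformity in time and a nonlinear Gronwall inequality *)

Section FsetFilter.
Variable I : choiceType.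
(** The directed set of finite subsets: lets the compactness of [0, T] be used
    for properties that hold for all large finite sets of frequencies. *)
Definition fset_filter : set_system {fset I} :=
  [set P | exists A0 : {fset I}, forall A, (A0 `<=` A)%fset -> P A].
Global Instance fset_filter_filter : Filter fset_filter.
Proof.
split; first by exists fset0.
- move=> P Q [A hA] [B hB]; exists (A `|` B)%fset => D.
  by rewrite fsubUset => /andP[/hA PD /hB QD].
- by move=> P Q PQ [A hA]; exists A => B /hA /PQ.
Qed.
End FsetFilter.

Section TimeUniformity.
Variable R : realType.
Local Notation K := ('rV[int]_3).
Implicit Types (T t r : R).

Lemma hnorm_near (I : Type) (F : set_system I) n (s : nat) (g : I -> coeffs R n) (c : R) :
  Filter F -> (0 < s)%N -> 0 < c -> (fun i => hnorm s%:R (g i)) @ F --> 0%E ->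
  \forall i \near F, l2le (fun k => len R k ^+ s * vnorm (g i k)) c.
Proof.
move=> FF s0 c0 /(_ [set y | (y < c%:E)%E]) h.
have /h : nbhs (0%E : \bar R) [set y | (y < c%:E)%E] by apply: open_ereal_lt'; rewrite lte_fin.
move=> hF; apply: (@filterS _ _ _ [set i | (hnorm s%:R (g i) < c%:E)%E]) hF => r /= /ltW hr.
by apply/hnorm_l2le => //; exact: ltW.
Qed.

Lemma sqr_vnormD n (z y : 'rV[R[i]]_n) : vnorm (z + y) ^+ 2 <=
  2 * vnorm z ^+ 2 + 2 * vnorm y ^+ 2.
Proof.
have := vnormD z y; have := vnorm_ge0 z; have := vnorm_ge0 y; have := vnorm_ge0 (z + y).
move=> a b c d; have : vnorm (z + y) ^+ 2 <=
  (vnorm z + vnorm y) ^+ 2 by rewrite lerXn2r// nnegrE addr_ge0.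
have := sqr_ge0 (vnorm z - vnorm y); lra.
Qed.

Lemma C0Hs_near T (s : nat) w t c : (0 < s)%N -> 0 < c -> C0Hs T s%:R w -> t \in `[0, T] ->
  \forall r \near t, r \in `[0, T] -> l2le (fun k => len R k ^+ s * vnorm (w r k - w t k)) c.
Proof.
move=> s0 c0 [_ wc] tT; have := hnorm_near _ s0 c0 (wc t tT).
exact.
Qed.

(** A continuous curve in H^s has a compact image, so its tails are uniformly
    small.  Near each time the tail is at most twice the tail at that time plus
    twice the squared distance, and finitely many times suffice. *)
Lemma C0Hs_tail T (s : nat) w (e : R) : (0 < s)%N -> C0Hs T s%:R w -> 0 < e ->
  exists B0 : {fset K}, forall t, t \in `[0, T] -> forall D : {fset K},
    [disjoint B0 & D]%fset -> \sum_(k <- D) (len R k ^+ s * vnorm (w t k)) ^+ 2 <= e.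
Proof.
move=> s0 wC e0.
pose P (B : {fset K}) (t : R) := forall D : {fset K},
    [disjoint B & D]%fset -> \sum_(k <- D) (len R k ^+ s * vnorm (w t k)) ^+ 2 <= e.
suff : \forall B \near (@fset_filter K), `[0, T] `<=` P B.
  move=> [B0 hB]; exists B0 => t tT; exact: (hB B0 (fsubset_refl _)).
have /compact_near_coveringP/near_covering_withinP := @segment_compact R 0 T.
apply => t tT.
have e4 : 0 < Num.sqrt e / 2 by rewrite divr_gt0// sqrtr_gt0.
have nr := C0Hs_near s0 e4 wC tT.
have [c [c0 _ [_ wt]]] : exists c, [/\ 0 <= c, hnorm s%:R (w t) = c%:E & l2le (fun k =>
  len R k ^+ s * vnorm (w t k)) c].
  by apply: hnorm_lty => //; have [[_ _ h] _] := wC.1 t tT.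
have e4' : 0 < e / 4 by lra.
have [B1 tl] := l1le_tail (fun k => sqr_ge0 _) wt e4'.
exists ([set r | r \in `[0, T]
  -> l2le (fun k => len R k ^+ s * vnorm (w r k - w t k)) (Num.sqrt e / 2)],
  [set B | (B1 `<=` B)%fset]) => /=.
  by split => //; exists B1.
move=> [r B] /= [hr hB] rT D BD.
have [_ /(_ D) h1] := hr rT.
have h2 := tl D (fdisjointWl hB BD).
apply: (@le_trans _ _ (\sum_(k <- D) (2 * (len R k ^+ s * vnorm (w r k - w t k)) ^+ 2 + 2 *
  (len R k ^+ s * vnorm (w t k)) ^+ 2))).
  apply: ler_sum => k _; rewrite !exprMn.
  have := ler_wpM2l (sqr_ge0 (len R k ^+ s)) (sqr_vnormD (w r k - w t k) (w t k)).
  rewrite subrK; lra.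
rewrite big_split/= -!mulr_sumr.
have sq := sqr_sqrtr (ltW e0); have sq4 : (Num.sqrt e / 2) ^+ 2 = e / 4 by lra.
move: h1; rewrite sq4; lra.
Qed.

(** The same covering of [0, T], for the size of the norm. *)
Lemma C0Hs_bound T (s : nat) w : (0 < s)%N -> C0Hs T s%:R w ->
  exists2 M : R, 0 <= M & forall t, t \in `[0, T] ->
    l2le (fun k => len R k ^+ s * vnorm (w t k)) M.
Proof.
move=> s0 wC.
pose P (M : R) (t : R) := l2le (fun k => len R k ^+ s * vnorm (w t k)) M.
suff : \forall M \near +oo, `[0, T] `<=` P M.
  move=> h; near (pinfty_nbhs R) => M.
  have hM : `[0, T] `<=` P M by near: M.
  have M0 : 0 <= M by near: M; apply: nbhs_pinfty_ge; exact: num_real.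
  by exists M.
have /compact_near_coveringP/near_covering_withinP := @segment_compact R 0 T.
apply => t tT.
have nr := C0Hs_near s0 ltr01 wC tT.
have [c [c0 _ [_ wt]]] : exists c, [/\ 0 <= c, hnorm s%:R (w t) = c%:E & l2le (fun k =>
  len R k ^+ s * vnorm (w t k)) c].
  by apply: hnorm_lty => //; have [[_ _ h] _] := wC.1 t tT.
exists ([set r | r \in `[0, T] -> l2le (fun k => len R k ^+ s * vnorm (w r k - w t k)) 1],
  [set M | 2 + 2 * c <= M]); first by split; [exact: nr|apply: nbhs_pinfty_ge; exact: num_real].
move=> [r M] /= [hr hM] rT; split; first lra.
move=> D.
have [_ /(_ D) h1] := hr rT.
have h2 := wt D.
apply: (@le_trans _ _ (\sum_(k <- D) (2 * (len R k ^+ s * vnorm (w r k - w t k)) ^+ 2 + 2 *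
  (len R k ^+ s * vnorm (w t k)) ^+ 2))).
  apply: ler_sum => k _; rewrite !exprMn.
  have := ler_wpM2l (sqr_ge0 (len R k ^+ s)) (sqr_vnormD (w r k - w t k) (w t k)).
  rewrite subrK; lra.
rewrite big_split/= -!mulr_sumr.
have : (2 + 2 * c) ^+ 2 <= M ^+ 2 by rewrite lerXn2r// nnegrE; lra.
move: h1; rewrite expr1n; nra.
Unshelve. all: by end_near.
Qed.

Lemma is_derive_quotient (f : R -> R) t df :
  (forall e : R, 0 < e -> \forall r \near t^', `|(r - t)^-1 * (f r - f t) - df| <= e) ->
  is_derive t 1 f df.
Proof.
move=> h.
have cv : (fun h => h^-1 *: (f (h *: 1 + t) - f t)) @ (0 : R)^' --> df.
  apply/cvgrPdist_le => /= e e0.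
  have := h e e0; rewrite !near_withinE => /nbhs_ballP[d /= d0 hd].
  apply/nbhs_ballP; exists d => //= r rd r0.
  have := hd (r + t); rewrite /ball/= opprD addrCA subrr addr0 -[- r]add0r => /(_ rd).
  rewrite addrK -[_ *: (_ - _)]/(_ * _) [_ *: 1]mulr1 distrC; apply.
  by rewrite -subr_eq0 addrK.
apply: DeriveDef; first by apply/cvg_ex; exists df.
exact: cvg_lim cv.
Qed.

Lemma coord_of_l2le n (w : coeffs R n) (s : nat) c (k : K) j : k != 0 ->
  l2le (fun k => len R k ^+ s * vnorm (w k)) c -> cnorm (w k 0 j) <= c.
Proof.
move=> k0 [c0 /(_ [fset k]%fset)]; rewrite big_seq_fset1 => h.
have : len R k ^+ s * vnorm (w k) <= c.
  by rewrite -(@ler_pXn2r _ 2)// nnegrE ?mulr_ge0 ?exprn_ge0 ?len_ge0 ?vnorm_ge0.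
apply: le_trans; apply: le_trans (coord_vnorm _ j) _.
by rewrite ler_peMl ?vnorm_ge0// exprn_ege1// len_ge1.
Qed.

Lemma itv_near_interior T t : t \in `]0, T[ -> \forall r \near t, r \in `[0, T].
Proof.
move=> tT; apply: filterS (near_in_itvoo tT) => r.
by rewrite !in_itv/= => /andP[/ltW -> /ltW ->].
Qed.

(** Differentiability in H^s implies that of each Fourier coefficient, whose
    real and imaginary parts are then ordinary real functions.  The coefficient
    of index 0, which the norm does not see, is identically zero. *)
Lemma C1Hs_coord T (s : nat) u du t (k : K) j : (0 < s)%N -> C1Hs T s%:R u du ->
  t \in `]0, T[ ->
  is_derive t 1 (fun r => complex.Re (u r k 0 j)) (complex.Re (du t k 0 j)) /\
  is_derive t 1 (fun r => complex.Im (u r k 0 j)) (complex.Im (du t k 0 j)).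
Proof.
move=> s0 [[uH _] [duH _] hd] tT.
have tT' : t \in `[0, T] by move: tT; rewrite !in_itv/= => /andP[/ltW -> /ltW ->].
suff main (e : R) : 0 < e -> \forall r \near t^',
    cnorm (((r - t)^-1)%:C%C * (u r k 0 j - u t k 0 j) - du t k 0 j) <= e.
  split; apply: is_derive_quotient => e /main; apply: filterS => r; apply: le_trans;
  set c := (r - t)^-1; set z := u r k 0 j; set z' := u t k 0 j; set dz := du t k 0 j.
    have -> : c * (complex.Re z - complex.Re z') - complex.Re dz =
      complex.Re (c%:C%C * (z - z') - dz).
      by case: (z) (z') (dz) => [? ?] [? ?] [? ?] /=; rewrite mul0r subr0.
    exact: cnorm_Re.
  have -> : c * (complex.Im z - complex.Im z') - complex.Im dz =
    complex.Im (c%:C%C * (z - z') - dz).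
    by case: (z) (z') (dz) => [? ?] [? ?] [? ?] /=; rewrite mul0r addr0.
  rewrite -ler_sqr ?nnegrE ?cnorm_ge0// cnorm_sqr real_normK ?num_real//.
  by rewrite lerDr sqr_ge0.
move=> e0.
have [k0|k0] := eqVneq k 0.
  have zero r : r \in `[0, T] -> u r k 0 j = 0.
    by move=> /uH[[h _ _] _]; rewrite k0 h mxE.
  have dz : du t k 0 j = 0 by have [[h _ _] _] := duH _ tT'; rewrite k0 h mxE.
  near=> r.
  have rT : r \in `[0, T].
    by near: r; apply: nbhs_dnbhs; exact: itv_near_interior.
  by rewrite !zero// dz !subr0 mulr0 cnorm0 ltW.
have := hnorm_near _ s0 e0 (hd t tT') => hn.
near=> r.
have rT : r \in `[0, T].
  by near: r; apply: nbhs_dnbhs; exact: itv_near_interior.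
have /(coord_of_l2le j k0) : l2le (fun k =>
  len R k ^+ s * vnorm ((((r - t)^-1)%:C%C *: (u r - u t) - du t) k)) e.
  move: rT; near: r; exact: hn.
by rewrite !mxE.
Unshelve. all: by end_near.
Qed.

Lemma C0Hs_coord T (s : nat) u t (k : K) j (e : R) : (0 < s)%N -> C0Hs T s%:R u ->
  t \in `[0, T] -> 0 < e ->
  \forall r \near t, r \in `[0, T] -> cnorm (u r k 0 j - u t k 0 j) <= e.
Proof.
move=> s0 uC tT e0.
have [k0|k0] := eqVneq k 0.
  near=> r => rT.
  have [[h _ _] _] := uC.1 t tT; have [[h' _ _] _] := uC.1 r rT.
  by rewrite k0 h h' subrr cnorm0 ltW.
apply: filterS (C0Hs_near s0 e0 uC tT) => r h /h.
by move=> /(coord_of_l2le (w := fun k => u r k - u t k) j k0); rewrite !mxE.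
Unshelve. all: by end_near.
Qed.

(** The function [(y + eta) / (1 + y) = 1 - (1 - eta) / (1 + y)] grows at most
    exponentially with rate [C], because the factor [1 + y] of the hypothesis
    cancels on differentiating.  It starts below [y 0 + eta] and therefore stays
    below [D = (y 0 + eta) exp(C T)], and [y + eta <= D (1 + y)] with
    [D <= 1 / 2] gives [y <= 2 D]. *)
Lemma gronwall_rational (T C eta : R) (y dy : R -> R) : 0 < T -> 0 <= C ->
  0 < eta <= 1 ->
  (forall t, t \in `[0, T] -> 0 <= y t) ->
  {within `[0, T], continuous y} ->
  (forall t, t \in `]0, T[ -> is_derive t 1 y (dy t)) ->
  (forall t, t \in `]0, T[ -> dy t <= C * (1 + y t) * (y t + eta)) ->
  (y 0 + eta) * expR (C * T) <= 1 / 2 ->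
  forall t, t \in `[0, T] -> y t <= 2 * ((y 0 + eta) * expR (C * T)).
Proof.
move=> T0 C0 /andP[eta0 eta1] y0 yc yd hd small t tT.
pose h (r : R) : R := (1 - (1 - eta) * (1 + y r)^-1) * expR (- C * r).
have oT r : r \in `]0, T[ -> r \in `[0, T].
  by rewrite !in_itv/= => /andP[/ltW -> /ltW ->].
have hder r : r \in `]0, T[ -> is_derive r 1 h
   (((1 - eta) * (dy r / (1 + y r) ^+ 2) - C * (1 - (1 - eta) * (1 + y r)^-1)) * expR (- C *
     r)).
  move=> rT; have yr := yd r rT; have yp := y0 r (oT r rT).
  have ny : 1 + y r != 0 by apply: lt0r_neq0; lra.
  have d1 : is_derive r 1 (fun r => 1 + y r) (dy r).
    by apply: is_derive_eq (is_deriveD (is_derive_cst (1 : R) r 1) yr) _; rewrite add0r.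
  have d2 : is_derive r 1 (fun r => (1 + y r)^-1) (- (1 + y r) ^- 2 * dy r).
    exact: is_deriveV.
  have e1 : is_derive r 1 (fun r => - C * r) (- C).
    by apply: is_derive_eq (is_deriveZ (- C) (is_derive_id r (1 : R))) _;
      rewrite -[_ *: _]/(_ * _) mulr1.
  have d3 : is_derive r 1 (fun r => expR (- C * r)) (expR (- C * r) * (- C)).
    exact: (is_derive1_comp (is_derive_expR (- C * r)) e1).
  have d4 : is_derive r 1 (fun r =>
    1 - (1 - eta) * (1 + y r)^-1) (- ((1 - eta) * (- (1 + y r) ^- 2 * dy r))).
    by apply: is_derive_eq (is_deriveB (is_derive_cst (1 : R) r 1) (is_deriveZ (1 - eta) d2))
      _; rewrite sub0r.
  apply: is_derive_eq (is_deriveM d4 d3) _.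
  rewrite -[_ *: _ + _ *: _]/(_ * _ + _ * _); ring.
have hle r : r \in `]0, T[ -> derive1 h r <= 0.
  move=> rT; have yp := y0 r (oT r rT).
  rewrite derive1E (@derive_val _ _ _ _ _ _ _ (hder r rT)).
  rewrite mulrC pmulr_rle0 ?expR_gt0//.
  have := hd r rT; set Y := y r in yp *; set dY := dy r => hdy.
  have Y1 : 0 < 1 + Y by lra.
  have -> : 1 - (1 - eta) * (1 + Y)^-1 = (Y + eta) / (1 + Y) by field; lra.
  have b1 : dY / (1 + Y) ^+ 2 <= C * (Y + eta) / (1 + Y).
    rewrite ler_pdivrMr ?exprn_gt0//.
    have -> : C * (Y + eta) / (1 + Y) * (1 + Y) ^+ 2 = C * (1 + Y) * (Y + eta) by field; lra.
    exact: hdy.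
  have b2 : 0 <= C * (Y + eta) / (1 + Y) by rewrite divr_ge0 ?mulr_ge0//; lra.
  have := ler_wpM2l (_ : 0 <= 1 - eta) b1; rewrite subr_ge0 => /(_ eta1) b3.
  have b4 : (1 - eta) * (C * (Y + eta) / (1 + Y)) <= C * (Y + eta) / (1 + Y).
    by rewrite ler_piMl//; lra.
  rewrite mulrA in b4 *; lra.
have hc : {within `[0, T], continuous h}.
  apply/subspace_continuousP => r rT.
  have yr : y @ within `[0, T] (nbhs r) --> y r by move/subspace_continuousP: yc => /(_ r rT).
  have yp := y0 r rT.
  apply: cvgM.
    apply: cvgB; first exact: cvg_cst.
    apply: cvgM; first exact: cvg_cst.
    apply: cvgV; first by apply: lt0r_neq0; lra.
    by apply: cvgD => //; exact: cvg_cst.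
  apply: cvg_within_filter.
  apply: (continuous_comp (f := fun r => - C * r) (g := @expR R)).
    by apply: cvgM; [exact: cvg_cst|exact: cvg_id].
  exact: continuous_expR.
have hmono := @ler0_derive1_le_cc R h 0 T (fun r rT =>
  @ex_derive _ _ _ _ _ _ _ (hder r rT)) hle hc.
have T00 : (0 : R) \in `[0, T] by rewrite in_itv/= lexx ltW.
have t0 : 0 <= t by move: tT; rewrite in_itv/= => /andP[].
have tleT : t <= T by move: tT; rewrite in_itv/= => /andP[].
have := hmono t 0 tT T00 t0; rewrite /h mulr0 expR0 mulr1 => hh.
have yp := y0 t tT; have y00 := y0 0 T00.
set Y := y t in yp hh *; set Z := y 0 in y00 small hh *.
have eqY : 1 - (1 - eta) * (1 + Y)^-1 = (Y + eta) / (1 + Y) by field; lra.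
have eqZ : 1 - (1 - eta) * (1 + Z)^-1 = (Z + eta) / (1 + Z) by field; lra.
rewrite eqY eqZ in hh.
have E0 : 0 < expR (C * t) by exact: expR_gt0.
have hE : expR (C * t) <= expR (C * T) by rewrite ler_expR ler_wpM2l.
have k1 : (Y + eta) / (1 + Y) <= (Z + eta) * expR (C * T).
  have : (Y + eta) / (1 + Y) <= (Z + eta) / (1 + Z) * expR (C * t).
    by move: hh; rewrite mulNr expRN ler_pdivrMr.
  move/le_trans; apply; apply: ler_pM => //.
  - by rewrite divr_ge0//; lra.
  - by rewrite ler_pdivrMr ?ler_peMr//; lra.
set D := (Z + eta) * _ in small k1 *.
have Y1 : 0 < 1 + Y by lra.
move: k1; rewrite ler_pdivrMr// => k1; nra.
Qed.

End TimeUniformity.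

(** * Inequalities between frequencies *)

Section Symbols.
Variable R : realType.
Implicit Types (N p q r s b : R).

(** A piecewise linear profile, 1 up to N and 0 beyond 2N: its Lipschitz constant
    1/N is what the commutator with the nonlinearity requires. *)
Definition cut N r : R := Num.max 0 (Num.min 1 (2 - r / N)).

(** Comparable to r^3 above N and to N r^2 below. *)
Definition omega N r : R := r ^+ 2 * (r + N).

Lemma cut_ge0 N r : 0 <= cut N r. Proof. by rewrite le_max lexx. Qed.
Lemma cut_le1 N r : cut N r <= 1. Proof. by rewrite ge_max ler01 ge_min lexx. Qed.
Lemma cut_in N r : 0 < N -> r <= N -> cut N r = 1.
Proof.
move=> N0 rN; have : r / N <= 1 by rewrite ler_pdivrMr ?mul1r.
by move=> h; rewrite /cut min_l ?max_r//; lra.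
Qed.
Lemma cut_out N r : 0 < N -> 2 * N <= r -> cut N r = 0.
Proof.
move=> N0 rN; have : 2 <= r / N by rewrite ler_pdivlMr.
by move=> h; rewrite /cut min_r ?max_l//; lra.
Qed.
Lemma cut_lip N p q : 0 < N -> `|cut N p - cut N q| <= `|p - q| / N.
Proof.
move=> N0; rewrite -[X in _ <= _ / X](gtr0_norm N0) -normf_div mulrBl /cut.
move: (p / N) (q / N) => {p q} x y.
wlog xy : x y / x <= y.
  by move=> H; case: (leP x y) => [/H//|/ltW/H]; rewrite distrC (distrC y).
rewrite (ler0_norm (_ : x - y <= 0)) ?subr_le0// opprB.
rewrite !maxElt !minElt ler_norml.
case: (ltP 1 (2 - x)) => ?; case: (ltP 1 (2 - y)) => ?; rewrite ?ltr01;
case: (ltP 0 (2 - x)) => ?; case: (ltP 0 (2 - y)) => ?; apply/andP; split; lra.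
Qed.

Lemma cut_near1 N r : 0 < N -> 0 <= r -> 1 - cut N r <= r / N.
Proof.
move=> N0 r0; have := cut_lip r 0 N0; rewrite subr0 (cut_in N0 (ltW N0)).
rewrite (ger0_norm r0) ler_norml; lra.
Qed.

Lemma omega_ge0 N r : 0 <= N -> 0 <= r -> 0 <= omega N r.
Proof. by move=> N0 r0; rewrite mulr_ge0 ?exprn_ge0 ?addr_ge0. Qed.

Lemma omega_le N p q : 0 <= N -> 0 <= p <= q -> omega N p <= omega N q.
Proof.
move=> N0 /andP[p0 pq]; apply: ler_pM; rewrite ?exprn_ge0 ?addr_ge0// ?lerD2r//.
by rewrite lerXn2r// nnegrE (le_trans p0).
Qed.

Lemma cube_le_omega N r : 0 <= N -> 0 <= r -> r ^+ 3 <= omega N r.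
Proof. by move=> N0 r0; rewrite /omega exprSr ler_wpM2l ?exprn_ge0// lerDl. Qed.

Lemma omega_cube N r : 0 <= N -> 1 <= r -> omega N r <= (1 + N) * r ^+ 3.
Proof.
move=> N0 r1; have r20 : 0 <= r ^+ 2 by exact: sqr_ge0.
have r10 : 0 <= r - 1 by lra.
rewrite /omega; have := mulr_ge0 r20 (mulr_ge0 N0 r10); lra.
Qed.

(** Here [b >= s] are the two frequencies of a pair and [p] is at least their
    difference.  Factorizing [omega b - omega s] by [b - s <= p] gains the power
    of frequency that the factor [s] costs; then [b <= p + s] distributes the
    remaining powers so that each term of the result can be summed by a Young
    inequality. *)
Lemma commutator_symbol_ordered N p s b : 0 <= N -> 0 <= p -> 0 <= s -> s <= b -> b - s <= p ->
  (omega N b ^+ 2 - omega N s ^+ 2) * s <=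
  16 * ((p ^+ 3 * (s + N) + p * omega N s) * omega N b).
Proof.
move=> N0 p0 s0 sb bsp; have b0 : 0 <= b by exact: le_trans sb.
have ob := omega_ge0 N0 b0; have os := omega_ge0 N0 s0.
have osb : omega N s <= omega N b by apply: omega_le; rewrite ?s0.
have d0 : 0 <= omega N b - omega N s by lra.
have dle : omega N b - omega N s <= p * (3 * b ^+ 2 + 2 * N * b).
  have -> : omega N b - omega N s = (b - s) * (b ^+ 2 + b * s + s ^+ 2 + N * (b + s)).
    by rewrite /omega; ring.
  apply: ler_pM; [lra| |exact: bsp|].
    by rewrite !addr_ge0 ?mulr_ge0 ?addr_ge0 ?sqr_ge0.
  have h1 : b * s <= b ^+ 2 by rewrite expr2 ler_wpM2l.
  have h2 : s ^+ 2 <= b ^+ 2 by rewrite lerXn2r.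
  have h3 : N * s <= N * b by rewrite ler_wpM2l.
  lra.
have h1 : (omega N b ^+ 2 - omega N s ^+ 2) * s <=
   (p * (3 * b ^+ 2 + 2 * N * b)) * (2 * omega N b) * s.
  rewrite subr_sqr; apply: ler_wpM2r => //; apply: ler_pM => //; lra.
apply: le_trans h1 _.
have bps : b <= p + s by lra.
have b2 : b ^+ 2 <= 2 * p ^+ 2 + 2 * s ^+ 2.
  apply: (@le_trans _ _ ((p + s) ^+ 2)); first by rewrite lerXn2r// nnegrE addr_ge0.
  have := sqr_ge0 (p - s); lra.
have key : p * (3 * b ^+ 2 + 2 * N * b) * s <= 8 * (p ^+ 3 * (s + N) + p * omega N s).
  have ps0 : 0 <= p * s by exact: mulr_ge0.
  have k1 : (p * s) * (3 * b ^+ 2) <= (p * s) * (6 * p ^+ 2 + 6 * s ^+ 2).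
    by rewrite ler_wpM2l//; lra.
  have k2 : (p * s * N) * b <= (p * s * N) * (p + s) by rewrite ler_wpM2l ?mulr_ge0.
  have k3 : (N * p) * (p * s) <= (N * p) * (p ^+ 2 + s ^+ 2).
    rewrite ler_wpM2l ?mulr_ge0//; have := sqr_ge0 (p - s); have := sqr_ge0 p;
      have := sqr_ge0 s; lra.
  have n1 : 0 <= p ^+ 3 * s by rewrite mulr_ge0 ?exprn_ge0.
  have n2 : 0 <= p ^+ 3 * N by rewrite mulr_ge0 ?exprn_ge0.
  have n3 : 0 <= p * s ^+ 3 by rewrite mulr_ge0 ?exprn_ge0.
  have n4 : 0 <= p * s ^+ 2 * N by rewrite !mulr_ge0 ?exprn_ge0.
  rewrite /omega; lra.
have := ler_wpM2r ob key; lra.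
Qed.

(** The minimum of the two frequencies is available since an incompressible
    advecting field lets the derivative fall on either factor ([adv_min]). *)
Lemma commutator_symbol N p q r : 0 <= N -> 0 <= p -> 0 <= q -> 0 <= r -> `|r - q| <= p ->
  `|omega N r ^+ 2 - omega N q ^+ 2| * Num.min q r <=
  16 * ((p ^+ 3 * (q + N) + p * omega N q) * omega N r +
        (p ^+ 3 * (r + N) + p * omega N r) * omega N q).
Proof.
move=> N0 p0 q0 r0; rewrite ler_norml => /andP[h1 h2].
have oq := omega_ge0 N0 q0; have orr := omega_ge0 N0 r0.
have t1 : 0 <= (p ^+ 3 * (q + N) + p * omega N q) * omega N r.
  by apply: mulr_ge0 => //; apply: addr_ge0; apply: mulr_ge0; rewrite ?exprn_ge0 ?addr_ge0.
have t2 : 0 <= (p ^+ 3 * (r + N) + p * omega N r) * omega N q.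
  by apply: mulr_ge0 => //; apply: addr_ge0; apply: mulr_ge0; rewrite ?exprn_ge0 ?addr_ge0.
have [qr|/ltW rq] := leP q r.
  have := commutator_symbol_ordered N0 p0 q0 qr h2.
  have osq : omega N q ^+ 2 <= omega N r ^+ 2.
    by rewrite lerXn2r// ?nnegrE//; apply: omega_le; rewrite ?q0.
  rewrite ger0_norm ?subr_ge0//; lra.
have h2' : q - r <= p by lra.
have := commutator_symbol_ordered N0 p0 r0 rq h2'.
have osq : omega N r ^+ 2 <= omega N q ^+ 2.
  by rewrite lerXn2r// ?nnegrE//; apply: omega_le; rewrite ?r0.
rewrite ler0_norm ?subr_le0// opprB; lra.
Qed.

Lemma omega_add N p q r : 0 <= N -> 0 <= p -> 0 <= q -> 0 <= r -> r <= p + q ->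
  omega N r <= 8 * (omega N p + omega N q).
Proof.
move=> N0 p0 q0 r0 rpq.
have dbl s : 0 <= s -> omega N (2 * s) <= 8 * omega N s.
  by move=> s0; rewrite /omega; have := mulr_ge0 (sqr_ge0 s) N0; lra.
have op := omega_ge0 N0 p0; have oq := omega_ge0 N0 q0.
have [pq|/ltW qp] := leP p q.
  apply: (@le_trans _ _ (omega N (2 * q))); first by apply: omega_le; rewrite ?r0//=; lra.
  have := dbl q q0; lra.
apply: (@le_trans _ _ (omega N (2 * p))); first by apply: omega_le; rewrite ?r0//=; lra.
have := dbl p p0; lra.
Qed.

(** The truncated field has no frequency [q] above [2 N], so one power of [q] in
    [omega q * q] is traded for [p + N]: this is the step that would lose a
    derivative without truncation. *)
Lemma transport_symbol N p q r : 0 < N -> 0 <= p -> 0 <= q -> 0 <= r -> r <= p + q ->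
  omega N r * q * cut N q <= 8 * (omega N p * q) + 24 * ((p + N) * q ^+ 3).
Proof.
move=> N0 p0 q0 r0 rpq; have N0' := ltW N0.
have op := omega_ge0 N0' p0; have oq := omega_ge0 N0' q0; have or := omega_ge0 N0' r0.
have n1 : 0 <= omega N p * q by exact: mulr_ge0.
have n2 : 0 <= (p + N) * q ^+ 3 by rewrite mulr_ge0 ?addr_ge0 ?exprn_ge0.
have [qN|/ltW Nq] := leP q (2 * N); last first.
  by rewrite (cut_out N0 Nq) mulr0; lra.
apply: (@le_trans _ _ (omega N r * q)).
  by rewrite ler_piMr ?cut_le1// mulr_ge0.
have := ler_wpM2r q0 (omega_add N0' p0 q0 r0 rpq).
have : omega N q * q <= 3 * ((p + N) * q ^+ 3).
  have -> : omega N q * q = (q + N) * q ^+ 3 by rewrite /omega; ring.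
  by rewrite mulrA ler_wpM2r ?exprn_ge0//; lra.
lra.
Qed.

(** All cutoffs are 1 and the difference vanishes when [p] and [q] are below
    [N / 2].  If [p] dominates, the crude bound by 1 is enough.  If [q] dominates,
    the Lipschitz bound gains [p / N], and the lost factor [N] is recovered from
    the minimum: when it exceeds [2 N], both cutoffs at [q] and [r] vanish. *)
Lemma truncation_symbol N p q r : 0 < N -> 0 <= p -> 0 <= q -> 0 <= r ->
  r <= p + q -> `|r - q| <= p ->
  omega N r * Num.min q r * `|cut N p * cut N q - cut N r| <=
  64 * ((if N / 2 < p then p ^+ 3 else 0) * q + p * (if N / 2 < q then q ^+ 3 else 0)).
Proof.
move=> N0 p0 q0 r0 rpq rq; have N0' := ltW N0.
have or := omega_ge0 N0' r0.
have c1 := cut_ge0 N p; have c2 := cut_ge0 N q; have c3 := cut_ge0 N r.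
have d1 := cut_le1 N p; have d2 := cut_le1 N q; have d3 := cut_le1 N r.
set D := `|_|.
have D0 : 0 <= D by exact: normr_ge0.
have D1 : D <= 1.
  rewrite /D ler_norml; have := mulr_ge0 c1 c2;
    have : cut N p * cut N q <= 1 by rewrite mulr_ile1.
  by move=> a b; apply/andP; split; lra.
have m0 : 0 <= Num.min q r by rewrite le_min q0.
have mq : Num.min q r <= q by rewrite ge_min lexx.
have or3 s : p <= s -> q <= s -> N / 2 < s -> omega N r <= 16 * s ^+ 3.
  move=> ps qs Ns; have -> : 16 * s ^+ 3 = (2 * s) ^+ 2 * (4 * s) by ring.
  apply: ler_pM; [exact: sqr_ge0|exact: addr_ge0| |lra].
  by rewrite lerXn2r// ?nnegrE; lra.
have lowhigh : p <= q -> N / 2 < q -> omega N r * (Num.min q r * D) <= 64 * (p * q ^+ 3).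
  move=> pq Nq.
  have md : Num.min q r * D <= 4 * p.
    have [m2|m2] := leP (2 * N) (Num.min q r).
      have q2 : 2 * N <= q by apply: le_trans m2 _; rewrite ge_min lexx.
      have r2 : 2 * N <= r by apply: le_trans m2 _; rewrite ge_min lexx orbT.
      by rewrite /D (cut_out N0 q2) (cut_out N0 r2) mulr0 subrr normr0 mulr0 mulr_ge0.
    have D2 : D <= 2 * p / N.
      have -> : D = `|(cut N q - cut N r) - cut N q * (1 - cut N p)| by rewrite /D;
        congr `|_|; ring.
      apply: le_trans (ler_normB _ _) _.
      have e1 := cut_lip q r N0; have e2 := cut_near1 N0 p0.
      have e3 : `|cut N q * (1 - cut N p)| <= p / N.
        by rewrite ger0_norm ?mulr_ge0 ?subr_ge0//; apply: le_trans e2;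
          rewrite ler_piMl// subr_ge0.
      have e4 : `|q - r| / N <= p / N by rewrite ler_pM2r ?invr_gt0// distrC.
      lra.
    have -> : 4 * p = (2 * N) * (2 * p / N) by field; rewrite gt_eqF.
    by apply: ler_pM => //; exact: ltW.
  have -> : 64 * (p * q ^+ 3) = 16 * q ^+ 3 * (4 * p) by ring.
  by apply: ler_pM md => //; [exact: mulr_ge0|exact: or3].
have highlow : q <= p -> N / 2 < p -> omega N r * (Num.min q r * D) <= 64 * (p ^+ 3 * q).
  move=> qp Np.
  have md : Num.min q r * D <= q by apply: le_trans mq; rewrite ler_piMr.
  apply: (@le_trans _ _ (16 * p ^+ 3 * q)).
    by apply: ler_pM md => //; [exact: mulr_ge0|exact: or3].
  by rewrite mulrA ler_wpM2r// ler_wpM2r ?exprn_ge0// ler_nat.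
have pq0 : 0 <= p * q ^+ 3 by rewrite mulr_ge0 ?exprn_ge0.
have qp0 : 0 <= p ^+ 3 * q by rewrite mulr_ge0 ?exprn_ge0.
rewrite -mulrA.
have [pN|Np] := leP p (N / 2); have [qN|Nq] := leP q (N / 2).
- suff -> : D = 0 by rewrite !mulr0 !mul0r addr0 mulr0.
  by rewrite /D !cut_in//; rewrite ?mul1r ?subrr ?normr0//; lra.
- by rewrite mul0r add0r; apply: lowhigh => //; lra.
- by rewrite mulr0 addr0; apply: highlow => //; lra.
- rewrite mulrDr; have [pq|/ltW qp] := leP p q.
    by apply: le_trans (lowhigh pq Nq) _; rewrite lerDr mulr_ge0.
  by apply: le_trans (highlow qp Np) _; rewrite lerDl mulr_ge0.
Qed.

Lemma cut_viscous N r : 0 < N -> 0 <= r -> omega N r * r ^+ 2 * cut N r <= 12 * N ^+ 3 * r ^+ 2.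
Proof.
move=> N0 r0; have N0' := ltW N0.
have [rN|/ltW Nr] := leP r (2 * N); last first.
  by rewrite (cut_out N0 Nr) mulr0 !mulr_ge0 ?exprn_ge0.
have : omega N r <= 12 * N ^+ 3.
  have -> : 12 * N ^+ 3 = (2 * N) ^+ 2 * (3 * N) by ring.
  apply: ler_pM; [exact: sqr_ge0|exact: addr_ge0| |lra].
  by rewrite lerXn2r// nnegrE mulr_ge0.
move=> h; apply: (@le_trans _ _ (omega N r * r ^+ 2)); last by rewrite ler_wpM2r ?sqr_ge0.
by rewrite ler_piMr ?cut_le1// mulr_ge0 ?omega_ge0 ?sqr_ge0.
Qed.

(** A crude bound with constants depending on [N], sufficient for the pairs of
    frequencies with one member outside the finite set of retained modes. *)
Lemma remainder_symbol N p q r : 0 <= N -> 0 <= p -> 0 <= q -> r <= p + q -> 1 <= r ->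
  omega N r ^+ 2 * q <= 4 * (1 + N) ^+ 2 * ((p ^+ 3 * q + q ^+ 4) * r ^+ 3).
Proof.
move=> N0 p0 q0 rpq r1; have r0 : 0 <= r by lra.
have or := omega_ge0 N0 r0; have oc := omega_cube N0 r1.
have r3 : r ^+ 3 <= 4 * (p ^+ 3 + q ^+ 3).
  apply: (@le_trans _ _ ((p + q) ^+ 3)); first by rewrite lerXn2r// nnegrE addr_ge0.
  have := mulr_ge0 (addr_ge0 p0 q0) (sqr_ge0 (p - q)); lra.
have r30 : 0 <= r ^+ 3 by exact: exprn_ge0.
have h : omega N r ^+ 2 <= ((1 + N) * r ^+ 3) ^+ 2.
  by rewrite lerXn2r// nnegrE mulr_ge0//; lra.
have := ler_wpM2r q0 h => /le_trans; apply.
have c0 := mulr_ge0 (mulr_ge0 (sqr_ge0 (1 + N)) r30) q0.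
have := ler_wpM2l c0 r3; lra.
Qed.
End Symbols.

(** * The terms of the energy identity *)

Section EnergyTerms.
Variable R : realType.
Local Notation K := ('rV[int]_3).
Local Notation V3 := ('rV[R[i]]_3).
Implicit Types (k l m : K) (u v w : coeffs R 3) (A B : {fset K}).

Definition divfree u := forall k, \sum_j (k 0 j)%:~R * u k 0 j = 0.

(** The gradient of a scalar multiplies its m-th coefficient by this vector. *)
Definition wave m : V3 := \row_j (0 +i* (m 0 j)%:~R)%C.

Definition hdot (z y : V3) : R[i] := \sum_j (z 0 j)^*%C * y 0 j.

Lemma hdotDr z y1 y2 : hdot z (y1 + y2) = hdot z y1 + hdot z y2.
Proof. by rewrite /hdot -big_split/=; apply: eq_bigr => j _; rewrite mxE mulrDr. Qed.
Lemma hdotZr z (c : R[i]) y : hdot z (c *: y) = c * hdot z y.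
Proof. by rewrite /hdot mulr_sumr; apply: eq_bigr => j _; rewrite mxE mulrCA. Qed.
Lemma hdotNr z y : hdot z (- y) = - hdot z y.
Proof. by rewrite -scaleN1r hdotZr mulN1r. Qed.
Lemma hdot_sumr z (I : Type) (s : seq I) (F : I -> V3) :
  hdot z (\sum_(i <- s) F i) = \sum_(i <- s) hdot z (F i).
Proof.
elim: s => [|i s IH]; last by rewrite !big_cons hdotDr IH.
by rewrite !big_nil /hdot big1// => j _; rewrite mxE mulr0.
Qed.
Lemma hdot_conj z y : (hdot z y)^*%C = hdot y z.
Proof.
rewrite /hdot rmorph_sum; apply: eq_bigr => j _.
by rewrite rmorphM/= conjcK mulrC.
Qed.
Lemma hdot_cnorm z y : cnorm (hdot z y) <= vnorm z * vnorm y.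
Proof.
pose z' : V3 := \row_j (z 0 j)^*%C.
have -> : hdot z y = \sum_j z' 0 j * y 0 j by apply: eq_bigr => j _; rewrite mxE.
apply: le_trans (vnorm_dot _ _) _; rewrite ler_wpM2r ?vnorm_ge0//.
by rewrite /vnorm /sqnorm; under eq_bigr do rewrite mxE cnorm_conj.
Qed.
Lemma hdot_self z : hdot z z = (vnorm z ^+ 2)%:C%C.
Proof.
rewrite vnorm_sqr /hdot /sqnorm rmorph_sum; apply: eq_bigr => j _.
rewrite cnorm_sqr; case: (z 0 j) => a b; apply/eqP; rewrite eq_complex/=.
by apply/andP; split; apply/eqP; ring.
Qed.
Lemma hdot_err (z y : V3) (e : R) : (forall j, cnorm (y 0 j) <= e) ->
  cnorm (hdot z y) <= 3 * vnorm z * e.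
Proof.
move=> ye; apply: le_trans (cnorm_sum _ _ _) _.
apply: (@le_trans _ _ (\sum_(j < 3) vnorm z * e)).
  apply: ler_sum => j _; rewrite cnormM cnorm_conj.
  by apply: ler_pM; rewrite ?cnorm_ge0 ?coord_vnorm.
by rewrite sumr_const card_ord -[leLHS]mulr_natl mulrA.
Qed.

Lemma imE (n : int) : (0 +i* (n%:~R : R))%C = 'i%C * n%:~R.
Proof.
have -> : (n%:~R : R[i]) = ((n%:~R : R)%:C)%C by rewrite -(rmorph_int (real_complex R)).
by apply/eqP; rewrite eq_complex/= !mul0r !mul1r subr0 add0r !eqxx.
Qed.

Lemma waveE m (z : V3) : \sum_j z 0 j * wave m 0 j = 'i%C * \sum_j (m 0 j)%:~R * z 0 j.
Proof.
by rewrite mulr_sumr; apply: eq_bigr => j _; rewrite mxE imE mulrC mulrA.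
Qed.

(** This is what removes the pressure from the energy identity. *)
Lemma hdot_wave u m : divfree u -> hdot (u m) (wave m) = 0.
Proof.
move=> ud; rewrite -[LHS]conjcK hdot_conj /hdot.
have -> : \sum_j (wave m 0 j)^*%C * u m 0 j = - \sum_j u m 0 j * wave m 0 j.
  rewrite -sumrN; apply: eq_bigr => j _; rewrite mxE mulrC -mulrN; congr (_ * _).
  by apply/eqP; rewrite eq_complex/= oppr0 !eqxx.
by rewrite waveE ud mulr0 oppr0 conjc0.
Qed.

Lemma advE u m l : adv u m l = 'i%C * \sum_j (l 0 j)%:~R * u (m - l) 0 j.
Proof. by rewrite -waveE; apply: eq_bigr => j _; rewrite mxE. Qed.

(** Incompressibility moves the derivative from the transported factor, of
    frequency [l], to the product, of frequency [m]: the difference pairs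
    [u (m - l)] with its own frequency. *)
Lemma adv_div u m l : divfree u ->
  adv u m l = 'i%C * \sum_j (m 0 j)%:~R * u (m - l) 0 j.
Proof.
move=> ud; rewrite advE; congr (_ * _).
apply/eqP; rewrite -subr_eq0 -sumrB.
rewrite -[eqbRHS](oppr0) -[in eqbRHS](ud (m - l)) -sumrN; apply/eqP.
by apply: eq_bigr => j _; rewrite !mxE rmorphB/=; ring.
Qed.

Lemma cnorm_i : cnorm ('i%C : R[i]) = 1.
Proof. by rewrite /= expr0n/= add0r expr1n sqrtr1. Qed.

Lemma adv_cnorm u m l : cnorm (adv u m l) <= len R l * vnorm (u (m - l)).
Proof. by rewrite advE cnormM cnorm_i mul1r vnorm_wave. Qed.

Lemma adv_min u m l : divfree u ->
  cnorm (adv u m l) <= Num.min (len R l) (len R m) * vnorm (u (m - l)).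
Proof.
move=> ud; case: (leP (len R l) (len R m)) => _; first exact: adv_cnorm.
by rewrite adv_div// cnormM cnorm_i mul1r vnorm_wave.
Qed.

(** The Fourier form of the fact that v.grad is antisymmetric for div v = 0. *)
Lemma adv_antisym v m l : real_coeffs v -> divfree v ->
  adv v l m = - (adv v m l)^*%C.
Proof.
move=> vr vd; rewrite adv_div// advE rmorphM rmorph_sum -mulNr.
have -> : - ('i%C : R[i])^*%C = 'i%C.
  by apply/eqP; rewrite eq_complex/= oppr0 opprK !eqxx.
congr (_ * _); apply: eq_bigr => j _.
by rewrite -opprB vr rmorphM rmorph_int.
Qed.

Lemma vnorm_even v k : real_coeffs v -> vnorm (v (- k)) = vnorm (v k).
Proof.
move=> vr; rewrite /vnorm /sqnorm; congr Num.sqrt; apply: eq_bigr => j _.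
by rewrite vr cnorm_conj.
Qed.

Variable N : R.
Hypothesis N1 : 1 <= N.
Let N0 : 0 < N. Proof. exact: lt_le_trans ltr01 N1. Qed.
Let N0' : 0 <= N. Proof. exact: ltW. Qed.

Local Notation om k := (omega N (len R k)).
Local Notation cu k := (cut N (len R k)).

Lemma om_ge0 k : 0 <= om k. Proof. by rewrite omega_ge0// len_ge0. Qed.

Lemma l1le_omega w Y : w 0 = 0 -> l2le (fun k => om k * vnorm (w k)) Y ->
  l1le (fun k => (len R k + N) * vnorm (w k)) (100 * Y).
Proof.
move=> w0 wY; apply: l1_of_l2; first by rewrite w0 vnorm0 mulr0.
by apply: le_l2le wY => // k; rewrite mulrA lexx mulr_ge0 ?om_ge0 ?vnorm_ge0.
Qed.

Lemma l1le_grad v X : v 0 = 0 -> l2le (fun k => len R k ^+ 3 * vnorm (v k)) X ->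
  l1le (fun k => len R k * vnorm (v k)) (100 * X).
Proof. by move=> v0 /(l1le_vnorm (r := 1) v0); apply: le_l1le. Qed.

(** Adding the double sum to its transpose replaces [om m ^+ 2] by the commutator
    [om m ^+ 2 - om l ^+ 2], bounded by [commutator_symbol].  Both Young
    inequalities then apply, with one factor in an l^1 norm dominated through
    two additional derivatives. *)
Lemma transport_antisym v w A (X Y : R) : real_coeffs v -> divfree v -> v 0 = 0 -> w 0 = 0 ->
  l2le (fun k => len R k ^+ 3 * vnorm (v k)) X ->
  l2le (fun k => om k * vnorm (w k)) Y ->
  `|\sum_(m <- A) om m ^+ 2 * \sum_(l <- A) complex.Re (adv v m l * hdot (w m) (w l))|
    <= 3200 * X * Y ^+ 2.
Proof.
move=> vr vd v0 w0 vX wY.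
pose G m l := complex.Re (adv v m l * hdot (w m) (w l)).
have Ganti m l : G l m = - G m l.
  by rewrite /G adv_antisym// -hdot_conj mulNr -rmorphM ReN Reconj.
pose S := \sum_(m <- A) \sum_(l <- A) om m ^+ 2 * G m l.
have -> : \sum_(m <- A) om m ^+ 2 * \sum_(l <- A) complex.Re (adv v m l * hdot (w m) (w l)) = S.
  by apply: eq_bigr => m _; rewrite mulr_sumr.
have S2 : S + S = \sum_(m <- A) \sum_(l <- A) (om m ^+ 2 - om l ^+ 2) * G m l.
  rewrite {2}/S exchange_big/= /S -big_split/=; apply: eq_bigr => m _.
  rewrite -big_split/=; apply: eq_bigr => l _.
  by rewrite (Ganti m l); ring.
pose F m l := len R (m - l) ^+ 3 * vnorm (v (m - l)) * ((len R l + N) * vnorm (w l)) * (om m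
  * vnorm (w m))
  + len R (m - l) * vnorm (v (m - l)) * (om l * vnorm (w l)) * (om m * vnorm (w m)).
have Fbound : \sum_(m <- A) \sum_(l <- A) F m l <= 200 * X * Y ^+ 2.
  rewrite /F; under eq_bigr do rewrite big_split/=.
  rewrite big_split/=.
  have f1 := @young212 R K (fun k => len R k ^+ 3 * vnorm (v k))
     (fun k => (len R k + N) * vnorm (w k)) (fun k => om k * vnorm (w k)) X (100 * Y) Y A A.
  have f2 := @young122 R K (fun k => len R k * vnorm (v k))
     (fun k => om k * vnorm (w k)) (fun k => om k * vnorm (w k)) (100 * X) Y Y A A.
  have := f1 _ _ _ vX (l1le_omega w0 wY) wY; have := f2 _ _ _ (l1le_grad v0 vX) wY wY.
  move=> h1 h2.
  have -> : 200 * X * Y ^+ 2 = X * (100 * Y) * Y + 100 * X * Y * Y by ring.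
  apply: lerD; [apply: h2|apply: h1] => k;
  by rewrite mulr_ge0 ?vnorm_ge0 ?om_ge0 ?exprn_ge0 ?addr_ge0 ?len_ge0.
have bnd : `|S + S| <= \sum_(m <- A) \sum_(l <- A) 16 * (F m l + F l m).
  rewrite S2; apply: le_trans (ler_norm_sum _ _ _) _; apply: ler_sum => m _.
  apply: le_trans (ler_norm_sum _ _ _) _; apply: ler_sum => l _.
  rewrite normrM.
  have g1 : `|G m l| <= Num.min (len R l) (len R m) * (vnorm (v (m - l)) * (vnorm (w m) *
    vnorm (w l))).
    apply: le_trans (cnorm_Re _) _; rewrite cnormM [leRHS]mulrA.
    by apply: ler_pM; [exact: cnorm_ge0|exact: cnorm_ge0|exact: adv_min|exact: hdot_cnorm].
  apply: le_trans (ler_wpM2l (normr_ge0 _) g1) _; rewrite [leLHS]mulrA.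
  have nn : 0 <= vnorm (v (m - l)) * (vnorm (w m) * vnorm (w l)).
    by rewrite !mulr_ge0 ?vnorm_ge0.
  have := commutator_symbol N0' (len_ge0 R (m - l)) (len_ge0 R l) (len_ge0 R m) (lenB_dist R
    m l).
  move=> /(ler_wpM2r nn)/le_trans; apply.
  rewrite le_eqVlt; apply/orP; left; apply/eqP.
  have e1 : vnorm (v (l - m)) = vnorm (v (m - l)) by rewrite -opprB vnorm_even.
  have e2 : len R (l - m) = len R (m - l) by rewrite -opprB lenN.
  rewrite /F e1 e2; move: (om m) (om l) => a b; ring.
have tot : \sum_(m <- A) \sum_(l <- A) 16 * (F m l + F l m) =
   32 * \sum_(m <- A) \sum_(l <- A) F m l.
  under eq_bigr do rewrite -mulr_sumr big_split/=.
  rewrite -mulr_sumr big_split/= [X in _ + X]exchange_big/=; ring.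
move: bnd; rewrite tot; have -> : S + S = 2 * S by ring.
rewrite normrM ger0_norm//; lra.
Qed.

(** The indices [l] outside [A] have no transposed partner.  Replacing [w] there
    by [w'], which vanishes on [A], turns the H^4 tail of [w] into a norm that
    can enter the Young inequalities. *)
Lemma transport_tail v w A B (X W kap : R) : v 0 = 0 -> w 0 = 0 ->
  l2le (fun k => len R k ^+ 3 * vnorm (v k)) X ->
  l2le (fun k => len R k ^+ 4 * vnorm (w k)) W ->
  0 <= kap -> (forall D, [disjoint A & D]%fset ->
     \sum_(k <- D) (len R k ^+ 4 * vnorm (w k)) ^+ 2 <= kap ^+ 2) ->
  \sum_(m <- A) om m ^+ 2 * \sum_(l <- (B `\` A)%fset)
     len R l * vnorm (v (m - l)) * (vnorm (w m) * vnorm (w l))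
    <= 800 * (1 + N) ^+ 2 * X * W * kap.
Proof.
move=> v0 w0 vX wW k0 tl.
pose w' : coeffs R 3 := fun k => if k \in A then 0 else w k.
have w'0 : w' 0 = 0 by rewrite /w'; case: ifP.
have w'k : l2le (fun k => len R k ^+ 4 * vnorm (w' k)) kap.
  split=> // D; rewrite (fset_sum_split A) big1_fset ?add0r.
    apply: le_trans (tl (D `\` A)%fset _); last first.
      by apply/fdisjointP => k kA; rewrite inE kA.
    apply: ler_sum => k _; rewrite lerXn2r ?nnegrE ?mulr_ge0 ?exprn_ge0 ?len_ge0 ?vnorm_ge0//.
    rewrite ler_wpM2l ?exprn_ge0 ?len_ge0// /w'; case: ifP => // _; rewrite vnorm0 vnorm_ge0//.
  move=> k; rewrite inE => /andP[_ kA] _.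
  by rewrite /w' kA vnorm0 mulr0 expr0n.
have w3 := l2le_weight (isT : (3 <= 4)%N) w0 wW.
have w'3 := l2le_weight (isT : (3 <= 4)%N) w'0 w'k.
have v2 := l2le_weight (isT : (2 <= 3)%N) v0 vX.
have v1 : l1le (fun k => vnorm (v k)) (100 * X).
  by have := l1le_vnorm (r := 0) v0 v2; apply: le_l1le => // k; rewrite mul1r.
have y1 := @young212 R K (fun k => len R k ^+ 3 * vnorm (v k))
   (fun k => len R k * vnorm (w' k)) (fun k =>
     len R k ^+ 3 * vnorm (w k)) X (100 * kap) W A (B `\` A)%fset.
have y2 := @young122 R K (fun k => vnorm (v k))
   (fun k => len R k ^+ 4 * vnorm (w' k)) (fun k =>
     len R k ^+ 3 * vnorm (w k)) (100 * X) kap W A (B `\` A)%fset.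
have n3 (z : coeffs R 3) a k : 0 <= len R k ^+ a * vnorm (z k).
  by rewrite mulr_ge0 ?exprn_ge0 ?len_ge0 ?vnorm_ge0.
have {}y1 := y1 (n3 _ 3) (n3 _ 1) (n3 _ 3) vX (l1le_grad w'0 w'3) w3.
have {}y2 := y2 (fun k => vnorm_ge0 _) (n3 _ 4) (n3 _ 3) v1 w'k w3.
set S1 := \sum_(m <- A) _ in y1; set S2 := \sum_(m <- A) _ in y2.
apply: (@le_trans _ _ (4 * (1 + N) ^+ 2 * (S1 + S2))); last first.
  have c0 : 0 <= 4 * (1 + N) ^+ 2 by rewrite mulr_ge0 ?sqr_ge0.
  have := ler_wpM2l c0 (lerD y1 y2); lra.
rewrite /S1 /S2 -big_split/= mulr_sumr; apply: ler_sum => m _.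
rewrite -big_split/= !mulr_sumr !big_seq; apply: ler_sum => l.
rewrite inE => /andP[lA _]; rewrite /w' (negbTE lA).
have [m0|m0] := eqVneq m 0.
  by rewrite m0 w0 vnorm0; lra.
have nn : 0 <= vnorm (v (m - l)) * (vnorm (w m) * vnorm (w l)).
  by rewrite !mulr_ge0 ?vnorm_ge0.
have := remainder_symbol N0' (len_ge0 R (m - l)) (len_ge0 R l) (lenB_le R m l) (len_ge1 R m0).
move=> /(ler_wpM2r nn); move: (om m) => a h; apply: (le_trans _ (le_trans h _));
  rewrite le_eqVlt; apply/orP; left; apply/eqP; ring.
Qed.

(** The bound is uniform in [N]: the two terms of [transport_symbol] pair an
    [omega] norm of [w], or an l^1 norm with weight [|k| + N], with the H^3 norm
    of [u]. *)
Lemma transport_trunc w u A B (M Y : R) : u 0 = 0 -> w 0 = 0 ->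
  l2le (fun k => len R k ^+ 3 * vnorm (u k)) M ->
  l2le (fun k => om k * vnorm (w k)) Y ->
  \sum_(m <- A) om m ^+ 2 * \sum_(l <- B)
     len R l * vnorm (w (m - l)) * (cu l * (vnorm (w m) * vnorm (u l)))
    <= 3200 * M * Y ^+ 2.
Proof.
move=> u0 w0 uM wY.
have n3 (z : coeffs R 3) a k : 0 <= len R k ^+ a * vnorm (z k).
  by rewrite mulr_ge0 ?exprn_ge0 ?len_ge0 ?vnorm_ge0.
have no k : 0 <= om k * vnorm (w k) by rewrite mulr_ge0 ?om_ge0 ?vnorm_ge0.
have nl k : 0 <= (len R k + N) * vnorm (w k).
  by rewrite mulr_ge0 ?addr_ge0 ?len_ge0 ?vnorm_ge0.
have y1 := young212 A B no (n3 u 1) no wY (l1le_grad u0 uM) wY.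
have y2 := young122 A B nl (n3 u 3) no (l1le_omega w0 wY) uM wY.
move: y1 y2; set S1 := \sum_(m <- A) _; set S2 := \sum_(m <- A) _ => y1 y2.
apply: (@le_trans _ _ (8 * S1 + 24 * S2)); last lra.
rewrite /S1 /S2 !mulr_sumr -big_split/=; apply: ler_sum => m _.
rewrite !mulr_sumr -big_split/=; apply: ler_sum => l _.
have nn : 0 <= vnorm (w (m - l)) * (vnorm (w m) * vnorm (u l)) * om m.
  exact: mulr_ge0 (mulr_ge0 (vnorm_ge0 _) (mulr_ge0 (vnorm_ge0 _) (vnorm_ge0 _))) (om_ge0 _).
have := transport_symbol N0 (len_ge0 R (m - l)) (len_ge0 R l) (len_ge0 R m) (lenB_le R m l).
move=> /(ler_wpM2r nn); move: (om m) (om (m - l)) (cu l) => a b c h.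
apply: (le_trans _ (le_trans h _)); rewrite le_eqVlt; apply/orP; left; apply/eqP; ring.
Qed.

(** The coefficients that [truncate N] may alter are those above [N]; the
    threshold [N / 2] is imposed by the products, whose frequency [l + (m - l)]
    can exceed [N] only if one of the two factors exceeds [N / 2]. *)
Definition hitail u k : R := if N / 2 < len R k then len R k ^+ 3 * vnorm (u k) else 0.

(** A Friedrichs commutator estimate.  By [truncation_symbol] one of the two
    copies of [u] is always of high frequency, which puts [tau] in the bound. *)
Lemma truncation_error w u A B (M Y tau : R) : u 0 = 0 ->
  l2le (fun k => len R k ^+ 3 * vnorm (u k)) M ->
  l2le (hitail u) tau ->
  l2le (fun k => om k * vnorm (w k)) Y ->
  \sum_(m <- A) om m ^+ 2 * \sum_(l <- B)
     `|cu (m - l) * cu l - cu m| * (Num.min (len R l) (len R m) * vnorm (u (m - l))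
        * (vnorm (w m) * vnorm (u l)))
    <= 128 * 100 * M * tau * Y.
Proof.
move=> u0 uM ut wY.
have n3 (z : coeffs R 3) a k : 0 <= len R k ^+ a * vnorm (z k).
  by rewrite mulr_ge0 ?exprn_ge0 ?len_ge0 ?vnorm_ge0.
have no k : 0 <= om k * vnorm (w k) by rewrite mulr_ge0 ?om_ge0 ?vnorm_ge0.
have nh k : 0 <= hitail u k by rewrite /hitail; case: ifP.
have y1 := young212 A B nh (n3 u 1) no ut (l1le_grad u0 uM) wY.
have y2 := young122 A B (n3 u 1) nh no (l1le_grad u0 uM) ut wY.
move: y1 y2; set S1 := \sum_(m <- A) _; set S2 := \sum_(m <- A) _ => y1 y2.
apply: (@le_trans _ _ (64 * S1 + 64 * S2)); last lra.
rewrite /S1 /S2 !mulr_sumr -big_split/=; apply: ler_sum => m _.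
rewrite !mulr_sumr -big_split/=; apply: ler_sum => l _.
have nn : 0 <= vnorm (u (m - l)) * (vnorm (w m) * vnorm (u l)) * om m.
  exact: mulr_ge0 (mulr_ge0 (vnorm_ge0 _) (mulr_ge0 (vnorm_ge0 _) (vnorm_ge0 _))) (om_ge0 _).
have := truncation_symbol N0 (len_ge0 R (m - l)) (len_ge0 R l) (len_ge0 R m) (lenB_le R m l)
  (lenB_dist R m l).
move=> /(ler_wpM2r nn) h.
have e1 : hitail u (m - l) = (if N / 2 < len R (m - l) then len R (m - l) ^+ 3 else 0) *
  vnorm (u (m - l)).
  by rewrite /hitail; case: ifP => _; rewrite ?mul0r.
have e2 : hitail u l = (if N / 2 < len R l then len R l ^+ 3 else 0) * vnorm (u l).
  by rewrite /hitail; case: ifP => _; rewrite ?mul0r.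
rewrite e1 e2; move: h; move: (om m) (`|_|) (if _ then _ else 0) (if _ then _ else 0)
  (Num.min _ _) => a b c d e h.
apply: (le_trans _ (le_trans h _)); rewrite le_eqVlt; apply/orP; left; apply/eqP; ring.
Qed.

Lemma viscous_error w u A (M Y : R) :
  l2le (fun k => len R k ^+ 2 * vnorm (u k)) M ->
  l2le (fun k => om k * vnorm (w k)) Y ->
  \sum_(m <- A) om m ^+ 2 * (len R m ^+ 2 * cu m * (vnorm (w m) * vnorm (u m)))
    <= 12 * N ^+ 3 * M * Y.
Proof.
move=> uM wY; have := l2le_mul uM wY A => h.
apply: (@le_trans _ _ (12 * N ^+ 3 * \sum_(k <- A) len R k ^+ 2 * vnorm (u k) * (om k * vnorm
  (w k)))).
  rewrite mulr_sumr; apply: ler_sum => m _.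
  have nn : 0 <= vnorm (w m) * vnorm (u m) * om m.
    exact: mulr_ge0 (mulr_ge0 (vnorm_ge0 _) (vnorm_ge0 _)) (om_ge0 _).
  have := ler_wpM2r nn (cut_viscous N0 (len_ge0 R m)).
  move: (om m) (cu m) => a b h'.
  apply: (le_trans _ (le_trans h' _)); rewrite le_eqVlt; apply/orP; left; apply/eqP; ring.
rewrite -[leRHS]mulrA ler_wpM2l// mulr_ge0 ?exprn_ge0//.
Qed.
End EnergyTerms.

(** * Growth rate of the energy *)

Section EnergyRate.
Variable R : realType.
Local Notation K := ('rV[int]_3).
Local Notation V3 := ('rV[R[i]]_3).
Implicit Types (k l m : K) (u v w du dv : coeffs R 3) (A B : {fset K}) (p : K -> R[i]).

(** The left-hand side of the Voigt equation for the mode [m], with convolution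
    restricted to [B], coefficients [a2 = alpha^2] and [nu], and pressure
    coefficients [p]; Euler is the case [a2 = nu = 0]. *)
Definition residual (a2 nu : R) v dv p m B : V3 :=
  (1 + a2 * len R m ^+ 2)%:C%C *: dv m + (nu * len R m ^+ 2)%:C%C *: v m
  + p m *: wave R m + \sum_(l <- B) adv v m l *: v l.

(** The convolution is an infinite series; that the equation holds is expressed
    by the residuals over large finite sets being small. *)
Definition solves_modes (a2 nu : R) v dv p : Prop :=
  forall m (e : R), 0 < e -> exists B0 : {fset K}, forall B, (B0 `<=` B)%fset ->
    forall j, cnorm (residual a2 nu v dv p m B 0 j) <= e.

Definition truncate (N : R) u : coeffs R 3 := fun k => (cut N (len R k))%:C%C *: u k.

Variables (N : R) (N1 : 1 <= N).
Let N0 : 0 < N. Proof. exact: lt_le_trans ltr01 N1. Qed.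
Let N0' : 0 <= N. Proof. exact: ltW. Qed.
Local Notation om k := (omega N (len R k)).
Local Notation cu k := (cut N (len R k)).

Variables (v dv u du : coeffs R 3) (pv pu : K -> R[i]) (a2 nu : R).
Let w : coeffs R 3 := fun k => v k - truncate N u k.
Let dw : coeffs R 3 := fun k => dv k - truncate N du k.

(* v.grad w + w.grad a + (a.grad a - cut_N (u.grad u)), restricted to B *)
Let X m B : V3 := \sum_(l <- B) (adv v m l *: w l + (adv w m l * (cu l)%:C%C) *: u l
   + ((cu (m - l) * cu l - cu m)%:C%C * adv u m l) *: u l).

Lemma adv_split m l : adv v m l = adv w m l + (cu (m - l))%:C%C * adv u m l.
Proof.
rewrite /adv mulr_sumr -big_split/=; apply: eq_bigr => j _.
by rewrite /w /truncate !mxE; ring.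
Qed.

(** Subtracting from the Voigt equation the truncation of the Euler equation.
    The Voigt and viscous terms of [w] appear on the left and with a sign, those
    of the truncated Euler solution as forcing terms. *)
Lemma difference_equation m B : (1 + a2 * len R m ^+ 2)%:C%C *: dw m =
  residual a2 nu v dv pv m B - (cu m)%:C%C *: residual 0 0 u du pu m B
  - (nu * len R m ^+ 2)%:C%C *: w m
  - (nu * len R m ^+ 2 * cu m)%:C%C *: u m
  - (a2 * len R m ^+ 2 * cu m)%:C%C *: du m
  - (pv m - (cu m)%:C%C * pu m) *: wave R m - X m B.
Proof.
have XE : X m B = \sum_(l <- B) adv v m l *: v l - (cu m)%:C%C *: \sum_(l <- B) adv u m l *:
  u l.
  rewrite /X scaler_sumr -sumrB; apply: eq_bigr => l _.
  rewrite [adv v m l]adv_split; apply/rowP => j.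
  by rewrite /w /truncate !mxE !rmorphB/= !rmorphM/=; ring.
rewrite XE /residual; move: (\sum_(l <- B) _) (\sum_(l <- B) _) => S1 S2.
have -> : (1 + a2 * len R m ^+ 2)%:C%C = 1 + a2%:C%C * (len R m ^+ 2)%:C%C.
  by rewrite rmorphD rmorphM rmorph1.
have -> : (1 + 0 * len R m ^+ 2)%:C%C = 1 :> R[i] by rewrite mul0r addr0 rmorph1.
have -> : (0 * len R m ^+ 2)%:C%C = 0 :> R[i] by rewrite mul0r.
rewrite !(rmorphM (real_complex R))/= /dw /w /truncate.
move: (a2%:C)%C (nu%:C)%C ((len R m ^+ 2)%:C)%C ((cu m)%:C)%C => a n r c.
move: (v m) (dv m) (u m) (du m) (wave R m) (pv m) (pu m) => v' dv' u' du' w' pv' pu'.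
apply/rowP => j; rewrite !mxE; ring.
Qed.

Lemma hdot_residual (z r1 r2 y1 y2 x wv : V3) (a b c d : R) (q : R[i]) :
  hdot z wv = 0 ->
  complex.Re (hdot z (r1 - c%:C%C *: r2 - a%:C%C *: z - b%:C%C *: y1
     - d%:C%C *: y2 - q *: wv - x)) =
  complex.Re (hdot z r1) - c * complex.Re (hdot z r2) - a * vnorm z ^+ 2
  - b * complex.Re (hdot z y1) - d * complex.Re (hdot z y2) - complex.Re (hdot z x).
Proof.
by move=> wv0; rewrite !hdotDr !hdotNr !hdotZr wv0 mulr0 hdot_self !ReD !ReN !RemulC /= oppr0
  addr0.
Qed.

Hypotheses (vr : real_coeffs v) (vd : divfree v) (ud : divfree u)
  (v0 : v 0 = 0) (u0 : u 0 = 0).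
Hypotheses (nu0 : 0 <= nu) (a20 : 0 <= a2).
Hypothesis (vmodes : solves_modes a2 nu v dv pv).
Hypothesis (umodes : solves_modes 0 0 u du pu).
Variables (X3 W M M' tau Y kap : R) (A : {fset K}).
Hypotheses (vX : l2le (fun k => len R k ^+ 3 * vnorm (v k)) X3)
  (wW : l2le (fun k => len R k ^+ 4 * vnorm (w k)) W)
  (uM : l2le (fun k => len R k ^+ 3 * vnorm (u k)) M)
  (duM : l2le (fun k => len R k ^+ 2 * vnorm (du k)) M')
  (utau : l2le (hitail N u) tau)
  (wY : l2le (fun k => om k * vnorm (w k)) Y)
  (kap0 : 0 <= kap)
  (tailA : forall D, [disjoint A & D]%fset ->
     \sum_(k <- D) (len R k ^+ 4 * vnorm (w k)) ^+ 2 <= kap ^+ 2).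

Let w0 : w 0 = 0.
Proof. by rewrite /w /truncate v0 u0 scaler0 subr0. Qed.

Let wd : divfree w.
Proof.
move=> k; rewrite /w /truncate.
have -> : \sum_j (k 0 j)%:~R * (v k - (cu k)%:C%C *: u k) 0 j =
  \sum_j (k 0 j)%:~R * v k 0 j - (cu k)%:C%C * \sum_j (k 0 j)%:~R * u k 0 j.
  by rewrite mulr_sumr -sumrB; apply: eq_bigr => j _; rewrite !mxE; ring.
by rewrite vd ud mulr0 subr0.
Qed.

(** Pairing with [w m] kills the pressures, gives the dissipation its sign, and
    splits the convolution over [B] into the part over [A], kept exactly because
    antisymmetry will be applied to it, and the part outside, bounded in
    absolute value. *)
Lemma energy_rate_mode m B (e : R) : (A `<=` B)%fset ->
  (forall j, cnorm (residual a2 nu v dv pv m B 0 j) <= e) ->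
  (forall j, cnorm (residual 0 0 u du pu m B 0 j) <= e) ->
  om m ^+ 2 * complex.Re (hdot (w m) ((1 + a2 * len R m ^+ 2)%:C%C *: dw m)) <=
  - (om m ^+ 2 * \sum_(l <- A) complex.Re (adv v m l * hdot (w m) (w l)))
  + om m ^+ 2 * \sum_(l <- (B `\` A)%fset) len R l * vnorm (v (m - l)) * (vnorm (w m) * vnorm
    (w l))
  + om m ^+ 2 * \sum_(l <- B) len R l * vnorm (w (m - l)) * (cu l * (vnorm (w m) * vnorm (u l)))
  + om m ^+ 2 * \sum_(l <- B)
     `|cu (m - l) * cu l - cu m| * (Num.min (len R l) (len R m) * vnorm (u (m - l))
        * (vnorm (w m) * vnorm (u l)))
  + nu * (om m ^+ 2 * (len R m ^+ 2 * cu m * (vnorm (w m) * vnorm (u m))))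
  + a2 * (om m ^+ 2 * (len R m ^+ 2 * cu m * (vnorm (w m) * vnorm (du m))))
  + 6 * e * (om m ^+ 2 * vnorm (w m)).
Proof.
move=> AB ev eu; rewrite (difference_equation m B).
rewrite hdot_residual ?hdot_wave//.
set rv := residual _ _ v _ _ _ _; set ru := residual _ _ u _ _ _ _.
have e1 : complex.Re (hdot (w m) rv) <= 3 * vnorm (w m) * e.
  by apply: le_trans (ler_norm _) _; apply: le_trans (cnorm_Re _) _; exact: hdot_err.
have e0 : 0 <= e by exact: le_trans (cnorm_ge0 _) (ev 0).
have c0 := cut_ge0 N (len R m); have c1 := cut_le1 N (len R m).
have e2 : - (cu m * complex.Re (hdot (w m) ru)) <= 3 * vnorm (w m) * e.
  apply: le_trans (ler_norm _) _; rewrite normrN normrM (ger0_norm c0).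
  apply: le_trans (ler_piMl (normr_ge0 _) c1) _.
  by apply: le_trans (cnorm_Re _) _; exact: hdot_err.
have l2 : 0 <= len R m ^+ 2 by exact: sqr_ge0.
have e3 : 0 <= nu * len R m ^+ 2 * vnorm (w m) ^+ 2.
  exact: mulr_ge0 (mulr_ge0 nu0 l2) (sqr_ge0 _).
have bnd (c : R) (y : V3) : 0 <= c -> - (c * len R m ^+ 2 * cu m * complex.Re (hdot (w m) y))
   <= c * (len R m ^+ 2 * cu m * (vnorm (w m) * vnorm y)).
  move=> cc; have key : - complex.Re (hdot (w m) y) <= vnorm (w m) * vnorm y.
    apply: le_trans (ler_norm _) _; rewrite normrN.
    by apply: le_trans (cnorm_Re _) _; exact: hdot_cnorm.
  by have := ler_wpM2l (mulr_ge0 (mulr_ge0 cc l2) c0) key; rewrite mulrN !mulrA.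
have e4 := bnd _ (u m) nu0; have e5 := bnd _ (du m) a20.
set SA := \sum_(l <- A) _; set SBA := \sum_(l <- (B `\` A)%fset) _.
set S1 := \sum_(l <- B) len R l * _ * _; set S2 := \sum_(l <- B) `|_| * _.
have e6 : - complex.Re (hdot (w m) (X m B)) <= - SA + SBA + S1 + S2.
  have -> : complex.Re (hdot (w m) (X m B)) =
     \sum_(l <- B) complex.Re (adv v m l * hdot (w m) (w l))
   + \sum_(l <- B) complex.Re (adv w m l * (cu l)%:C%C * hdot (w m) (u l))
   + \sum_(l <- B) complex.Re ((cu (m - l) * cu l - cu m)%:C%C * adv u m l * hdot (w m) (u l)).
    rewrite hdot_sumr Re_sum -!big_split/=; apply: eq_bigr => l _.
    by rewrite 2!hdotDr !hdotZr !ReD.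
  rewrite (fset_sum_split A) (fsetIidPr AB) -/SA.
  have f1 : - \sum_(l <- (B `\` A)%fset) complex.Re (adv v m l * hdot (w m) (w l)) <= SBA.
    rewrite -sumrN; apply: ler_sum => l _; apply: le_trans (ler_norm _) _; rewrite normrN.
    apply: le_trans (cnorm_Re _) _; rewrite cnormM.
    by apply: ler_pM; [exact: cnorm_ge0|exact: cnorm_ge0|exact: adv_cnorm|exact: hdot_cnorm].
  have f2 : - \sum_(l <- B) complex.Re (adv w m l * (cu l)%:C%C * hdot (w m) (u l)) <= S1.
    rewrite -sumrN; apply: ler_sum => l _; apply: le_trans (ler_norm _) _; rewrite normrN.
    apply: le_trans (cnorm_Re _) _; rewrite -mulrA !cnormM cnorm_real ger0_norm ?cut_ge0//.
    apply: ler_pM; [exact: cnorm_ge0| |exact: adv_cnorm|].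
      exact: mulr_ge0 (cut_ge0 _ _) (cnorm_ge0 _).
    by apply: ler_wpM2l (hdot_cnorm _ _); exact: cut_ge0.
  have f3 : - \sum_(l <- B) complex.Re ((cu (m - l) * cu l - cu m)%:C%C * adv u m l * hdot (w
    m) (u l)) <= S2.
    rewrite -sumrN; apply: ler_sum => l _; apply: le_trans (ler_norm _) _; rewrite normrN.
    apply: le_trans (cnorm_Re _) _; rewrite -mulrA !cnormM cnorm_real.
    apply: ler_wpM2l; first exact: normr_ge0.
    by apply: ler_pM; [exact: cnorm_ge0|exact: cnorm_ge0|exact: adv_min|exact: hdot_cnorm].
  lra.
have o2 : 0 <= om m ^+ 2 by exact: sqr_ge0.
apply: (@le_trans _ _ (om m ^+ 2 * (- SA + SBA + S1 + S2
  + nu * (len R m ^+ 2 * cu m * (vnorm (w m) * vnorm (u m)))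
  + a2 * (len R m ^+ 2 * cu m * (vnorm (w m) * vnorm (du m))) + 6 * e * vnorm (w m)))).
  by apply: ler_wpM2l => //; lra.
by rewrite le_eqVlt; apply/orP; left; apply/eqP; ring.
Qed.

(** The left-hand side does not depend on [B], which can therefore be enlarged
    until the residuals, multiplied by the finite sum [Q], are negligible. *)
Lemma energy_rate :
  \sum_(m <- A) om m ^+ 2 * complex.Re (hdot (w m) ((1 + a2 * len R m ^+ 2)%:C%C *: dw m)) <=
  3200 * X3 * Y ^+ 2 + 800 * (1 + N) ^+ 2 * X3 * W * kap + 3200 * M * Y ^+ 2
  + 128 * 100 * M * tau * Y + nu * (12 * N ^+ 3 * M * Y) + a2 * (12 * N ^+ 3 * M' * Y).
Proof.
apply/ler_addgt0Pl => e e0.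
pose Q := \sum_(m <- A) om m ^+ 2 * vnorm (w m).
have Q0 : 0 <= Q by apply: sumr_ge0 => m _; rewrite mulr_ge0 ?sqr_ge0 ?vnorm_ge0.
pose e' := e / (6 * (Q + 1)).
have den : 0 < 6 * (Q + 1) by lra.
have e'0 : 0 < e' by exact: divr_gt0.
have /choice [Bv hBv] := fun m => vmodes m e'0.
have /choice [Bu hBu] := fun m => umodes m e'0.
pose B := (A `|` (\bigcup_(m <- A) Bv m `|` \bigcup_(m <- A) Bu m))%fset.
have AB : (A `<=` B)%fset by exact: fsubsetUl.
have BvB m : m \in A -> (Bv m `<=` B)%fset.
  move=> mA; apply: fsubset_trans (fsubsetUr _ _); apply: fsubset_trans (fsubsetUl _ _).
  exact: bigfcup_sup.
have BuB m : m \in A -> (Bu m `<=` B)%fset.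
  move=> mA; apply: fsubset_trans (fsubsetUr _ _); apply: fsubset_trans (fsubsetUr _ _).
  exact: bigfcup_sup.
rewrite big_seq; apply: le_trans (ler_sum _ (fun m mA =>
  energy_rate_mode AB (hBv m _ (BvB m mA)) (hBu m _ (BuB m mA)))) _.
rewrite -big_seq !big_split/= sumrN -!mulr_sumr -/Q.
have t1 := transport_antisym N1 A vr vd v0 w0 vX wY.
have t2 := transport_tail N1 B v0 w0 vX wW kap0 tailA.
have t3 := transport_trunc N1 A B u0 w0 uM wY.
have t4 := truncation_error N1 A B u0 uM utau wY.
have uM2 := l2le_weight (isT : (2 <= 3)%N) u0 uM.
have t5 := ler_wpM2l nu0 (viscous_error N1 A uM2 wY).
have t6 := ler_wpM2l a20 (viscous_error N1 A duM wY).
have t7 : 6 * e' * Q <= e.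
  rewrite /e'; have -> : 6 * (e / (6 * (Q + 1))) * Q = e * (Q / (Q + 1)) by field; lra.
  by apply: ler_piMr; [exact: ltW|rewrite ler_pdivrMr ?mul1r; lra].
have t1' := le_trans (ler_norm _) (eq_ind_r (fun x => x <= _) t1 (normrN _)).
move: t1' t2 t3 t4 t5 t6 t7; lra.
Qed.
End EnergyRate.

(** * Distance between a Voigt solution and the truncated Euler solution *)

Section EnergyCalculus.
Variable R : realType.
Local Notation V3 := ('rV[R[i]]_3).
Local Notation Re := complex.Re.
Local Notation Im := complex.Im.
Implicit Types (T t r : R) (z : R -> V3).

Lemma is_derive_bigsum (I : Type) (s : seq I) (h : I -> R -> R) (dh : I -> R) t :
  (forall i, is_derive t 1 (h i) (dh i)) ->
  is_derive t 1 (fun r => \sum_(i <- s) h i r) (\sum_(i <- s) dh i).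
Proof.
move=> hd; elim: s => [|i s IH].
  rewrite big_nil (_ : (fun r => _) = cst 0); last by apply/boolp.funext => r; rewrite big_nil.
  exact: is_derive_cst.
rewrite big_cons (_ : (fun r => _) = h i \+ (fun r => \sum_(i <- s) h i r)).
  exact: is_deriveD.
by apply/boolp.funext => r; rewrite big_cons.
Qed.

Lemma cvg_bigsum (I J : Type) (F : set_system J) (s : seq I) (h : I -> J -> R) (l : I -> R) :
  Filter F -> (forall i, h i @ F --> l i) ->
  (fun x => \sum_(i <- s) h i x) @ F --> \sum_(i <- s) l i.
Proof.
move=> FF hc; elim: s => [|i s IH].
  rewrite big_nil (_ : (fun x => _) = cst 0); last by apply/boolp.funext => x; rewrite big_nil.
  exact: cvg_cst.
rewrite big_cons (_ : (fun x => _) = h i \+ (fun x => \sum_(i <- s) h i x)).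
  exact: cvgD.
by apply/boolp.funext => x; rewrite big_cons.
Qed.

Lemma is_derive_sqnorm z (dz : V3) t :
  (forall j, is_derive t 1 (fun r => Re (z r 0 j)) (Re (dz 0 j)) /\
             is_derive t 1 (fun r => Im (z r 0 j)) (Im (dz 0 j))) ->
  is_derive t 1 (fun r => vnorm (z r) ^+ 2) (2 * Re (hdot (z t) dz)).
Proof.
move=> hd.
have -> : (fun r => vnorm (z r) ^+ 2) = (fun r => \sum_(j <- index_enum 'I_3)
    (Re (z r 0 j) * Re (z r 0 j) + Im (z r 0 j) * Im (z r 0 j))).
  apply/boolp.funext => r; rewrite vnorm_sqr; apply: eq_bigr => j _.
  by rewrite cnorm_sqr !expr2.
have -> : 2 * Re (hdot (z t) dz) = \sum_(j <- index_enum 'I_3)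
    ((Re (z t 0 j) * Re (dz 0 j) + Re (z t 0 j) * Re (dz 0 j))
    + (Im (z t 0 j) * Im (dz 0 j) + Im (z t 0 j) * Im (dz 0 j))).
  rewrite /hdot Re_sum mulr_sumr; apply: eq_bigr => j _.
  by case: (z t 0 j) (dz 0 j) => a b [c d] /=; ring.
apply: is_derive_bigsum => j; have [h1 h2] := hd j.
exact: (is_deriveD (is_deriveM h1 h1) (is_deriveM h2 h2)).
Qed.

Lemma cvg_sqnorm (F : set_system R) z (z0 : V3) : Filter F ->
  (forall j (e : R), 0 < e -> \forall r \near F, cnorm (z r 0 j - z0 0 j) <= e) ->
  (fun r => vnorm (z r) ^+ 2) @ F --> vnorm z0 ^+ 2.
Proof.
move=> FF hc.
have cRe j : (fun r => Re (z r 0 j)) @ F --> Re (z0 0 j).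
  apply/cvgrPdist_le => /= e e0; apply: filterS (hc j e e0) => r; apply: le_trans.
  by rewrite distrC -ReN -ReD; exact: cnorm_Re.
have cIm j : (fun r => Im (z r 0 j)) @ F --> Im (z0 0 j).
  apply/cvgrPdist_le => /= e e0; apply: filterS (hc j e e0) => r; apply: le_trans.
  have -> : Im (z0 0 j) - Im (z r 0 j) = - Im (z r 0 j - z0 0 j).
    by case: (z r 0 j) (z0 0 j) => a b [c d] /=; ring.
  rewrite normrN -ler_sqr ?nnegrE ?cnorm_ge0// cnorm_sqr real_normK ?num_real//.
  by rewrite lerDr sqr_ge0.
have -> : (fun r => vnorm (z r) ^+ 2) = (fun r => \sum_(j <- index_enum 'I_3)
    (Re (z r 0 j) * Re (z r 0 j) + Im (z r 0 j) * Im (z r 0 j))).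
  apply/boolp.funext => r; rewrite vnorm_sqr; apply: eq_bigr => j _.
  by rewrite cnorm_sqr !expr2.
have -> : vnorm z0 ^+ 2 = \sum_(j <- index_enum 'I_3)
    (Re (z0 0 j) * Re (z0 0 j) + Im (z0 0 j) * Im (z0 0 j)).
  by rewrite vnorm_sqr; apply: eq_bigr => j _; rewrite cnorm_sqr !expr2.
by apply: cvg_bigsum => j; apply: cvgD; apply: cvgM.
Qed.
End EnergyCalculus.

Section Stability.
Variable R : realType.
Local Notation K := ('rV[int]_3).
Local Notation V3 := ('rV[R[i]]_3).
Implicit Types (t : R) (D : {fset K}).

Lemma sqr_mono (a b : R) : 0 <= a -> a <= b -> a ^+ 2 <= b ^+ 2.
Proof. by move=> a0 ab; rewrite lerXn2r// nnegrE (le_trans a0). Qed.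

Lemma sqr_vnormB (z y : V3) : vnorm (z - y) ^+ 2 <= 2 * vnorm z ^+ 2 + 2 * vnorm y ^+ 2.
Proof. by rewrite -(vnormN y); exact: sqr_vnormD. Qed.

(** The tail [kap] has to beat the factor [W], a bound of the H^4 norm of [w]
    that depends on the Voigt solution; it is chosen after [N] and [W]. *)
Lemma tail_threshold (n c W d : R) : 0 <= n -> 0 <= c -> 0 <= W -> 0 < d -> d <= 1 ->
  exists kap : R, [/\ 0 < kap, 1600 * (1 + n) ^+ 2 * (1 + c) * (W * kap) <= d,
    (1 + n) ^+ 2 * kap <= 1 & kap <= d].
Proof.
move=> n0 c0 W0 d0 d1.
have [n1 c1 W1] : [/\ 1 <= (1 + n) ^+ 2, 1 <= 1 + c & 1 <= 1 + W].
  by split; rewrite ?exprn_ege1// lerDl.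
set P := (1 + n) ^+ 2 in n1 *.
have Q1 : 1 <= (1 + c) * (1 + W) by rewrite mulr_ege1.
pose den := 1600 * (P * ((1 + c) * (1 + W))).
have P1 : P <= P * ((1 + c) * (1 + W)) by rewrite ler_peMr//; lra.
have Pden : P <= den by rewrite /den; lra.
have den0 : 0 < den by lra.
exists (d / den); split.
- exact: divr_gt0.
- have -> : 1600 * P * (1 + c) * (W * (d / den)) = d * (W / (1 + W)).
    by rewrite /den; field; rewrite !gt_eqF//; lra.
  by apply: ler_piMr; [exact: ltW|rewrite ler_pdivrMr ?mul1r; lra].
- by rewrite mulrA ler_pdivrMr// mul1r; apply: le_trans Pden; rewrite ler_piMr//; lra.
- by rewrite ler_pdivrMr// ler_peMr//; [exact: ltW|lra].
Qed.

(** [Y = sqrt (y + d)] bounds the weighted norm of [w] over all modes, [y] being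
    the energy over the retained ones.  The velocity [v] enters through its H^3
    norm [2 (Y + M)], whence the cubic term [Y^3 <= (1 + Y^2) Y^2]; terms linear
    in [Y] are bounded through [Y <= 1 + Y^2]. *)
Lemma rate_algebra (M Y y d P W kap tau N3 nu a2 M' D : R) :
  0 <= M -> 0 <= Y -> 0 <= y -> Y ^+ 2 = y + d -> 0 < d -> d <= 1 ->
  0 <= P -> 0 <= W -> 0 <= kap -> 1600 * P * (1 + M) * (W * kap) <= d ->
  0 <= 128 * 100 * M * tau + 12 * N3 * (nu * M + a2 * M') ->
  D <= 3200 * (2 * (Y + M)) * Y ^+ 2 + 800 * P * (2 * (Y + M)) * W * kap
     + 3200 * M * Y ^+ 2 + 128 * 100 * M * tau * Y
     + nu * (12 * N3 * M * Y) + a2 * (12 * N3 * M' * Y) ->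
  2 * D <= 4 * (96 * 100 * (1 + M)) * (1 + y)
    * (y + (3 * d + (128 * 100 * M * tau + 12 * N3 * (nu * M + a2 * M')))).
Proof.
move=> M0 Y0 y0 Y2 d0 d1 P0 W0 k0 hk.
set e1 := 128 * 100 * M * tau + _ => e10 hD.
have tl : 800 * P * (2 * (Y + M)) * W * kap <= d * (1 + Y).
  have nn := mulr_ge0 (mulr_ge0 (ler0n R 1600) P0) (mulr_ge0 W0 k0).
  have YM1 : Y + M <= (1 + M) * (1 + Y) by have := mulr_ge0 Y0 M0; lra.
  have := ler_wpM2l nn YM1; have := ler_wpM2r (addr_ge0 ler01 Y0) hk; lra.
have {hD tl hk} h1 : D <= 64 * 100 * (Y + M) * Y ^+ 2 + 3200 * M * Y ^+ 2 + d * (1 + Y) + e1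
  * Y.
  by move: hD tl; rewrite /e1; clear; lra.
have Yle : Y <= 1 + Y ^+ 2 by have := sqr_ge0 (Y - 1); have := sqr_ge0 Y; clear; lra.
clearbody e1; move: (Y ^+ 2) (sqr_ge0 Y) Y2 Yle h1 => Z Z0 Zy YZ h1.
have b1 : e1 * Y <= e1 * (1 + Z) by rewrite ler_wpM2l.
have b2 : d * (1 + Y) <= d * (2 * (1 + Z)) by rewrite ler_wpM2l ?ltW//; lra.
have b3 : Y * Z <= (1 + Z) * Z by rewrite ler_wpM2r.
have MZ := mulr_ge0 (mulr_ge0 M0 Z0) Z0.
have b5 := mulr_ge0 M0 (mulr_ge0 (addr_ge0 ler01 Z0) (addr_ge0 (mulr_ge0 (ler0n R 2) (ltW
  d0)) e10)).
have b6 := mulr_ge0 (addr_ge0 ler01 Z0) (addr_ge0 (mulr_ge0 (ler0n R 2) (ltW d0)) e10).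
have b7 := mulr_ge0 (addr_ge0 ler01 Z0) Z0; have b8 := mulr_ge0 M0 b7.
have h2 : D <= (1 + Z) * (96 * 100 * (1 + M) * (Z + 2 * d + e1)).
  by move: h1 b1 b2 b3 MZ b5 b6 b7 b8; clear; lra.
have h3 : (1 + Z) * (96 * 100 * (1 + M) * (Z + 2 * d + e1)) <=
    (2 * (1 + y)) * (96 * 100 * (1 + M) * (y + (3 * d + e1))).
  rewrite Zy; apply: ler_pM; [lra| |lra|].
    by apply: mulr_ge0; lra.
  by apply: ler_wpM2l; lra.
by move: h2 h3; clear; lra.
Qed.

Variables (N T a2 nu : R) (u du v dv : R -> coeffs R 3) (pu pv : R -> K -> R[i]).
Hypotheses (N1 : 1 <= N) (T0 : 0 < T) (a20 : 0 <= a2) (nu0 : 0 <= nu).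
Let N0 : 0 < N. Proof. exact: lt_le_trans ltr01 N1. Qed.
Let N0' : 0 <= N. Proof. exact: ltW. Qed.
Local Notation om k := (omega N (len R k)).
Local Notation cu k := (cut N (len R k)).
Local Notation w t := (fun k => v t k - truncate N (u t) k).
Local Notation dw t := (fun k => dv t k - truncate N (du t) k).

Hypotheses (uC : C0Hs T 3 u) (uC1 : C1Hs T 2 u du) (vC1 : C1Hs T 4 v dv).
Hypothesis umodes : forall t, t \in `[0, T] -> solves_modes 0 0 (u t) (du t) (pu t).
Hypothesis vmodes : forall t, t \in `[0, T] -> solves_modes a2 nu (v t) (dv t) (pv t).
Variables (M M' tau E0 del : R).
Hypothesis uM : forall t, t \in `[0, T] -> l2le (fun k => len R k ^+ 3 * vnorm (u t k)) M.
Hypothesis duM : forall t, t \in `[0, T] -> l2le (fun k => len R k ^+ 2 * vnorm (du t k)) M'.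
Hypothesis utau : forall t, t \in `[0, T] -> l2le (hitail N (u t)) tau.
Hypothesis init : forall D,
  \sum_(k <- D) om k ^+ 2 * (1 + a2 * len R k ^+ 2) * vnorm (w 0 k) ^+ 2 <= E0.
Hypothesis del01 : 0 < del <= 1.

Let u_div t : t \in `[0, T] -> divfree (u t).
Proof. by move=> /uC.1[_ h]. Qed.
Let u_zero t : t \in `[0, T] -> u t 0 = 0.
Proof. by move=> /uC.1[[h _ _] _]. Qed.
Let vC : C0Hs T 4 v. Proof. by case: vC1. Qed.
Let v_real t : t \in `[0, T] -> real_coeffs (v t).
Proof. by move=> /vC.1[[_ h _] _]. Qed.
Let v_div t : t \in `[0, T] -> divfree (v t).
Proof. by move=> /vC.1[_ h]. Qed.
Let v_zero t : t \in `[0, T] -> v t 0 = 0.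
Proof. by move=> /vC.1[[h _ _] _]. Qed.

Let itv0 : (0 : R) \in `[0, T]. Proof. by rewrite in_itv/= lexx ltW. Qed.

(** The truncation gains a derivative at the cost of the factor [2 N]. *)
Lemma truncate_len4 (z : coeffs R 3) k :
  len R k ^+ 4 * vnorm (truncate N z k) <= 2 * N * (len R k ^+ 3 * vnorm (z k)).
Proof.
rewrite /truncate vnormZ cnorm_real ger0_norm ?cut_ge0//.
have l0 := len_ge0 R k; have c0 := cut_ge0 N (len R k); have c1 := cut_le1 N (len R k).
have key : len R k * cu k <= 2 * N.
  have [h|/ltW h] := leP (2 * N) (len R k).
    by rewrite (cut_out N0 h) mulr0 mulr_ge0.
  by apply: le_trans h; rewrite ler_piMr.
have nn : 0 <= len R k ^+ 3 * vnorm (z k) by rewrite mulr_ge0 ?exprn_ge0 ?vnorm_ge0.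
have := ler_wpM2r nn key; apply: le_trans.
by rewrite le_eqVlt; apply/orP; left; apply/eqP; ring.
Qed.

Lemma difference_len4 t D : \sum_(k <- D) (len R k ^+ 4 * vnorm (w t k)) ^+ 2 <=
  2 * \sum_(k <- D) (len R k ^+ 4 * vnorm (v t k)) ^+ 2
  + 8 * N ^+ 2 * \sum_(k <- D) (len R k ^+ 3 * vnorm (u t k)) ^+ 2.
Proof.
rewrite !mulr_sumr -big_split/=; apply: ler_sum => k _.
have n k' (z : V3) a : 0 <= len R k' ^+ a * vnorm z.
  by rewrite mulr_ge0 ?exprn_ge0 ?len_ge0 ?vnorm_ge0.
have h1 : (len R k ^+ 4 * vnorm (truncate N (u t) k)) ^+ 2 <=
  (2 * N * (len R k ^+ 3 * vnorm (u t k))) ^+ 2.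
  by rewrite lerXn2r ?nnegrE ?n ?truncate_len4// mulr_ge0// mulr_ge0.
have h2 := ler_wpM2l (sqr_ge0 (len R k ^+ 4)) (sqr_vnormB (v t k) (truncate N (u t) k)).
move: h1 h2; rewrite !exprMn; lra.
Qed.

(** [v] is continuous in H^4 and, for fixed [N], the truncation of [u] inherits
    in H^4 the uniform smallness of the H^3 tails of [u]. *)
Lemma difference_tail (kap : R) : 0 < kap ->
  exists A0 : {fset K}, forall t, t \in `[0, T] -> forall D, [disjoint A0 & D]%fset ->
    \sum_(k <- D) (len R k ^+ 4 * vnorm (w t k)) ^+ 2 <= kap ^+ 2.
Proof.
move=> k0; have k2 : 0 < kap ^+ 2 by exact: exprn_gt0.
have c1 : 0 < kap ^+ 2 / 4 by lra.
have c2 : 0 < kap ^+ 2 / (16 * N ^+ 2) by rewrite divr_gt0// mulr_gt0// exprn_gt0.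
have [Bv hv] := @C0Hs_tail R T 4 v _ isT vC c1.
have [Bu hu] := @C0Hs_tail R T 3 u _ isT uC c2.
exists (Bv `|` Bu)%fset => t tT D dis; apply: le_trans (difference_len4 _ _) _.
have h1 := hv t tT D (fdisjointWl (fsubsetUl _ _) dis).
have h2 := hu t tT D (fdisjointWl (fsubsetUr _ _) dis).
have N2 : 0 <= 8 * N ^+ 2 by rewrite mulr_ge0// sqr_ge0.
have := ler_wpM2l N2 h2.
have -> : 8 * N ^+ 2 * (kap ^+ 2 / (16 * N ^+ 2)) = kap ^+ 2 / 2 by field; rewrite gt_eqF.
lra.
Qed.

Let y (A : {fset K}) t := \sum_(k <- A) (om k ^+ 2 * (1 + a2 * len R k ^+ 2)) * vnorm (w t k)
  ^+ 2.

Lemma energy_cont A : {within `[0, T], continuous (y A)}.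
Proof.
apply/subspace_continuousP => t tT; rewrite /y.
apply: cvg_bigsum => k; apply: cvgM; first exact: cvg_cst.
apply: (@cvg_sqnorm R _ (fun t => w t k)) => j e e0.
have e2 : 0 < e / 2 by lra.
have h1 := C0Hs_coord k j (isT : (0 < 4)%N) vC tT e2.
have h2 := C0Hs_coord k j (isT : (0 < 3)%N) uC tT e2.
rewrite near_withinE; near=> r => rT.
have g1 : cnorm (v r k 0 j - v t k 0 j) <= e / 2 by move: rT; near: r.
have g2 : cnorm (u r k 0 j - u t k 0 j) <= e / 2 by move: rT; near: r.
have -> : (v r k - truncate N (u r) k) 0 j - (v t k - truncate N (u t) k) 0 j =
  (v r k 0 j - v t k 0 j) - (cu k)%:C%C * (u r k 0 j - u t k 0 j).
  by rewrite /truncate !mxE; ring.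
apply: le_trans (cnormB _ _) _; rewrite cnormM cnorm_real ger0_norm ?cut_ge0//.
have := ler_piMl (cnorm_ge0 (u r k 0 j - u t k 0 j)) (cut_le1 N (len R k)); lra.
Unshelve. all: by end_near.
Qed.

Lemma energy_derive A t : t \in `]0, T[ -> is_derive t 1 (y A)
  (2 * \sum_(m <- A) om m ^+ 2 * complex.Re (hdot (w t m) ((1 + a2 * len R m ^+ 2)%:C%C *: dw
    t m))).
Proof.
move=> tT; rewrite mulr_sumr.
have -> : \sum_(m <- A) 2 * (om m ^+ 2 * complex.Re (hdot (w t m) ((1 + a2 * len R m ^+
  2)%:C%C *: dw t m)))
  = \sum_(m <- A) (om m ^+ 2 * (1 + a2 * len R m ^+ 2)) * (2 * complex.Re (hdot (w t m) (dw t
    m))).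
  by apply: eq_bigr => m _; rewrite hdotZr RemulC; ring.
apply: is_derive_bigsum => k.
apply: (@is_deriveZ _ _ _ (fun t => vnorm (w t k) ^+ 2)).
apply: (@is_derive_sqnorm R (fun t => w t k)) => j.
have [v1 v2] := C1Hs_coord k j (isT : (0 < 4)%N) vC1 tT.
have [u1 u2] := C1Hs_coord k j (isT : (0 < 2)%N) uC1 tT.
have part (P : R[i] -> R) : (forall a b, P (a - b) = P a - P b) ->
    (forall (c : R) b, P (c%:C%C * b) = c * P b) ->
    is_derive t 1 (fun r => P (v r k 0 j)) (P (dv t k 0 j)) ->
    is_derive t 1 (fun r => P (u r k 0 j)) (P (du t k 0 j)) ->
    is_derive t 1 (fun r => P ((v r k - truncate N (u r) k) 0 j)) (P ((dv t k - truncate N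
      (du t) k) 0 j)).
  move=> PB PZ h1 h2.
  have e (a b : coeffs R 3) : P ((a k - truncate N b k) 0 j) = P (a k 0 j) - cu k * P (b k 0 j).
    by rewrite /truncate !mxE PB PZ.
  rewrite e (_ : (fun r => _) = (fun r => P (v r k 0 j)) \- (cu k \*: (fun r =>
    P (u r k 0 j)))).
    exact: (is_deriveB h1 (is_deriveZ _ h2)).
  by apply/boolp.funext => r; rewrite e.
split; apply: part => //; try by move=> c [a b] /=; ring.
  by move=> [a b] [c d].
by move=> [a b] [c d].
Qed.

Let eta := 3 * del + (128 * 100 * M * tau + 12 * N ^+ 3 * (nu * M + a2 * M')).
Let C := 4 * (96 * 100 * (1 + M)).

(** The Gronwall inequality applied to the energy of the modes in [A], where [A]
    contains the modes of interest and enough others for the tail [kap] to be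
    below its threshold.  The bound does not depend on [A], nor on the H^4 norm
    [W] of the difference, which only influenced the choice of [kap]. *)
Lemma voigt_euler_distance : eta <= 1 -> (E0 + eta) * expR (C * T) <= 1 / 2 ->
  forall t, t \in `[0, T] -> forall D,
  \sum_(k <- D) (om k * vnorm (w t k)) ^+ 2 <= 2 * ((E0 + eta) * expR (C * T)).
Proof.
move=> eta1 small t tT D.
have /andP[d0 d1] := del01; have n0 : 0 < N := N0; have n1 : 1 <= N := N1.
have M0 : 0 <= M by case: (uM itv0).
have M'0 : 0 <= M' by case: (duM itv0).
have tau0 : 0 <= tau by case: (utau itv0).
have C0 : 0 <= C by rewrite /C; lra.
have e00 : 0 <= 128 * 100 * M * tau + 12 * N ^+ 3 * (nu * M + a2 * M').
  have h1 := mulr_ge0 M0 tau0; have h2 := mulr_ge0 nu0 M0; have h3 := mulr_ge0 a20 M'0.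
  have h4 := mulr_ge0 (exprn_ge0 3 N0') (addr_ge0 h2 h3); lra.
have eta0 : 0 < eta by rewrite /eta; lra.
have [Mv Mv0 hMv] := @C0Hs_bound R T 4 v isT vC.
pose W := 2 * (Mv + 2 * N * M).
have W0 : 0 <= W.
  apply: mulr_ge0 => //; apply: addr_ge0 => //; apply: mulr_ge0 => //; exact: mulr_ge0.
have wW s : s \in `[0, T] -> l2le (fun k => len R k ^+ 4 * vnorm (w s k)) W.
  move=> sT; split; first exact: W0.
  move=> B; apply: le_trans (difference_len4 s B) _.
  have [_ /(_ B) h1] := hMv s sT; have [_ /(_ B) h2] := uM sT.
  have N2 : 0 <= 8 * N ^+ 2 by rewrite mulr_ge0// sqr_ge0.
  have h3 := ler_wpM2l N2 h2.
  have := mulr_ge0 Mv0 (mulr_ge0 N0' M0); have := sqr_ge0 Mv; have := sqr_ge0 (N * M).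
  rewrite /W; lra.
clearbody W.
have [kap [kap0 kapW kapN kap1]] := tail_threshold N0' M0 W0 d0 d1.
have [A0 hA0] := difference_tail kap0.
pose A := (A0 `|` D)%fset.
have A0A : (A0 `<=` A)%fset by exact: fsubsetUl.
have tailA s : s \in `[0, T] -> forall B, [disjoint A & B]%fset ->
    \sum_(k <- B) (len R k ^+ 4 * vnorm (w s k)) ^+ 2 <= kap ^+ 2.
  by move=> sT B dis; apply: hA0 => //; exact: fdisjointWl A0A dis.
have yge s (B : {fset K}) : \sum_(k <- B) (om k * vnorm (w s k)) ^+ 2 <= y B s.
  apply: ler_sum => k _; rewrite exprMn ler_wpM2r ?sqr_ge0// ler_peMr ?sqr_ge0//.
  by rewrite lerDl mulr_ge0// sqr_ge0.
have y0 (B : {fset K}) s : 0 <= y B s.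
  by apply: le_trans (yge s B); apply: sumr_ge0 => k _; exact: sqr_ge0.
have wz s : s \in `[0, T] -> w s 0 = 0.
  by move=> sT; rewrite /truncate (v_zero sT) (u_zero sT) scaler0 subr0.
(* The modes outside A contribute at most (1 + N)^2 kap^2 <= del. *)
have total s : s \in `[0, T] ->
    l2le (fun k => om k * vnorm (w s k)) (Num.sqrt (y A s + del)).
  move=> sT; split; first exact: sqrtr_ge0.
  move=> B; rewrite sqr_sqrtr; last by have := y0 A s; lra.
  rewrite (fset_sum_split A); apply: lerD.
    apply: le_trans (yge s A); apply: ler_sum_fset; first exact: fsubsetIr.
    by move=> k; exact: sqr_ge0.
  apply: (@le_trans _ _ (\sum_(k <- (B `\` A)%fset) (1 + N) ^+ 2 * (len R k ^+ 4 * vnorm (w s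
    k)) ^+ 2)).
    apply: ler_sum => k _.
    have [->|k0] := eqVneq k 0; first by rewrite (wz s sT) vnorm0 !mulr0 expr0n/= mulr0.
    rewrite -exprMn; apply: sqr_mono;
      first exact: mulr_ge0 (omega_ge0 N0' (len_ge0 _ _)) (vnorm_ge0 _).
    have l1 := len_ge1 R k0.
    rewrite mulrA ler_wpM2r ?vnorm_ge0//; apply: le_trans (omega_cube N0' l1) _.
    by rewrite ler_wpM2l ?ler_weXn2l// addr_ge0.
  rewrite -mulr_sumr.
  have dis : [disjoint A & B `\` A]%fset by apply/fdisjointP => k kA; rewrite inE kA.
  apply: le_trans (ler_wpM2l (sqr_ge0 _) (tailA s sT _ dis)) _.
  by rewrite expr2 mulrA; apply: le_trans (ler_piMl (ltW kap0) kapN) kap1.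
have rate s : s \in `]0, T[ ->
   2 * \sum_(m <- A) om m ^+ 2 * complex.Re (hdot (w s m) ((1 + a2 * len R m ^+ 2)%:C%C *: dw
     s m))
   <= C * (1 + y A s) * (y A s + eta).
  move=> sI; have sT : s \in `[0, T] by move: sI; rewrite !in_itv/= => /andP[/ltW -> /ltW ->].
  set Y := Num.sqrt (y A s + del).
  have Y0 : 0 <= Y by exact: sqrtr_ge0.
  have Y2 : Y ^+ 2 = y A s + del by rewrite sqr_sqrtr//; have := y0 A s; lra.
  have vX : l2le (fun k => len R k ^+ 3 * vnorm (v s k)) (2 * (Y + M)).
    split; first by rewrite mulr_ge0// addr_ge0.
    move=> B; have [_ /(_ B) h1] := total s sT; have [_ /(_ B) h2] := uM sT.
    apply: (@le_trans _ _ (2 * Y ^+ 2 + 2 * M ^+ 2)); last by have := mulr_ge0 Y0 M0;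
      have := sqr_ge0 Y; have := sqr_ge0 M; lra.
    apply: le_trans (lerD (ler_wpM2l (ler0n _ 2) h1) (ler_wpM2l (ler0n _ 2) h2)).
    rewrite !mulr_sumr -big_split/=; apply: ler_sum => k _.
    have l0 := len_ge0 R k.
    have h3 := ler_wpM2l (sqr_ge0 (len R k ^+ 3)) (sqr_vnormD (w s k) (truncate N (u s) k)).
    rewrite subrK in h3.
    have h4 : (len R k ^+ 3 * vnorm (w s k)) ^+ 2 <= (om k * vnorm (w s k)) ^+ 2.
      apply: sqr_mono; first exact: mulr_ge0 (exprn_ge0 3 l0) (vnorm_ge0 _).
      by rewrite ler_wpM2r ?vnorm_ge0// cube_le_omega.
    have h5 : (len R k ^+ 3 * vnorm (truncate N (u s) k)) ^+ 2 <=
      (len R k ^+ 3 * vnorm (u s k)) ^+ 2.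
      apply: sqr_mono; first exact: mulr_ge0 (exprn_ge0 3 l0) (vnorm_ge0 _).
      rewrite ler_wpM2l ?exprn_ge0// /truncate vnormZ cnorm_real ger0_norm ?cut_ge0//.
      by rewrite ler_piMl ?vnorm_ge0 ?cut_le1.
    move: h3 h4 h5; rewrite !exprMn; lra.
  have := energy_rate N1 (v_real sT) (v_div sT) (u_div sT) (v_zero sT) (u_zero sT) nu0 a20
    (vmodes sT) (umodes sT) vX (wW s sT) (uM sT) (duM sT) (utau sT) (total s sT) (ltW kap0)
      (tailA s sT).
  rewrite -/Y => /(rate_algebra M0 Y0 (y0 A s) Y2 d0 d1 (sqr_ge0 _) W0 (ltW kap0) kapW e00).
  by rewrite /C /eta.
have yinit : y A 0 <= E0 by exact: init.
have small' : (y A 0 + eta) * expR (C * T) <= 1 / 2.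
  by apply: le_trans small; rewrite ler_wpM2r ?expR_ge0// lerD2r.
have eta01 : 0 < eta <= 1 by rewrite eta0.
have := gronwall_rational T0 C0 eta01 (fun s _ => y0 A s) (@energy_cont A)
  (fun s sI => @energy_derive A s sI) rate small' tT.
move=> ybound.
apply: (@le_trans _ _ (y A t)).
  apply: le_trans (yge t A); apply: ler_sum_fset; first exact: fsubsetUr.
  by move=> k; exact: sqr_ge0.
apply: le_trans ybound _; rewrite ler_wpM2l// ler_wpM2r ?expR_ge0// lerD2r//.
Qed.
End Stability.

(** * Equations in Fourier space, initial energy *)

Section FromEquations.
Variable R : realType.
Local Notation K := ('rV[int]_3).
Implicit Types (u du : coeffs R 3) (p : coeffs R 1).

Lemma solves_modes_pointwise (a2 nu : R) u du p (f : 'I_3 -> 'rV[R]_3 -> R) c cp :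
  real_coeffs u -> u 0 = 0 -> l2le (fun k => len R k ^+ 3 * vnorm (u k)) c ->
  real_coeffs p -> p 0 = 0 -> l2le (fun k => len R k ^+ 3 * vnorm (p k)) cp ->
  (forall j, has_fourier (f j) (fun k =>
     (1 + a2 * len R k ^+ 2)%:C%C * du k 0 j + (nu * len R k ^+ 2)%:C%C * u k 0 j)) ->
  (forall x j, f j x + convection u j x + pder j (realize p 0) x = 0) ->
  solves_modes a2 nu u du (fun m => p m 0 0).
Proof.
move=> ur u0 uc pr p0 pc fa eqn m e e0.
have /choice [B hB] := fun j => convection_modes ur u0 uc pr p0 pc (fa j) (fun x =>
  eqn x j) m e0.
exists (\bigcup_(j <- enum 'I_3) B j)%fset => D BD j.
have BjD : (B j `<=` D)%fset.
  by apply: fsubset_trans BD; apply: bigfcup_sup; rewrite ?mem_enum.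
have := hB j D BjD; congr (cnorm _ <= _).
rewrite /residual !mxE summxE; congr (_ + _ + _); first by rewrite mulrC.
by apply: eq_bigr => l _; rewrite mxE.
Qed.

Lemma sobolev0_l2le n (s : nat) (w : coeffs R n) : (0 < s)%N -> sobolev0 s%:R w ->
  [/\ real_coeffs w, w 0 = 0 & exists c, l2le (fun k => len R k ^+ s * vnorm (w k)) c].
Proof.
move=> s0 [w0 wr /(hnorm_lty s0)[c [_ _ hc]]]; split => //; by exists c.
Qed.

Lemma euler_modes T (u du : R -> coeffs R 3) (p : R -> coeffs R 1) :
  C0Hs T 3 u -> C1Hs T 2 u du ->
  (forall t, t \in `[0, T] -> sobolev0 3 (p t)) ->
  (forall t, t \in `[0, T] -> forall x j,
     realize (du t) j x + convection (u t) j x + pder j (realize (p t) 0) x = 0) ->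
  forall t, t \in `[0, T] -> solves_modes 0 0 (u t) (du t) (fun m => p t m 0 0).
Proof.
move=> uC [_ duC _] pS eqn t tT.
have [ur uz [c uc]] := sobolev0_l2le (isT : (0 < 3)%N) (uC.1 t tT).1.
have [dur duz [c' duc]] := sobolev0_l2le (isT : (0 < 2)%N) (duC.1 t tT).1.
have [pr pz [c'' pc]] := sobolev0_l2le (isT : (0 < 3)%N) (pS t tT).
apply: (solves_modes_pointwise ur uz uc pr pz pc) (eqn t tT) => j.
apply: has_fourier_ext (frefl _) _ (has_fourier_Hs j (isT : (2 <= 2)%N) dur duz duc) => k.
by rewrite !mul0r !addr0 mul1r.
Qed.

Lemma nsv_modes T alpha nu (u du : R -> coeffs R 3) (p : R -> coeffs R 1) :
  C1Hs T 4 u du ->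
  (forall t, t \in `[0, T] -> sobolev0 3 (p t)) ->
  (forall t, t \in `[0, T] -> forall x j,
     realize (du t) j x - alpha ^+ 2 * laplacian (realize (du t) j) x
       + convection (u t) j x - nu * laplacian (realize (u t) j) x
       + pder j (realize (p t) 0) x = 0) ->
  forall t, t \in `[0, T] -> solves_modes (alpha ^+ 2) nu (u t) (du t) (fun m => p t m 0 0).
Proof.
move=> [uC duC _] pS eqn t tT.
have [ur uz [c uc]] := sobolev0_l2le (isT : (0 < 4)%N) (uC.1 t tT).1.
have [dur duz [c' duc]] := sobolev0_l2le (isT : (0 < 4)%N) (duC.1 t tT).1.
have [pr pz [c'' pc]] := sobolev0_l2le (isT : (0 < 3)%N) (pS t tT).
have uc3 := l2le_weight (isT : (3 <= 4)%N) uz uc.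
pose f j x := realize (du t) j x + (- alpha ^+ 2) * laplacian (realize (du t) j) x
  + (- nu) * laplacian (realize (u t) j) x.
apply: (@solves_modes_pointwise _ _ _ _ _ f _ _ ur uz uc3 pr pz pc) => [j|x j].
  have h := has_fourierD (has_fourierD (has_fourier_Hs j (isT : (2 <= 4)%N) dur duz duc)
     (has_fourierZ (- alpha ^+ 2) (has_fourier_laplacian j dur duz duc)))
     (has_fourierZ (- nu) (has_fourier_laplacian j ur uz uc)).
  apply: has_fourier_ext (frefl _) _ h => k.
  have -> : (1 + alpha ^+ 2 * len R k ^+ 2)%:C%C = 1 + (alpha ^+ 2)%:C%C * (len R k ^+ 2)%:C%C.
    by rewrite rmorphD rmorphM rmorph1.
  have -> : (nu * len R k ^+ 2)%:C%C = nu%:C%C * (len R k ^+ 2)%:C%C by rewrite rmorphM.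
  have -> : (- alpha ^+ 2)%:C%C = - (alpha ^+ 2)%:C%C :> R[i] by rewrite rmorphN.
  have -> : (- nu)%:C%C = - nu%:C%C :> R[i] by rewrite rmorphN.
  move: (alpha ^+ 2)%:C%C nu%:C%C (len R k ^+ 2)%:C%C (du t k 0 j) (u t k 0 j) => a b r x y.
  ring.
rewrite -[RHS](eqn t tT x j) /f.
move: (pder j _ x) (convection (u t) j x) (laplacian (realize (u t) j) x)
  (laplacian (realize (du t) j) x) (realize (du t) j x) => a b g d e.
by rewrite !mulNr; congr (_ + _); rewrite addrAC.
Qed.
End FromEquations.

Section CutoffEstimates.
Variable R : realType.
Local Notation K := ('rV[int]_3).

Lemma squeeze_cvge0 (f : nat -> \bar R) :
  (forall e : R, 0 < e -> \forall n \near \oo, (0 <= f n <= e%:E)%E) -> f @ \oo --> 0%E.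
Proof.
move=> h A hA; have /nbhs_ballP[e /= e0 he] : nbhs (0 : R) (fun r => A r%:E) := hA.
have e2 : 0 < e / 2 by lra.
apply: filterS (h _ e2) => n; case fE : (f n) => [r| |] //=;
  rewrite ?leye_eq// ?leeNy_eq ?andbF//.
rewrite !lee_fin => /andP[r0 re].
rewrite /preimage/= fE; apply: he; rewrite /ball/= sub0r normrN ger0_norm//; lra.
Qed.

(** Finitely many frequencies carry all but [tau] of the H^3 norm, uniformly in
    time, and [N / 2] is taken above all of them. *)
Lemma high_frequencies (T : R) (u : R -> coeffs R 3) (tau : R) : C0Hs T 3 u -> 0 < tau ->
  exists2 N : R, 1 <= N & forall t, t \in `[0, T] -> l2le (hitail N (u t)) tau.
Proof.
move=> uC t0; have t2 : 0 < tau ^+ 2 by exact: exprn_gt0.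
have [B0 hB] := @C0Hs_tail R T 3 u _ isT uC t2.
pose N := 1 + 2 * \sum_(k <- B0) len R k.
have s0 : 0 <= \sum_(k <- B0) len R k by apply: sumr_ge0 => k _; exact: len_ge0.
exists N; first by rewrite lerDl mulr_ge0.
move=> t tT; split; first exact: ltW.
move=> A; rewrite (fset_sum_split B0).
rewrite [X in X + _]big1_fset ?add0r; last first.
  move=> k; rewrite inE => /andP[_ kB] _; rewrite /hitail ifF ?expr0n//.
  have : len R k <= \sum_(k <- B0) len R k.
    by rewrite (big_fsetD1 k)//= lerDl sumr_ge0// => i _; exact: len_ge0.
  by move=> h; apply/negbTE; rewrite -leNgt /N; lra.
apply: le_trans (hB t tT (A `\` B0)%fset _); last by apply/fdisjointP => k kB; rewrite inE kB.
apply: ler_sum => k _; rewrite /hitail; case: ifP => // _.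
by rewrite expr0n/= sqr_ge0.
Qed.

Variables (N : R) (N1 : 1 <= N).
Local Notation om k := (omega N (len R k)).
Local Notation cu k := (cut N (len R k)).

Lemma truncation_tail (u : coeffs R 3) k : u 0 = 0 ->
  len R k ^+ 3 * vnorm (u k - truncate N u k) <= hitail N u k.
Proof.
move=> u0; have n1 : 1 <= N := N1; have n0 : 0 < N by lra.
have -> : u k - truncate N u k = (1 - cu k)%:C%C *: u k.
  by rewrite /truncate rmorphB rmorph1 scalerBl scale1r.
have c0 := cut_ge0 N (len R k); have c1 := cut_le1 N (len R k).
rewrite vnormZ cnorm_real ger0_norm ?subr_ge0// /hitail.
have [h|h] := leP (len R k) (N / 2).
  by rewrite cut_in//; [rewrite subrr mul0r mulr0|lra].
rewrite ler_wpM2l ?exprn_ge0 ?len_ge0// ler_piMl ?vnorm_ge0//; lra.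
Qed.

(** Where the truncation acts, the frequency exceeds [N], and there
    [omega N r <= 2 r^3]. *)
Lemma omega_truncation_tail (u : coeffs R 3) k : u 0 = 0 ->
  om k * vnorm (u k - truncate N u k) <= 2 * hitail N u k.
Proof.
move=> u0; have n1 : 1 <= N := N1; have n0 : 0 < N by lra.
have [h|h] := leP (len R k) N.
  have -> : u k - truncate N u k = 0 by rewrite /truncate cut_in// rmorph1 scale1r subrr.
  rewrite vnorm0 mulr0 mulr_ge0// /hitail; case: ifP => // _.
  by rewrite mulr_ge0 ?exprn_ge0 ?len_ge0 ?vnorm_ge0.
apply: le_trans (ler_wpM2l (ler0n _ 2) (truncation_tail k u0));
  rewrite mulrA ler_wpM2r ?vnorm_ge0//.
rewrite /omega; have := mulr_ge0 (sqr_ge0 (len R k)) (ltW (_ : 0 < len R k - N)).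
rewrite subr_gt0 => /(_ h); lra.
Qed.

(** The part of the energy without [a2] splits into the distance of the data,
    with the factor [(1 + N)^2] of [omega_cube], and the high frequencies of
    [u0], whose factor must be free of [N] because [tau] is fixed before [N].
    The part with [a2] takes the H^4 norms of both terms. *)
Lemma initial_energy (a2 : R) (w0 u0 : coeffs R 3) (M d B4 tau : R) (D : {fset K}) :
  0 <= a2 -> w0 0 = 0 -> u0 0 = 0 ->
  l2le (fun k => len R k ^+ 3 * vnorm (u0 k)) M ->
  l2le (fun k => len R k ^+ 3 * vnorm (w0 k - u0 k)) d ->
  l2le (fun k => len R k ^+ 4 * vnorm (w0 k)) B4 ->
  l2le (hitail N u0) tau ->
  \sum_(k <- D) om k ^+ 2 * (1 + a2 * len R k ^+ 2) * vnorm (w0 k - truncate N u0 k) ^+ 2 <=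
  2 * (1 + N) ^+ 2 * d ^+ 2 + 8 * tau ^+ 2
  + a2 * (2 * (1 + N) ^+ 2 * (B4 ^+ 2 + 4 * N ^+ 2 * M ^+ 2)).
Proof.
move=> a0 w00 u00 uM wd wB ut; have n1 : 1 <= N := N1; have n0 : 0 <= N by lra.
have P0 : 0 <= 2 * (1 + N) ^+ 2 by rewrite mulr_ge0 ?sqr_ge0.
have [_ /(_ D) h1] := uM; have [_ /(_ D) h2] := wd; have [_ /(_ D) h3] := wB;
  have [_ /(_ D) h4] := ut.
have N2 : 0 <= 4 * N ^+ 2 by rewrite mulr_ge0 ?sqr_ge0.
apply: le_trans (lerD (lerD (ler_wpM2l P0 h2) (ler_wpM2l (ler0n _ 8) h4))
  (ler_wpM2l a0 (ler_wpM2l P0 (lerD h3 (ler_wpM2l N2 h1))))).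
rewrite [leRHS](_ : _ = \sum_(k <- D)
   (2 * (1 + N) ^+ 2 * (len R k ^+ 3 * vnorm (w0 k - u0 k)) ^+ 2 + 8 * hitail N u0 k ^+ 2
   + a2 * (2 * (1 + N) ^+ 2 * ((len R k ^+ 4 * vnorm (w0 k)) ^+ 2
        + 4 * N ^+ 2 * (len R k ^+ 3 * vnorm (u0 k)) ^+ 2)))); last first.
  by rewrite 2!big_split/= -!mulr_sumr big_split/= -mulr_sumr.
apply: ler_sum => k _.
have [->|k0] := eqVneq k 0.
  rewrite w00 /truncate u00 scaler0 subr0 vnorm0 expr0n !mulr0 expr0n !mulr0 !addr0 !mulr0
    addr0 add0r.
  exact: mulr_ge0 (ler0n _ 8) (sqr_ge0 _).
have l1 := len_ge1 R k0; have l0 : 0 <= len R k by lra.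
have oc := omega_cube n0 l1; have o0 := omega_ge0 n0 l0.
have p1 : om k ^+ 2 * vnorm (w0 k - truncate N u0 k) ^+ 2 <=
   2 * (1 + N) ^+ 2 * (len R k ^+ 3 * vnorm (w0 k - u0 k)) ^+ 2 + 8 * hitail N u0 k ^+ 2.
  have e : w0 k - truncate N u0 k =
    (w0 k - u0 k) + (u0 k - truncate N u0 k) by rewrite addrA subrK.
  have q1 := ler_wpM2l (sqr_ge0 (om k)) (sqr_vnormD (w0 k - u0 k) (u0 k - truncate N u0 k)).
  rewrite -e in q1.
  have q2 := sqr_mono (mulr_ge0 o0 (vnorm_ge0 _)) (omega_truncation_tail k u00).
  have q3 := sqr_mono (mulr_ge0 o0 (vnorm_ge0 _)) (ler_wpM2r (vnorm_ge0 (w0 k - u0 k)) oc).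
  by move: q1 q2 q3; rewrite !exprMn; clear; lra.
have p2 : om k ^+ 2 * len R k ^+ 2 * vnorm (w0 k - truncate N u0 k) ^+ 2 <=
   2 * (1 + N) ^+ 2 * ((len R k ^+ 4 * vnorm (w0 k)) ^+ 2 + 4 * N ^+ 2 * (len R k ^+ 3 *
     vnorm (u0 k)) ^+ 2).
  have q1 := sqr_vnormB (w0 k) (truncate N u0 k).
  have q2 := sqr_mono o0 oc.
  have nt : 0 <= len R k ^+ 4 * vnorm (truncate N u0 k) by rewrite mulr_ge0 ?exprn_ge0
    ?vnorm_ge0.
  have q3 := sqr_mono nt (truncate_len4 N1 u0 k).
  have q4 := ler_wpM2r (mulr_ge0 (sqr_ge0 (len R k)) (sqr_ge0 (vnorm (w0 k - truncate N u0
    k)))) q2.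
  have q5 := ler_wpM2l (mulr_ge0 (sqr_ge0 (1 + N)) (sqr_ge0 (len R k ^+ 4))) q1.
  have q6 := ler_wpM2l (sqr_ge0 (1 + N)) q3.
  move: q4 q5 q6; rewrite !exprMn; clear; lra.
have := ler_wpM2l a0 p2; move: p1; clear; lra.
Qed.
End CutoffEstimates.

(** * Convergence *)

Section Convergence.
Variable R : realType.
Local Notation K := ('rV[int]_3).

Lemma choose_tau (M g : R) : 0 <= M -> 0 < g -> g <= 1 ->
  exists tau : R, [/\ 0 < tau, tau <= g & 8 * tau ^+ 2 + 128 * 100 * M * tau <= g / 8].
Proof.
move=> M0 g0 g1.
pose Z := 64 + 8 * (128 * 100) * M.
have Z1 : 64 <= Z.
  by rewrite /Z lerDl mulr_ge0// mulr_ge0// mulr_ge0// ler0n.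
have Z0 : 0 < Z by lra.
have t0 : 0 < g / Z by exact: divr_gt0.
have tg : g / Z <= g by rewrite ler_pdivrMr// ler_peMr ?ltW//; lra.
exists (g / Z); split => //.
have tZ : (g / Z) * Z = g by rewrite divfK// gt_eqF.
move: (g / Z) t0 tg tZ => x x0 xg xZ.
have x1 : x ^+ 2 <= x by rewrite expr2; apply: ler_piMr; [exact: ltW|lra].
by move: xZ x1; rewrite /Z; clear; lra.
Qed.

Lemma le_hnorm3 (w : coeffs R 3) (e : R) : 0 <= e ->
  (forall D : {fset K}, \sum_(k <- D) (len R k ^+ 3 * vnorm (w k)) ^+ 2 <= e ^+ 2) ->
  (hnorm 3 w <= e%:E)%E.
Proof. by move=> e0 h; apply/(@hnorm_l2le R 3 3). Qed.

(** The truncation error [v - u - w] is itself at most [tau] in H^3. *)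
Lemma sobolev_distance (N : R) (v u : coeffs R 3) (tau b : R) (D : {fset K}) :
  1 <= N -> u 0 = 0 -> l2le (hitail N u) tau ->
  \sum_(k <- D) (omega N (len R k) * vnorm (v k - truncate N u k)) ^+ 2 <= b ->
  \sum_(k <- D) (len R k ^+ 3 * vnorm (v k - u k)) ^+ 2 <= 2 * b + 2 * tau ^+ 2.
Proof.
move=> N1 u0 [_ /(_ D) ut] hb; have N0 : 0 <= N by lra.
apply: le_trans (lerD (ler_wpM2l (ler0n _ 2) hb) (ler_wpM2l (ler0n _ 2) ut)).
rewrite !mulr_sumr -big_split/=; apply: ler_sum => k _.
have l0 := len_ge0 R k; have l3 := exprn_ge0 3 l0.
have e : v k - u k = (v k - truncate N u k) - (u k - truncate N u k) by rewrite opprB addrA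
  subrK.
have q1 := ler_wpM2l (sqr_ge0 (len R k ^+ 3)) (sqr_vnormB (v k - truncate N u k) (u k -
  truncate N u k)).
rewrite -e in q1.
have q2 := sqr_mono (mulr_ge0 l3 (vnorm_ge0 _)) (truncation_tail N1 k u0).
have q3 := sqr_mono (mulr_ge0 l3 (vnorm_ge0 _))
  (ler_wpM2r (vnorm_ge0 (v k - truncate N u k)) (cube_le_omega N0 l0)).
by move: q1 q2 q3; rewrite !exprMn; clear; lra.
Qed.

Variables (T : R) (u du : R -> coeffs R 3) (pu : R -> K -> R[i]).
Hypotheses (T0 : 0 < T) (uC : C0Hs T 3 u) (uC1 : C1Hs T 2 u du).
Hypothesis umodes : forall t, t \in `[0, T] -> solves_modes 0 0 (u t) (du t) (pu t).

(** The order of choice matters: [g] bounds [E(0) + eta] as required by the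
    target [e]; then [tau] and hence [N] depend only on [g] and [u]; only then
    [rho] beats the coefficients that grow with [N].  The auxiliary [s] bounds
    both [alpha] and [alpha] times the H^4 norm of the data. *)
Lemma uniform_stability (e : R) : 0 < e -> exists2 rho : R, 0 < rho &
  forall (alpha nu d s : R) (v dv : R -> coeffs R 3) (pv : R -> K -> R[i]) (B4 : R),
  0 < nu -> nu <= rho -> d <= rho -> 0 <= s -> s <= rho ->
  alpha ^+ 2 <= s ^+ 2 -> alpha ^+ 2 * B4 ^+ 2 <= s ^+ 2 ->
  C1Hs T 4 v dv ->
  (forall t, t \in `[0, T] -> solves_modes (alpha ^+ 2) nu (v t) (dv t) (pv t)) ->
  l2le (fun k => len R k ^+ 3 * vnorm (v 0 k - u 0 k)) d ->
  l2le (fun k => len R k ^+ 4 * vnorm (v 0 k)) B4 ->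
  forall t, t \in `[0, T] -> (hnorm 3 (v t - u t)%R <= e%:E)%E.
Proof.
move=> e0.
have [M M0 uM] := @C0Hs_bound R T 3 u isT uC.
have [M' M'0 duM] : exists2 M' : R, 0 <= M' & forall t, t \in `[0, T] ->
    l2le (fun k => len R k ^+ 2 * vnorm (du t k)) M'.
  by apply: (@C0Hs_bound R T 2 du isT); case: uC1.
pose C := 4 * (96 * 100 * (1 + M)).
pose E := expR (C * T).
have E0 : 0 < E by exact: expR_gt0.
have [g [g0 g1 gE ge]] : exists g : R, [/\ 0 < g, g <= 1, g * E <= 1 / 2 &
    4 * (g * E) + 2 * g <= e ^+ 2].
  have e2 : 0 < e ^+ 2 by exact: exprn_gt0.
  pose Z := 1 + 2 * E + (4 * E + 2) / e ^+ 2.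
  have q0 : 0 <= (4 * E + 2) / e ^+ 2 by rewrite divr_ge0 ?ltW//; lra.
  have Z0 : 0 < Z by rewrite /Z; lra.
  exists Z^-1; split; first by rewrite invr_gt0.
  - by rewrite invf_le1// /Z; lra.
  - by rewrite mulrC ler_pdivrMr// /Z; lra.
  - have -> : 4 * (Z^-1 * E) + 2 * Z^-1 = (4 * E + 2) / Z by field; rewrite gt_eqF.
    rewrite ler_pdivrMr//.
    have -> : 4 * E + 2 = e ^+ 2 * ((4 * E + 2) / e ^+ 2) by field; rewrite gt_eqF.
    by rewrite ler_pM2l// /Z; lra.
have [tau [tau0 taug taub]] := choose_tau M0 g0 g1.
have [N N1 utau] := high_frequencies uC tau0.
have N0 : 0 <= N by lra.
pose Z := 2 * (1 + N) ^+ 2 + 2 * (1 + N) ^+ 2 * (1 + 4 * N ^+ 2 * M ^+ 2) + 12 * N ^+ 3 * (M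
  + M').
have p1 : 0 <= 2 * (1 + N) ^+ 2 by rewrite mulr_ge0 ?sqr_ge0.
have p2 : 0 <= 4 * N ^+ 2 * M ^+ 2 by rewrite mulr_ge0 ?sqr_ge0// mulr_ge0 ?sqr_ge0.
have p2' : 0 <= 2 * (1 + N) ^+ 2 * (1 + 4 * N ^+ 2 * M ^+ 2).
  exact: mulr_ge0 p1 (addr_ge0 ler01 p2).
have p3 : 0 <= 12 * N ^+ 3 by rewrite mulr_ge0 ?exprn_ge0.
have p3' : 0 <= 12 * N ^+ 3 * (M + M') by exact: mulr_ge0 p3 (addr_ge0 M0 M'0).
have Z0 : 0 <= Z by rewrite /Z !addr_ge0.
have rho0 : 0 < g / (2 * (1 + Z)) by rewrite divr_gt0//; lra.
exists (g / (2 * (1 + Z))) => //.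
have rhoZ : Z * (g / (2 * (1 + Z))) <= g / 2.
  have -> : Z * (g / (2 * (1 + Z))) = (g / 2) * (Z / (1 + Z)) by field; lra.
  by apply: ler_piMr; [lra|rewrite ler_pdivrMr ?mul1r; lra].
have rho1 : g / (2 * (1 + Z)) <= 1 by rewrite ler_pdivrMr ?mul1r; lra.
move: (g / (2 * (1 + Z))) rho0 rhoZ rho1 => rho rho0 rhoZ rho1.
move=> alpha nu d s v dv pv B4 nu0 nur dr s0 sr a2s a2B vC1 vmodes vd vB t tT.
have itv0 : (0 : R) \in `[0, T] by rewrite in_itv/= lexx ltW.
have d0 : 0 <= d by case: vd.
have a20 : 0 <= alpha ^+ 2 by exact: sqr_ge0.
have sqle (x : R) : 0 <= x -> x <= rho -> x ^+ 2 <= rho.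
  move=> x0 xr; have x1 := le_trans xr rho1; rewrite expr2.
  exact: le_trans (ler_piMr x0 x1) xr.
have d2 := sqle _ d0 dr; have s2 := sqle _ s0 sr.
pose E1 := 2 * (1 + N) ^+ 2 * d ^+ 2 + 8 * tau ^+ 2
  + alpha ^+ 2 * (2 * (1 + N) ^+ 2 * (B4 ^+ 2 + 4 * N ^+ 2 * M ^+ 2)).
have uz s' : s' \in `[0, T] -> u s' 0 = 0 by move=> /uC.1[[h _ _] _].
have vz : v 0 0 = 0 by case: vC1 => -[vH _] _ _; have [[h _ _] _] := vH 0 itv0.
have init := fun D => initial_energy N1 D a20 vz (uz 0 itv0) (uM 0 itv0) vd vB (utau 0 itv0).
(* 3 del = g / 8, and tau contributes g / 8; the terms in rho take g / 2. *)
pose del := g / 24.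
have del0 : 0 < del by rewrite /del; lra.
have del1 : del <= 1 by rewrite /del; lra.
have del01 : 0 < del <= 1 by rewrite del0.
pose eta := 3 * del + (128 * 100 * M * tau + 12 * N ^+ 3 * (nu * M + alpha ^+ 2 * M')).
have total : E1 + eta <= g.
  have t1 : E1 <= 2 * (1 + N) ^+ 2 * rho + 8 * tau ^+ 2
     + 2 * (1 + N) ^+ 2 * (1 + 4 * N ^+ 2 * M ^+ 2) * rho.
    have q1 := ler_wpM2l p1 d2.
    have q2 : alpha ^+ 2 * (2 * (1 + N) ^+ 2 * (B4 ^+ 2 + 4 * N ^+ 2 * M ^+ 2)) <=
       2 * (1 + N) ^+ 2 * (1 + 4 * N ^+ 2 * M ^+ 2) * rho.
      have -> : alpha ^+ 2 * (2 * (1 + N) ^+ 2 * (B4 ^+ 2 + 4 * N ^+ 2 * M ^+ 2)) =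
        2 * (1 + N) ^+ 2 * (alpha ^+ 2 * B4 ^+ 2 + 4 * N ^+ 2 * M ^+ 2 * alpha ^+ 2) by ring.
      rewrite -[leRHS]mulrA ler_wpM2l// [leRHS]mulrDl mul1r; apply: lerD;
        first exact: le_trans a2B s2.
      by rewrite ler_wpM2l//; exact: le_trans a2s s2.
    by rewrite /E1; move: q1 q2; clear; lra.
  have t2 : 12 * N ^+ 3 * (nu * M + alpha ^+ 2 * M') <= 12 * N ^+ 3 * (M + M') * rho.
    rewrite -[leRHS]mulrA ler_wpM2l// [leRHS]mulrDl; apply: lerD;
      rewrite [leLHS]mulrC ler_wpM2l//.
    exact: le_trans a2s s2.
  by move: t1 t2 rhoZ taub g0; rewrite /eta /del /Z; clear; lra.
have eta1 : eta <= 1.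
  have : 0 <= E1.
    have := init fset0; rewrite big_seq_fset0; exact.
  by move=> h; move: total g1 h; clear; lra.
have small : (E1 + eta) * E <= g * E by rewrite ler_wpM2r// ltW.
have := voigt_euler_distance N1 T0 a20 (ltW nu0) uC uC1 vC1 umodes vmodes uM duM utau init
  del01 eta1 (le_trans small gE) tT.
rewrite -/eta -/C -/E -/E1 => hD.
apply: le_hnorm3; first exact: ltW.
move=> D; have := sobolev_distance N1 (uz t tT) (utau t tT) (hD D).
move/le_trans; apply.
have tt : tau ^+ 2 <= g.
  by rewrite expr2; exact: le_trans (ler_piMr (ltW tau0) (le_trans taug g1)) taug.
by move: tt small ge; clear; lra.
Qed.
End Convergence.

(** It remains to choose [alpha n], small enough to make both [alpha n] and
    [alpha n] times the H^4 norm of the initial datum at most 1 / (n + 1). *)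
Theorem theorem4p1 (R : realType) (T : R) (u0 : coeffs R 3)
    (u : R -> coeffs R 3) (u0b : R -> coeffs R 3)
    (v : R -> R -> R -> R -> coeffs R 3)
    (T_gt0 : 0 < T)
    (u0_H3 : Hs 3 u0)
    (u_sol : euler_solution T u0 u)
    (u0b_H4 : forall beta : R, 0 < beta -> Hs 4 (u0b beta))
    (u0b_cvg : (fun beta : R => hnorm 3 (u0b beta - u0)) @ 0^'+ --> 0%E)
    (v_sol : forall alpha beta nu : R, 0 < alpha -> 0 < beta -> 0 < nu ->
       nsv_solution alpha nu T (u0b beta) (v alpha beta nu)) :
  forall beta nu : nat -> R,
    (forall n, 0 < beta n) -> (forall n, 0 < nu n) ->
    beta @ \oo --> (0 : R) -> nu @ \oo --> (0 : R) ->
  exists alpha : nat -> R,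
    [/\ forall n, 0 < alpha n,
        alpha @ \oo --> (0 : R)
      & (fun n => ereal_sup [set hnorm 3 (v (alpha n) (beta n) (nu n) t - u t)
                            | t in `]0, T[]) @ \oo --> 0%E].
Proof.
move=> beta nu beta_gt0 nu_gt0 beta_cvg nu_cvg.
have [u_init uC [du [p [uC1 pS eqn]]]] := u_sol.
have umodes := euler_modes uC uC1 pS eqn.
have itv0 : (0 : R) \in `[0, T] by rewrite in_itv/= lexx ltW.
have H4 n : exists B4 : R, [/\ 0 <= B4, hnorm 4 (u0b (beta n)) = B4%:E &
    l2le (fun k => len R k ^+ 4 * vnorm (u0b (beta n) k)) B4].
  by apply: (@hnorm_lty R 3 4) => //; have [[_ _ h] _] := u0b_H4 _ (beta_gt0 n).
have [B4 hB4] := boolp.choice H4.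
have B40 n : 0 <= B4 n by have [] := hB4 n.
pose s n : R := n.+1%:R^-1.
have s0 n : 0 < s n by rewrite invr_gt0 ltr0n.
pose alpha n := s n / (1 + B4 n).
have den n : 0 < 1 + B4 n by rewrite ltr_pwDl.
have alpha_gt0 n : 0 < alpha n by exact: divr_gt0.
have alpha_s n : alpha n <= s n.
  by rewrite ler_pdivrMr//; apply: ler_peMr; [exact: ltW|rewrite lerDl].
have alphaB n : alpha n * B4 n <= s n.
  rewrite /alpha mulrAC ler_pdivrMr//; apply: ler_wpM2l; [exact: ltW|lra].
have s_cvg : s @ \oo --> (0 : R) by exact: cvg_harmonic.
exists alpha; split => //.
  apply: (squeeze_cvgr _ (cvg_cst 0) s_cvg).
  by near=> n; rewrite alpha_s ltW.
apply: squeeze_cvge0 => e e0.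
have [rho rho0 hrho] := uniform_stability T_gt0 uC uC1 umodes e0.
have [b b0 hb] : exists2 b : R, 0 < b & forall x : R, 0 < x -> x < b ->
    l2le (fun k => len R k ^+ 3 * vnorm (u0b x k - u0 k)) rho.
  have /nbhs_ballP[b /= b0 h] : nbhs (0 : R) (fun x => 0 < x ->
      l2le (fun k => len R k ^+ 3 * vnorm ((u0b x - u0) k)) rho).
    exact: (hnorm_near _ (isT : (0 < 3)%N) rho0 u0b_cvg).
  exists b => // x x0 xb; apply: (h x) => //.
  by rewrite /ball/= sub0r normrN gtr0_norm.
near=> n.
have small_beta : beta n < b.
  near: n; have /cvgrPdist_lt/(_ b b0) := beta_cvg.
  by apply: filterS => n; rewrite sub0r normrN; apply: le_lt_trans; exact: ler_norm.
have small_nu : nu n <= rho.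
  near: n; have /cvgrPdist_le/(_ rho rho0) := nu_cvg.
  by apply: filterS => n; rewrite sub0r normrN; apply: le_trans; exact: ler_norm.
have small_s : s n <= rho.
  near: n; have /cvgrPdist_le/(_ rho rho0) := s_cvg.
  by apply: filterS => n; rewrite sub0r normrN; apply: le_trans; exact: ler_norm.
have [v_init [dv [q [vC1 qS veqn]]]] := v_sol _ _ _ (alpha_gt0 n) (beta_gt0 n) (nu_gt0 n).
have vmodes := nsv_modes vC1 qS veqn.
have [_ _ hB] := hB4 n.
have bound t : t \in `[0, T] -> (hnorm 3 (v (alpha n) (beta n) (nu n) t - u t)%R <= e%:E)%E.
  apply: (hrho _ _ rho (s n) _ _ _ (B4 n) (nu_gt0 n) small_nu (lexx _) (ltW (s0 n)) small_s _
    _ vC1 vmodes).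
  - by apply: sqr_mono => //; exact: ltW.
  - by rewrite -exprMn; apply: sqr_mono => //; exact: mulr_ge0 (ltW (alpha_gt0 n)) (B40 n).
  - by rewrite v_init u_init; exact: hb.
  - by rewrite v_init.
apply/andP; split.
  apply: (@le_trans _ _ (hnorm 3 (v (alpha n) (beta n) (nu n) (T / 2) - u (T / 2))%R)).
    exact: sqrte_ge0.
  apply: ereal_sup_ubound; exists (T / 2) => //=.
  by rewrite in_itv/=; apply/andP; split; lra.
apply: ge_ereal_sup => _ [t tI <-]; apply: bound.
by move: tI; rewrite /= !in_itv/= => /andP[/ltW -> /ltW ->].
Unshelve. all: by end_near.
Qed.
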